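(* For each $\varepsilon>0$ there is an effectively computable constant $N(\varepsilon)>0$ such that for all integers $n\geq N(\varepsilon)$, $$\frac{\sqrt{6}}{\pi}\sqrt{n}\,p(n)<\mathrm{spt}(n)<\left(\frac{\sqrt{6}}{\pi}+\varepsilon\right)\sqrt{n}\,p(n).$$
   Context: $p(n)$ is the number of integer partitions of $n$. $\mathrm{spt}(n)$ is the total number of smallest parts among all partitions of $n$, counted with multiplicity; equivalently $\sum_{n\ge1}\mathrm{spt}(n)q^n=\sum_{n\ge1}\frac{q^n}{(1-q^n)^2(q^{n+1};q)_\infty}$. *)

(* Defs.v *)
From mathcomp Require Import all_boot.

Set Implicit Arguments.
Unset Strict Implicit.
Unset Printing Implicit Defensive.

Definition is_partition (n : nat) (s : seq nat) : bool :=
  [&& sorted geq s, 0 \notin s & sumn s == n].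

(* A partition of n has at most n parts, each at most n, so the finite type of
   sequences of length <= n over {0, ..., n} contains all of them; see
   [is_partition_bseq]. *)
Definition parts (n : nat) (s : n.-bseq 'I_n.+1) : seq nat := map val s.

Lemma is_partition_bseq (n : nat) (s : seq nat) :
  is_partition n s -> exists t : n.-bseq 'I_n.+1, parts t = s.
Proof.
move=> /and3P[_ s0 /eqP sn].
have size_s : size s <= n.
  rewrite -sn; elim: s s0 {sn} => //= x s IHs.
  rewrite inE negb_or eq_sym -lt0n => /andP[x0 /IHs le_s].
  by rewrite -add1n leq_add.
have le_s x : x \in s -> x <= n.
  rewrite -sn; elim: s {s0 size_s sn} => //= y s IHs.
  rewrite inE => /orP[/eqP->|/IHs le_x]; first exact: leq_addr.
  exact: leq_trans le_x (leq_addl _ _).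
have size_t : size [seq inord x : 'I_n.+1 | x <- s] <= n by rewrite size_map.
exists (Bseq size_t); rewrite /parts /= -map_comp -[RHS]map_id.
by apply/eq_in_map => x xs /=; rewrite inordK // ltnS le_s.
Qed.

Definition npartitions (n : nat) : nat :=
  #|[set s : n.-bseq 'I_n.+1 | is_partition n (parts s)]|.

(* The parts are listed in nonincreasing order, so the smallest is the last. *)
Definition num_smallest_parts (s : seq nat) : nat := count_mem (last 0 s) s.

Definition spt (n : nat) : nat :=
  \sum_(s : n.-bseq 'I_n.+1 | is_partition n (parts s))
    num_smallest_parts (parts s).

(* Kleene's general recursive functions, i.e. the total computable functions
   nat^n -> nat: [rec_mu] is minimization restricted to the case where a zero
   always exists. *)
Inductive recursive : forall n : nat, (n.-tuple nat -> nat) -> Prop :=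
| rec_zero n : recursive (fun _ : n.-tuple nat => 0)
| rec_succ : recursive (fun x : 1.-tuple nat => (thead x).+1)
| rec_proj n (i : 'I_n) : recursive (fun x : n.-tuple nat => tnth x i)
| rec_comp m n (g : m.-tuple nat -> nat) (h : 'I_m -> n.-tuple nat -> nat) :
    recursive g -> (forall i, recursive (h i)) ->
    recursive (fun x : n.-tuple nat => g [tuple h i x | i < m])
| rec_prim n (g : n.-tuple nat -> nat) (h : n.+2.-tuple nat -> nat)
    (f : n.+1.-tuple nat -> nat) :
    recursive g -> recursive h ->
    (forall x : n.-tuple nat, f [tuple of 0 :: x] = g x) ->
    (forall (k : nat) (x : n.-tuple nat), f [tuple of k.+1 :: x]
                 = h [tuple of k :: [tuple of f [tuple of k :: x] :: x]]) ->
    recursive f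
| rec_mu n (g : n.+1.-tuple nat -> nat) (f : n.-tuple nat -> nat) :
    recursive g ->
    (forall x : n.-tuple nat, g [tuple of f x :: x] = 0) ->
    (forall (x : n.-tuple nat) (k : nat), k < f x -> g [tuple of k :: x] <> 0) ->
    recursive f.

(* Main.v *)
Require Import Defs.
From HB Require Import structures.
From mathcomp Require Import all_boot all_order all_algebra.
From mathcomp Require Import all_classical all_reals all_analysis.
From mathcomp Require Import complex ring lra zify.

(** Put w_m(n) for the number of occurrences of m in all partitions of n with
    parts >= m; then spt(n) is the sum of the w_m(n), and splitting each smallest
    part i + 1 >= 3 into i and 1 shows w_1 + w_2 <= spt <= w_1 + 2 p.

    Let t = pi / sqrt (6 n), q = e^-t and z = q e^(i a).  The coefficients of
    P(z) h(z), with P the partition generating function, are read off by averaging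
    over roots of unity.  Writing P(z) e^(-i n a) = P(q) rho(a) e^(i phi(a)), the
    modulus rho is exponentially small unless a = O(t^(7/5)), and there phi is
    small; so if Re (e^(i phi) h) >= - kappa for these a, then the n-th coefficient
    of P h is at least about - 2 kappa p(n), and no Gaussian integral is needed.

    The function h(z) = 1 / (1 - z) - 1 / 2 - g sum_i i z^i / (1 - z^i) gives the
    coefficient w_1(n) + p(n) / 2 - g n p(n), because z P'(z) = P(z) sum_i ...
    The constant g is chosen so that the linear term of h at z = q vanishes; its
    quadratic term is then nonnegative up to a negligible error since
    coth y >= 1 / y.  Hence w_1 / p >= 1 / t - 1 / 2 + g (n - M) - o(1), with
    M = sum_i i q^i / (1 - q^i) = sum_j 1 / (2 sinh (j t / 2)) ^ 2.  As
    sinh y > y and n = zeta(2) / t^2, the difference n - M is at least a constant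
    times 1 / t while g is of order t, so the correction is bounded below by a
    positive constant.  Since w_2 / p tends to 1 / 2, the strict lower bound
    follows; the upper bound only uses cruder estimates.

    All error terms are expressed in powers of v = t^(1/5). *)

(** The claimed lower bound is exactly the main term, since 1 / t = sqrt 6 / pi * sqrt n, so the
    theorem rests on the sign of the bounded term of spt(n) / p(n): an error o(1) is needed beside a
    main term that tends to infinity. Comparing w_1(n) with p(n) itself, instead of expanding both,
    removes their common factor. The obstacle is that 1 / (1 - z) varies by about a / t^2 along the
    arc, which is unbounded at a = t^(7/5). Subtracting g times the Lambert series cancels this
    variation at no cost, because the coefficient n p(n) is exact. The exponent 7/5 obeys two
    constraints: the cubic error a^3 / t^4 of the phase must tend to 0, so a stays below t^(4/3),
    and the decay a^2 / t^3 of log rho must tend to infinity at the cutoff, so a exceeds t^(3/2).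
    All objects are finite: each 1 / (1 - X^i) is truncated at J terms, the product at m factors,
    and the contour is a set of roots of unity. With m fixed, J and the number of sample points
    grow, and a lower bound valid for every sample size survives the limit. *)

Import Order.TTheory GRing.Theory Num.Theory ComplexField.Normc.
Import numFieldNormedType.Exports.

Set Implicit Arguments.
Unset Strict Implicit.
Unset Printing Implicit Defensive.

(** * Partitions by smallest part *)

(* k is a recursion bound; see plist_fuel. *)
Fixpoint plist (k m n : nat) : seq (seq nat) :=
  if k is k'.+1 then
    if n == 0 then [:: [::]]
    else if m <= n then
      [seq rcons s m | s <- plist k' m (n - m)] ++ plist k' m.+1 n
    else [::]
  else [::].

Lemma plistS k m n : plist k.+1 m n =
  if n == 0 then [:: [::]]
  else if m <= n then
    [seq rcons s m | s <- plist k m (n - m)] ++ plist k m.+1 n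
  else [::].
Proof. by []. Qed.

(** The quantity n + (n.+1 - m) drops both when a part m is removed and when m is raised, so any
    fuel above it yields the same list. *)
Lemma plist_fuel k k' m n : 0 < m -> n + (n.+1 - m) < k ->
  n + (n.+1 - m) < k' -> plist k m n = plist k' m n.
Proof.
elim: k k' m n => [//|k IH] [//|k'] m n m0 lt_k lt_k' /=.
case: eqP => [//|n0]; case: leqP => [le_mn|//].
congr (map _ _ ++ _); apply: IH; lia.
Qed.

Definition partitions_ge m n := plist (n.*2).+2 m n.
Definition npart_ge m n := size (partitions_ge m n).

Lemma partitions_geE m n : 0 < m -> 0 < n -> m <= n ->
  partitions_ge m n =
  [seq rcons s m | s <- partitions_ge m (n - m)] ++ partitions_ge m.+1 n.
Proof.
move=> m0 n0 le_mn; rewrite {1}/partitions_ge plistS.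
rewrite gtn_eqF // le_mn.
by congr (map _ _ ++ _); rewrite /partitions_ge; apply: plist_fuel; lia.
Qed.

Lemma partitions_ge0 m : partitions_ge m 0 = [:: [::]].
Proof. by []. Qed.

Lemma partitions_ge_small m n : 0 < n < m -> partitions_ge m n = [::].
Proof.
move=> /andP[n0 lt_nm]; rewrite /partitions_ge /=.
by rewrite eqn0Ngt n0 leqNgt lt_nm.
Qed.

Lemma partitions_ge_ind (P : nat -> nat -> Prop) :
  (forall m, 0 < m -> P m 0) ->
  (forall m n, 0 < n < m -> P m n) ->
  (forall m n, 0 < m <= n -> P m (n - m) -> P m.+1 n -> P m n) ->
  forall m n, 0 < m -> P m n.
Proof.
move=> P0 Psmall Pind m n m0.
have [k] := ubnP (n + (n.+1 - m)); elim: k m n m0 => // k IH m n m0 ltk.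
have [->|n0] := posnP n; first exact: P0.
have [le_mn|lt_nm] := leqP m n; last by apply: Psmall; rewrite n0.
apply: Pind; first by rewrite m0.
- by apply: IH => //; lia.
- by apply: IH => //; lia.
Qed.

Definition is_partition_ge m n s :=
  [&& sorted geq s, all (leq m) s & sumn s == n].

Lemma sorted_geq_rcons s m :
  sorted geq (rcons s m) = sorted geq s && all (leq m) s.
Proof.
have geqT : transitive geq by move=> y x z /= h1 h2; apply: leq_trans h2 h1.
rewrite -[rcons s m]revK rev_rcons rev_sorted /=.
rewrite (path_sortedE leq_trans) all_rev andbC; congr andb.
by rewrite -rev_sorted revK.
Qed.

Lemma sumn_ge_all m s : all (leq m) s -> s != [::] -> m <= sumn s.
Proof. by case: s => //= x s /andP[le_mx _] _; apply: leq_trans le_mx (leq_addr _ _). Qed.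

Lemma mem_partitions_ge m n s : 0 < m ->
  (s \in partitions_ge m n) = is_partition_ge m n s.
Proof.
move=> m0; move: m n m0 s.
apply: partitions_ge_ind => [m m0 s|m n /andP[n0 ltnm] s|m n /andP[m0 le_mn] IH1 IH2 s].
- rewrite partitions_ge0 inE; apply/eqP/and3P => [->//|[_ al /eqP s0]].
  apply/eqP/negPn/negP => sn; have := sumn_ge_all al sn; lia.
- rewrite partitions_ge_small ?n0 // in_nil; apply/esym/negbTE/and3P => -[_ al /eqP sn].
  have s0 : s != [::] by apply/eqP => s0; rewrite s0 /= in sn; lia.
  have := sumn_ge_all al s0; lia.
- have n0 : 0 < n by lia.
  rewrite partitions_geE // mem_cat IH2; case: (lastP s) => [|s' x].
    rewrite /is_partition_ge /=; rewrite (_ : (0 == n) = false) ?orbF; last by lia.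
    by apply/negbTE/mapP => -[[|? ?]].
  have [->|nxm] := eqVneq x m.
    rewrite (mem_map (@rcons_injl _ m)) IH1.
    rewrite /is_partition_ge !sorted_geq_rcons !all_rcons leqnn ltnn /= andbF orbF.
    rewrite sumn_rcons.
    have -> : (sumn s' + m == n) = (sumn s' == n - m) by lia.
    by case: (all (leq m) s'); rewrite ?andbT ?andbF.
  rewrite (_ : (_ \in map _ _) = false); last first.
    by apply/negbTE/mapP => -[s1 _ /rcons_inj[_ e]]; rewrite e eqxx in nxm.
  rewrite /is_partition_ge !sorted_geq_rcons !all_rcons /=.
  case: (all (leq x) s') (@allP _ (leq x) s') => [al|]; last by rewrite !andbF.
  have -> : (m < x) = (m <= x) by rewrite ltn_neqAle eq_sym nxm.
  case: (leqP m x) => //= lt_mx; congr (_ && (_ && _)).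
  have al' := al isT.
  have -> : all (leq m) s' by apply/allP => y /al'; apply: leq_trans.
  by apply/allP => y /al'; apply: leq_trans; rewrite ltn_neqAle eq_sym nxm.
Qed.

Lemma uniq_partitions_ge m n : 0 < m -> uniq (partitions_ge m n).
Proof.
move: m n; apply: partitions_ge_ind => [//|m n h|m n /andP[m0 le_mn] u1 u2].
  by rewrite partitions_ge_small.
have n0 : 0 < n by lia.
rewrite partitions_geE // cat_uniq u2 (map_inj_uniq (@rcons_injl _ m)) u1.
rewrite /= andbT; apply/hasPn => s; rewrite mem_partitions_ge // => /and3P[_ al _].
by apply/mapP => -[s' _ e]; move: al; rewrite e all_rcons ltnn.
Qed.

Lemma partitions_ge1_perm n :
  perm_eq [seq parts s | s <- enum [set s : n.-bseq 'I_n.+1 | is_partition n (parts s)]]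
          (partitions_ge 1 n).
Proof.
have injp : injective (@parts n).
  by move=> s1 s2 /(inj_map val_inj); apply: val_inj.
apply: uniq_perm; first by rewrite map_inj_uniq ?enum_uniq.
  exact: uniq_partitions_ge.
have eqp s : is_partition n s = is_partition_ge 1 n s.
  rewrite /is_partition /is_partition_ge; congr [&& _, _ & _].
  apply/idP/allP => [s0 x xs|al]; last by apply/negP => /al.
  by rewrite lt0n; apply: contraNneq s0 => <-.
move=> s; rewrite mem_partitions_ge // -eqp; apply/mapP/idP => [[x]|ps].
  by rewrite mem_enum inE => ? ->.
have [x xs] := is_partition_bseq ps; exists x; last by [].
by rewrite mem_enum inE xs.
Qed.

Lemma npartitionsE n : npartitions n = npart_ge 1 n.
Proof.
by rewrite /npart_ge -(perm_size (partitions_ge1_perm n)) size_map -cardE.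
Qed.

Definition spt_ge m n := \sum_(s <- partitions_ge m n) num_smallest_parts s.
(** The quantity w_m(n) of the overview, that is, the contribution to spt(n) of the partitions with
    smallest part m. *)
Definition nmult m n := \sum_(s <- partitions_ge m n) count_mem m s.

Lemma sptE n : spt n = spt_ge 1 n.
Proof.
rewrite /spt_ge -(perm_big _ (partitions_ge1_perm n)) /= big_map big_enum_cond /=.
by rewrite /spt; apply: eq_bigl => s; rewrite inE andbT.
Qed.

Lemma npart_ge_rec m n : 0 < m ->
  npart_ge m n = npart_ge m.+1 n + (if m <= n then npart_ge m (n - m) else 0).
Proof.
move=> m0; rewrite /npart_ge; have [->|n0] := posnP n.
  by rewrite !partitions_ge0 leqn0 eqn0Ngt m0.
case: leqP => [le_mn|lt_nm].
  by rewrite partitions_geE // size_cat size_map addnC.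
by rewrite !partitions_ge_small ?n0 //= ltnS ltnW.
Qed.

Lemma npart_ge0 m : npart_ge m 0 = 1. Proof. by []. Qed.

Lemma npart_ge_small m n : 0 < n < m -> npart_ge m n = 0.
Proof. by move=> h; rewrite /npart_ge partitions_ge_small. Qed.

Lemma nmult_rec m n : 0 < m ->
  nmult m n = if m <= n then nmult m (n - m) + npart_ge m (n - m) else 0.
Proof.
move=> m0; rewrite /nmult; have [->|n0] := posnP n.
  by rewrite partitions_ge0 big_seq1 leqn0 eqn0Ngt m0.
case: leqP => [le_mn|lt_nm]; last by rewrite partitions_ge_small ?n0 // big_nil.
rewrite partitions_geE // big_cat big_map /= [X in _ + X]big1_seq ?addn0.
  under eq_bigr do rewrite -cats1 count_cat /= eqxx addn0.
  by rewrite big_split /= sum1_size.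
move=> s /andP[_]; rewrite mem_partitions_ge // => /and3P[_ al _].
by apply/count_memPn/negP => /(allP al); rewrite ltnn.
Qed.

Lemma spt_ge_rec m n : 0 < m -> spt_ge m n = nmult m n + spt_ge m.+1 n.
Proof.
move=> m0; rewrite /spt_ge nmult_rec //; have [->|n0] := posnP n.
  by rewrite !partitions_ge0 !big_seq1 leqn0 eqn0Ngt m0.
case: leqP => [le_mn|lt_nm]; last first.
  have e k : m <= k -> partitions_ge k n = [::].
    by move=> le_mk; rewrite partitions_ge_small ?n0 ?(leq_trans lt_nm).
  by rewrite !e // !big_nil.
rewrite partitions_geE // big_cat big_map /=; congr addn.
rewrite /nmult /npart_ge -sum1_size -big_split /=; apply: eq_bigr => s _.
by rewrite /num_smallest_parts last_rcons -cats1 count_cat /= eqxx addn0.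
Qed.

Lemma spt_ge_big m n : n < m -> spt_ge m n = 0.
Proof.
move=> lt_nm; rewrite /spt_ge; have [->|n0] := posnP n.
  by rewrite partitions_ge0 big_seq1.
by rewrite partitions_ge_small ?n0 // big_nil.
Qed.

(** The j-th copy of m is counted by the partitions with at least j copies, and removing j copies
    leaves a partition of n - j * m. The bound B only has to reach every possible j. *)
Lemma nmultE m n B : 0 < m -> n <= B * m ->
  nmult m n = \sum_(1 <= j < B.+1 | j * m <= n) npart_ge m (n - j * m).
Proof.
move=> m0; elim: B n => [|B IH] n le_n.
  by rewrite big_geq // nmult_rec // leqNgt (leq_ltn_trans le_n) // mul0n.
rewrite nmult_rec // big_mkcond big_ltn // mul1n; case: leqP => le_mn; last first.
  rewrite big1_seq // => j; rewrite mem_index_iota => /and3P[_ j2 _].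
  by case: leqP => //; nia.
rewrite (IH (n - m)); last by rewrite leq_subLR -mulSn.
rewrite addnC; congr addn; rewrite [RHS]big_add1 /= [LHS]big_mkcond.
apply: eq_big_nat => j _; rewrite mulSn -leq_subRL //.
by case: ifP => // _; congr npart_ge; lia.
Qed.

Lemma spt_ge_sum m n : 0 < m -> spt_ge m n = \sum_(m <= k < n.+1) nmult k n.
Proof.
move=> m0; have [d] := ubnP (n.+1 - m); elim: d m m0 => // d IH m m0 ltd.
have [lt_nm|le_mn] := ltnP n m; first by rewrite spt_ge_big // big_geq.
by rewrite spt_ge_rec // [RHS]big_ltn // IH //; lia.
Qed.

Lemma npart_ge_anti m n : 0 < m -> npart_ge m.+1 n <= npart_ge m n.
Proof. by move=> m0; rewrite (npart_ge_rec n m0) leq_addr. Qed.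

Lemma npart_ge_sub m n j : 0 < m -> j * m <= n ->
  npart_ge m (n - j * m) <= npart_ge m n.
Proof.
move=> m0; elim: j => [|j IH] le_jn; first by rewrite subn0.
apply: leq_trans (IH _); last by apply: leq_trans le_jn; rewrite mulSn leq_addl.
rewrite (npart_ge_rec (n - j * m) m0) ifT; last by rewrite mulSn in le_jn; lia.
by rewrite mulSn [m + _]addnC subnDA leq_addl.
Qed.

(** Adding j copies of i to a partition counted on the left gives a partition of k whose smallest
    part i occurs exactly j times, so different i never collide. *)
Lemma sum_npart_ge_mult j m B k : 0 < j -> 0 < m ->
  \sum_(m <= i < B | j * i <= k) npart_ge i.+1 (k - j * i) <= npart_ge m k.
Proof.
move=> j0 m0; have [d] := ubnP (B - m); elim: d m m0 => // d IH m m0 ltd.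
have [le_Bm|lt_mB] := leqP B m; first by rewrite big_geq.
rewrite big_mkcond big_ltn // -big_mkcond /= (npart_ge_rec k m0) addnC.
apply: leq_add; first by apply: IH; lia.
case: ifP => // le_jk; have le_mk : m <= k by nia.
rewrite le_mk; apply: leq_trans (npart_ge_anti _ m0) _.
rewrite (_ : k - j * m = k - m - j.-1 * m); last by nia.
by apply: npart_ge_sub => //; nia.
Qed.

Lemma npart_ge1_sum n : npart_ge 1 n = \sum_(0 <= j < n.+1) npart_ge 2 (n - j).
Proof.
elim: n => [|n IH]; first by rewrite big_nat1 !npart_ge0.
rewrite npart_ge_rec // big_nat_recl // subn0 subn1 IH; congr addn.
Qed.

(** Let p_2 count the partitions without ones. From n - 2 to n the left side grows by p_2(n - 2) and
    the right side by p_2(n) + p_2(n - 1), while p_2(n) >= p_2(n - 2) by inserting a part 2. *)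
Lemma nmult2_le n : nmult 2 n <= npart_ge 1 n.
Proof.
elim/ltn_ind: n => n IH; rewrite nmult_rec //; case: leqP => // le2n.
have -> : npart_ge 1 n = npart_ge 2 n + npart_ge 2 n.-1 + npart_ge 1 (n - 2).
  rewrite npart_ge_rec // (leq_trans _ le2n) // subn1.
  rewrite [npart_ge 1 n.-1]npart_ge_rec // addnA; congr (_ + _).
  by rewrite ifT; [congr npart_ge|]; lia.
have := IH (n - 2); have := npart_ge_rec n (isT : 0 < 2); rewrite le2n.
have lt : n - 2 < n by lia.
move=> e /(_ lt); lia.
Qed.

(* Each of the j copies of the smallest part i.+1 >= 3 is split as i + 1. *)
Lemma spt_ge3_le n : spt_ge 3 n <= npart_ge 1 n.
Proof.
rewrite spt_ge_sum //.
have -> : \sum_(3 <= k < n.+1) nmult k n =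
    \sum_(3 <= k < n.+1) \sum_(1 <= j < n.+1)
       (if j * k <= n then npart_ge k (n - j * k) else 0).
  apply: eq_big_nat => k /andP[k3 _]; rewrite (@nmultE k n n) ?big_mkcond //; nia.
(* For a fixed number j of split copies, the j new ones are set aside and the rest is a partition of
   n - j handled by [sum_npart_ge_mult]; summing over j sorts the partitions of n by their number of
   ones. *)
rewrite exchange_big /= npart_ge1_sum [leqRHS]big_ltn //.
apply: leq_trans (leq_addl _ _); rewrite !big_nat; apply: leq_sum => j /andP[j1 le_jn].
apply: leq_trans (@sum_npart_ge_mult j 2 n.+1 (n - j) j1 isT).
rewrite big_add1 /= [leqRHS]big_mkcond /=.
have [lt|le] := leqP 2 n; last by rewrite big_geq //; lia.
rewrite [leqRHS]big_nat_recr //=; apply: leq_trans (leq_addr _ _).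
rewrite !big_nat; apply: leq_sum => i _.
rewrite (_ : (j * i.+1 <= n) = (j * i <= n - j)); last by rewrite mulnS; lia.
by case: ifP => // _; rewrite mulnS subnDA.
Qed.

Lemma spt_lower n : nmult 1 n + nmult 2 n <= spt n.
Proof. by rewrite sptE spt_ge_rec // leq_add2l spt_ge_rec // leq_addr. Qed.

Lemma spt_upper n : spt n <= nmult 1 n + (npartitions n).*2.
Proof.
rewrite sptE spt_ge_rec // spt_ge_rec // npartitionsE; have := nmult2_le n.
have := spt_ge3_le n; lia.
Qed.

Lemma npartitions_gt0 n : 0 < npartitions n.
Proof.
rewrite npartitionsE; apply: (@leq_trans (npart_ge 1 (n - n * 1))); first by rewrite muln1 subnn.
by apply: npart_ge_sub; rewrite ?muln1.
Qed.

(** * General recursive functions *)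

Lemma recursive_ext n (f g : n.-tuple nat -> nat) : recursive f -> f =1 g -> recursive g.
Proof. by move=> rf /funext <-. Qed.

Lemma recursive_comp1 n (g : 1.-tuple nat -> nat) (F : n.-tuple nat -> nat) :
  recursive g -> recursive F -> recursive (fun x => g [tuple F x]).
Proof.
move=> rg rF; apply: recursive_ext (rec_comp (h := fun=> F) rg (fun=> rF)) _ => x.
by congr g; apply: eq_from_tnth => i; rewrite tnth_mktuple ord1.
Qed.

Lemma recursive_comp2 n (g : 2.-tuple nat -> nat) (F G : n.-tuple nat -> nat) :
  recursive g -> recursive F -> recursive G -> recursive (fun x => g [tuple F x; G x]).
Proof.
move=> rg rF rG; pose h (i : 'I_2) := if i == ord0 then F else G.
have rh i : recursive (h i) by rewrite /h; case: ifP.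
apply: recursive_ext (rec_comp rg rh) _ => x.
by congr g; apply: eq_from_tnth => -[[|[|//]] i]; rewrite tnth_mktuple.
Qed.

Lemma recursive_succ n (F : n.-tuple nat -> nat) : recursive F -> recursive (fun x => (F x).+1).
Proof. exact: recursive_comp1 rec_succ. Qed.

Lemma recursive_const n k : recursive (fun _ : n.-tuple nat => k).
Proof. by elim: k => [|k IH]; [exact: rec_zero|exact: recursive_succ IH]. Qed.

Lemma recursive_add2 : recursive (fun x : 2.-tuple nat => tnth x ord0 + tnth x (inord 1)).
Proof.
have rp := rec_proj (ord0 : 'I_1).
(* The step function of [rec_prim] receives the counter, the previous value, then the arguments, so
   index 1 is the previous value. *)
have rs := recursive_succ (rec_proj (inord 1 : 'I_3)).
apply: (rec_prim rp rs) => [x|k x].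
  by rewrite !(tnth_nth 0) /= inordK.
by rewrite !(tnth_nth 0) /= !inordK // addSn.
Qed.

Lemma recursive_add n (F G : n.-tuple nat -> nat) :
  recursive F -> recursive G -> recursive (fun x => F x + G x).
Proof.
move=> rF rG; apply: recursive_ext (recursive_comp2 recursive_add2 rF rG) _ => x.
by rewrite !(tnth_nth 0) /= inordK.
Qed.

Lemma recursive_mul2 : recursive (fun x : 2.-tuple nat => tnth x ord0 * tnth x (inord 1)).
Proof.
have rp := @rec_zero 1.
have rs := recursive_add (rec_proj (inord 2 : 'I_3)) (rec_proj (inord 1 : 'I_3)).
apply: (rec_prim rp rs) => [x|k x].
  by rewrite !(tnth_nth 0) /= mul0n.
by rewrite !(tnth_nth 0) /= !inordK // mulSn.
Qed.

Lemma recursive_mul n (F G : n.-tuple nat -> nat) :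
  recursive F -> recursive G -> recursive (fun x => F x * G x).
Proof.
move=> rF rG; apply: recursive_ext (recursive_comp2 recursive_mul2 rF rG) _ => x.
by rewrite !(tnth_nth 0) /= inordK.
Qed.

Lemma recursive_exp n (F : n.-tuple nat -> nat) k : recursive F -> recursive (fun x => F x ^ k).
Proof.
move=> rF; elim: k => [|k IH]; first exact: recursive_const.
by apply: recursive_ext (recursive_mul rF IH) _ => x; rewrite expnS.
Qed.

Local Open Scope ring_scope.

Local Notation Re := complex.Re.
Local Notation Im := complex.Im.

(** * The generating polynomial and its Fourier coefficients *)

(** A truncation of 1 / (1 - X^i). Its coefficients below J are exact, and its values on a circle of
    radius below 1 converge as J grows, so generating functions can remain polynomials. *)
Definition geom_poly (K : fieldType) (J i : nat) : {poly K} :=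
  \sum_(j < J) 'X^(i * j).

Lemma geom_polyE (K : fieldType) J i :
  (1 - 'X^i) * geom_poly K J i = 1 - 'X^(i * J).
Proof.
rewrite /geom_poly; elim: J => [|J IH]; first by rewrite big_ord0 mulr0 muln0 subrr.
rewrite big_ord_recr /= mulrDr IH mulrBl mul1r -exprD mulnS [(i + _)%N]addnC.
by rewrite addrA subrK.
Qed.

(** By [geom_polyE] the product B satisfies B = A + X^i B - X^(iJ) A, and the last term is invisible
    below degree J. *)
Lemma coefM_geom_poly (K : fieldType) J i (A : {poly K}) k : (0 < i)%N -> (k < J)%N ->
  (A * geom_poly K J i)`_k =
  A`_k + (if (i <= k)%N then (A * geom_poly K J i)`_(k - i) else 0).
Proof.
move=> i0 lt_kJ; set B := A * _.
have eB : B = A + 'X^i * B - 'X^(i * J) * A.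
  apply/eqP; rewrite -subr_eq0.
  have /eqP := congr1 (fun p => A * p) (geom_polyE K J i).
  rewrite -subr_eq0 => /eqP e; apply/eqP; rewrite -[RHS]e /B; ring.
rewrite [in LHS]eB coefB coefD !coefXnM.
rewrite (_ : (k < i * J)%N = true); last by nia.
by rewrite subr0; case: leqP.
Qed.

Definition part_poly (K : fieldType) (J a m : nat) : {poly K} :=
  \prod_(a <= i < m.+1) geom_poly K J i.

(** Both sides obey the recursion of [npart_ge_rec], by descent on a and then strong induction on
    k. *)
Lemma coef_part_poly (K : fieldType) J a m k : (0 < a <= m.+1)%N -> (k < J)%N ->
  (k <= m)%N -> (part_poly K J a m)`_k = (npart_ge a k)%:R.
Proof.
move=> /andP[a0 le_am] lt_kJ le_km.
have [d] := ubnP (m.+1 - a); elim: d a a0 le_am k lt_kJ le_km => // d IH a a0 le_am k.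
move: le_am; rewrite leq_eqVlt => /orP[/eqP ->|lt_am] lt_kJ le_km ltd.
  rewrite /part_poly big_geq // coef1; case: k le_km {lt_kJ} => [//|k le_km].
  by rewrite npart_ge_small.
elim/ltn_ind: k lt_kJ le_km => k IHk lt_kJ le_km.
rewrite /part_poly big_ltn // mulrC coefM_geom_poly // mulrC -big_ltn //.
rewrite -/(part_poly K J a.+1 m) -/(part_poly K J a m) npart_ge_rec // natrD.
rewrite IH //; last by lia.
by congr (_ + _); case: leqP => // le_ak; rewrite IHk //; lia.
Qed.

Lemma coef_nmult1 (K : fieldType) J m n : (n < J)%N -> (n <= m)%N ->
  (part_poly K J 1 m * (geom_poly K J 1 - 1))`_n = (nmult 1 n)%:R.
Proof.
elim: n => [|n IH] lt_nJ le_nm; rewrite mulrBr mulr1 coefB coefM_geom_poly //.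
  by rewrite addr0 subrr nmult_rec.
rewrite /= subn1 /= nmult_rec //= subn1 /= natrD addrC addKr -IH; try lia.
by rewrite mulrBr mulr1 coefB coef_part_poly ?subrK //; lia.
Qed.

(** The factor 1 - X removes the parts 1, and [geom_poly K J 2 - 1] adds j >= 1 copies of 2, as in
    [nmultE]. *)
Lemma coef_nmult2 (K : fieldType) J m n : (n < J)%N -> (0 < m)%N -> (n <= m)%N ->
  (part_poly K J 1 m * (1 - 'X) * (geom_poly K J 2 - 1))`_n = (nmult 2 n)%:R.
Proof.
have c2 k : (k < J)%N -> (0 < m)%N -> (k <= m)%N ->
    (part_poly K J 1 m * (1 - 'X))`_k = (npart_ge 2 k)%:R.
  move=> lt_kJ m0 le_km; rewrite mulrBr mulr1 coefB coefMX coef_part_poly //.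
  case: k lt_kJ le_km => [|k] lt_kJ le_km /=; first by rewrite subr0 !npart_ge0.
  rewrite coef_part_poly //; try lia.
  by rewrite [npart_ge 1 _]npart_ge_rec //= subn1 natrD addrK.
elim/ltn_ind: n => n IH lt_nJ m0 le_nm; rewrite [_ * (_ - 1)]mulrBr [_ * 1 in LHS]mulr1 coefB coefM_geom_poly //.
rewrite nmult_rec // addrC addKr; case: leqP => le2n //.
rewrite natrD -IH; try lia.
by rewrite [_ * (geom_poly _ _ _ - 1)]mulrBr [_ * 1]mulr1 coefB c2 ?subrK //; lia.
Qed.

(** * Points of the unit circle and the discrete Fourier transform *)

Section cis.
Local Open Scope complex_scope.
Variable R : realType.
Implicit Types x y : R.

Definition cis x : R[i] := cos x +i* sin x.

Lemma cis0 : cis 0 = 1. Proof. by rewrite /cis cos0 sin0. Qed.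

Lemma cisD x y : cis (x + y) = cis x * cis y.
Proof. by rewrite /cis cosD sinD; simpc; congr (_ +i* _); ring. Qed.

Lemma cisX x k : cis x ^+ k = cis (x *+ k).
Proof.
by elim: k => [|k IH]; rewrite ?mulr0n ?cis0 // exprS IH -cisD mulrS.
Qed.

Lemma normc_cis x : normc (cis x) = 1.
Proof. by rewrite /cis /= cos2Dsin2 sqrtr1. Qed.

Lemma cis_neq0 x : cis x != 0.
Proof. by apply/eqP => /(congr1 (@normc R))/eqP; rewrite normc_cis normc0 oner_eq0. Qed.

Lemma cis2pi : cis (pi *+ 2) = 1.
Proof. by rewrite /cis cos2pi sin2pi. Qed.

Lemma cis_neq1 x : 0 < x < pi *+ 2 -> cis x != 1.
Proof.
move=> /andP[x0 x2]; apply/eqP => -[c1 _].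
have s0 : 0 < sin (x / 2).
  by apply: sin_gt0_pi; rewrite divr_gt0 //= ltr_pdivrMr // mulr_natr.
have := cos_mulr2n (x / 2); rewrite (_ : (x / 2) *+ 2 = x); last by lra.
rewrite c1 cos2sin2 => e.
have : sin (x / 2) ^+ 2 = 0 by lra.
by move/eqP; rewrite sqrf_eq0 gt_eqF.
Qed.

Lemma normcR x : normc x%:C = `|x|.
Proof. by rewrite /= expr0n addr0 sqrtr_sqr. Qed.

Lemma ler_normc_Re (z : R[i]) : `|Re z| <= normc z.
Proof. by case: z => a b /=; rewrite -sqrtr_sqr ler_wsqrtr // lerDl sqr_ge0. Qed.

Lemma normc_ge0 (z : R[i]) : 0 <= normc z.
Proof. by case: z => a b; apply: sqrtr_ge0. Qed.

Lemma normc_exp (z : R[i]) k : normc (z ^+ k) = normc z ^+ k.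
Proof. by elim: k => [|k IH]; rewrite ?expr0 ?normc1 // !exprS normcM IH. Qed.

Lemma ler_normc_sum (I : Type) (s : seq I) (P : pred I) (F : I -> R[i]) :
  normc (\sum_(i <- s | P i) F i) <= \sum_(i <- s | P i) normc (F i).
Proof.
elim/big_ind2: _ => [|u a v b h1 h2|//]; first by rewrite normc0.
exact: le_trans (le_normcD _ _) (lerD h1 h2).
Qed.

Lemma Re_sum (I : Type) (s : seq I) (P : pred I) (F : I -> R[i]) :
  Re (\sum_(i <- s | P i) F i) = \sum_(i <- s | P i) Re (F i).
Proof. by apply: (big_morph (@complex.Re R)) => // -[a b] [c d]. Qed.

Lemma ReZ x (z : R[i]) : Re (x%:C * z) = x * Re z.
Proof. by case: z => a b /=; rewrite mul0r subr0. Qed.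

Lemma ImZ x (z : R[i]) : Im (x%:C * z) = x * Im z.
Proof. by case: z => a b /=; rewrite mul0r addr0. Qed.

(* An odd number of sample points, so that the angles lie in [-pi, pi]. *)
Definition circle_pt (K : nat) (l : nat) : R := pi *+ 2 * (l%:R - K%:R) / (K.*2.+1)%:R.

Lemma circle_pt_bound K l : (l < K.*2.+1)%N -> `|circle_pt K l| <= pi.
Proof.
move=> ltl; have K0 : 0 < (K.*2.+1)%:R :> R by rewrite ltr0n.
rewrite /circle_pt normrM normfV (gtr0_norm K0) ler_pdivrMr // normrM.
rewrite [`|_ *+ _|]ger0_norm; last by apply: mulrn_wge0; apply: pi_ge0.
rewrite -[pi *+ 2]mulr_natr -mulrA ler_pM2l ?pi_gt0 //.
have h1 : l%:R <= K.*2%:R :> R by rewrite ler_nat.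
have h2 : 0 <= l%:R :> R by rewrite ler0n.
have h3 : (K.*2.+1)%:R = 2 * K%:R + 1 :> R by rewrite -addn1 natrD -mul2n natrM.
rewrite h3; rewrite -mul2n natrM in h1.
have : `|l%:R - K%:R| <= K%:R :> R by rewrite ler_norml; lra.
lra.
Qed.

(** Orthogonality of the characters of Z/M with M = 2 K + 1. Centering the angles at l = K only
    contributes a factor independent of l, and a geometric sum with ratio y = z^(k - n), y^M = 1,
    remains. *)
Lemma sum_circle_pt K k n : (k < K.*2.+1)%N -> (n < K.*2.+1)%N ->
  \sum_(l < K.*2.+1) cis (k%:R * circle_pt K l) * cis (- (n%:R * circle_pt K l)) =
  ((k == n) * K.*2.+1)%:R.
Proof.
move=> ltk ltn; pose M := K.*2.+1; pose w := pi *+ 2 / M%:R : R.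
have M0 : M%:R != 0 :> R by rewrite pnatr_eq0.
have Mgt0 : 0 < M%:R :> R by rewrite ltr0n.
pose z := cis w; have z0 : z != 0 := cis_neq0 w.
have zM : z ^+ M = 1 by rewrite cisX -mulr_natr divfK // cis2pi.
have zneq1 d : (0 < d < M)%N -> z ^+ d != 1.
  move=> /andP[d0 dM]; rewrite cisX; apply: cis_neq1.
  have p2 : 0 < pi *+ 2 :> R by rewrite pmulrn_lgt0 // pi_gt0.
  rewrite pmulrn_lgt0 // divr_gt0 //= -mulr_natr mulrAC ltr_pdivrMr //.
  by rewrite ltr_pM2l // ltr_nat.
pose y := z ^+ k / z ^+ n.
transitivity (\sum_(l < M) cis (- ((k%:R - n%:R) * w * K%:R)) * y ^+ l).
  apply: eq_bigr => l _; rewrite /y expr_div_n -!exprM !cisX.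
  have -> : (cis (w *+ (n * l)))^-1 = cis (- (w *+ (n * l))).
    apply: (mulIf (cis_neq0 (w *+ (n * l)))).
    by rewrite mulVf ?cis_neq0 // -cisD addNr cis0.
  rewrite -!cisD; congr cis.
  rewrite -[w *+ (k * l)]mulr_natr -[w *+ (n * l)]mulr_natr !natrM /circle_pt -/M /w.
  by field.
rewrite -mulr_sumr; have [ekn|nkn] := eqVneq k n.
  rewrite /y ekn divff ?expf_neq0 // subrr !mul0r oppr0 cis0 mul1r.
  under eq_bigr do rewrite expr1n.
  by rewrite sumr_const card_ord mul1n.
have y1 : y != 1.
  rewrite /y; apply/eqP => /divr1_eq e.
  have [lt|gt|/eqP] := ltngtP k n; last by rewrite (negbTE nkn).
  - have /eqP[] := @zneq1 (n - k)%N ltac:(rewrite /M; lia).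
    apply: (mulfI (expf_neq0 k z0)); rewrite -exprD subnKC 1?ltnW //.
    by rewrite -e mulr1.
  - have /eqP[] := @zneq1 (k - n)%N ltac:(rewrite /M; lia).
    apply: (mulfI (expf_neq0 n z0)); rewrite -exprD subnKC 1?ltnW //.
    by rewrite e mulr1.
rewrite mul0n; apply/eqP; rewrite mulf_eq0; apply/orP; right.
have yM : y ^+ M = 1.
  rewrite /y expr_div_n -!exprM [(k * M)%N]mulnC [(n * M)%N]mulnC !exprM.
  by rewrite zM !expr1n divr1.
have /esym/eqP := subrX1 y M; rewrite yM subrr.
by rewrite mulf_eq0 subr_eq0 (negbTE y1).
Qed.

(** A discrete Cauchy formula, exact because the number of sample points exceeds the degree. *)
Lemma dft_coef (p : {poly R[i]}) r K n : 0 < r -> (size p <= K.*2.+1)%N ->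
  (n < K.*2.+1)%N ->
  p`_n * (r ^+ n)%:C = (K.*2.+1)%:R^-1 * \sum_(l < K.*2.+1)
     p.[r%:C * cis (circle_pt K l)] * cis (- (n%:R * circle_pt K l)).
Proof.
move=> r0 szp ltn; set M := K.*2.+1.
have M0 : M%:R != 0 :> R[i] by rewrite pnatr_eq0.
apply: (mulfI M0); rewrite mulVKf //.
transitivity (\sum_(l < M) \sum_(k < M) (p`_k * (r ^+ k)%:C) *
    (cis (k%:R * circle_pt K l) * cis (- (n%:R * circle_pt K l)))); last first.
  apply: eq_bigr => l _; rewrite (horner_coef_wide _ szp) mulr_suml.
  apply: eq_bigr => k _; rewrite exprMn cisX -[circle_pt K l *+ k]mulr_natl.
  by rewrite -!mulrA rmorphXn.
rewrite exchange_big /=.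
transitivity (\sum_(k < M) (p`_k * (r ^+ k)%:C) * (((k : nat) == n) * M)%:R); last first.
  by apply: eq_bigr => k _; rewrite -mulr_sumr sum_circle_pt.
rewrite (bigD1 (Ordinal ltn)) //= eqxx mul1n big1 ?addr0; first by rewrite mulrC.
by move=> k; rewrite -val_eqE /= => /negbTE ->; rewrite mul0n mulr0.
Qed.
End cis.

(** * Uniform limits of polynomials on a circle *)

Section unif_lim.
Local Open Scope complex_scope.
Variable R : realType.
Implicit Types (r e : R) (Q : nat -> {poly R[i]}) (g h : R[i] -> R[i]).

Lemma expr_small r e : 0 <= r < 1 -> 0 < e -> exists J0, forall J, (J0 <= J)%N -> r ^+ J <= e.
Proof.
move=> /andP[r0 r1] e0.
have /cvgrPdist_le /(_ _ e0) [J0 _ H] : ((fun n => r ^+ n) @ \oo --> (0 : R))%classic.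
  by apply: cvg_expr; rewrite ger0_norm.
exists J0 => J le_J; have := H J le_J; rewrite /= sub0r normrN ger0_norm //.
exact: exprn_ge0.
Qed.

Lemma natr_expr_le r J : 0 <= r < 1 -> J%:R * r ^+ J <= (1 - r)^-1.
Proof.
move=> /andP[r0 r1]; have r1' : 0 < 1 - r by rewrite subr_gt0.
rewrite -[leRHS]mul1r ler_pdivlMr //.
apply: (@le_trans _ _ (1 - r ^+ J)); last by rewrite gerBl exprn_ge0.
have -> : 1 - r ^+ J = (\sum_(j < J) r ^+ j) * (1 - r).
  by have := subrX1 r J; rewrite -[r ^+ J - 1]opprB => /eqP; rewrite eqr_oppLR => /eqP ->; ring.
rewrite ler_wpM2r ?(ltW r1') //.
have -> : J%:R * r ^+ J = \sum_(j < J) r ^+ J.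
  by rewrite sumr_const card_ord mulr_natl.
apply: ler_sum => j _; apply: ler_wiXn2l => //; [exact: ltW|exact: ltnW].
Qed.

(** With r = s^2, the factor J * s^J stays bounded while the other s^J tends to 0. *)
Lemma natr_expr_small r e : 0 <= r < 1 -> 0 < e ->
  exists J0, forall J, (J0 <= J)%N -> J%:R * r ^+ J <= e.
Proof.
move=> /andP[r0 r1] e0; pose s := Num.sqrt r.
have s0 : 0 <= s by exact: sqrtr_ge0.
have s1 : s < 1 by rewrite -sqrtr1 ltr_sqrt.
have s01 : 0 <= s < 1 by rewrite s0.
have s1' : 0 < 1 - s by rewrite subr_gt0.
have [J0 H] := expr_small s01 (mulr_gt0 e0 s1'); exists J0 => J le_J.
have -> : r = s * s by rewrite -expr2 sqr_sqrtr.
rewrite exprMn mulrA; apply: (@le_trans _ _ ((1 - s)^-1 * s ^+ J)).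
  by rewrite ler_wpM2r ?exprn_ge0 // natr_expr_le.
by rewrite mulrC ler_pdivrMr // H.
Qed.

(** Boundedness of the limit on the circle is included so that the notion is closed under
    products. *)
Definition unif_lim r Q g :=
  (exists B, forall z, normc z = r -> normc (g z) <= B) /\
  forall e, 0 < e -> exists J0, forall J z, (J0 <= J)%N -> normc z = r ->
    normc ((Q J).[z] - g z) <= e.

Lemma unif_lim_poly r (p : {poly R[i]}) : unif_lim r (fun=> p) (fun z => p.[z]).
Proof.
split; last by move=> e e0; exists 0%N => J z _ _; rewrite subrr normc0 ltW.
exists (\sum_(k < size p) normc p`_k * r ^+ k) => z <-; rewrite horner_coef.
apply: le_trans (ler_normc_sum _ _ _) _; apply: ler_sum => k _.
by rewrite normcM normc_exp.
Qed.

Lemma unif_limD r P Q g h : unif_lim r P g -> unif_lim r Q h ->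
  unif_lim r (fun J => P J + Q J) (fun z => g z + h z).
Proof.
move=> [[B1 b1] l1] [[B2 b2] l2]; split.
  by exists (B1 + B2) => z zr; apply: le_trans (le_normcD _ _) _; rewrite lerD ?b1 ?b2.
move=> e e0; have e2 : 0 < e / 2 by rewrite divr_gt0.
have [J1 H1] := l1 _ e2; have [J2 H2] := l2 _ e2.
exists (maxn J1 J2) => J z; rewrite geq_max => /andP[le1 le2] zr.
rewrite hornerD opprD addrACA [e]splitr.
by apply: le_trans (le_normcD _ _) _; rewrite lerD ?H1 ?H2.
Qed.

Lemma unif_limM r P Q g h : unif_lim r P g -> unif_lim r Q h ->
  unif_lim r (fun J => P J * Q J) (fun z => g z * h z).
Proof.
move=> [[B1 b1] l1] [[B2 b2] l2]; split.
  exists (`|B1| * `|B2|) => z zr; rewrite normcM ler_pM ?normc_ge0 //.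
    exact: le_trans (b1 _ zr) (ler_norm _).
  exact: le_trans (b2 _ zr) (ler_norm _).
move=> e e0; pose B := `|B1| + `|B2| + 1.
have B0 : 0 < B by rewrite ltr_wpDl // addr_ge0.
(* The cap 1 reduces the product of the two errors to a single d, and 3 * B pays for the three terms
   of the decomposition below. *)
pose d := Num.min 1 (e / (3 * B)).
have d0 : 0 < d by rewrite lt_min ltr01 divr_gt0 // mulr_gt0.
have [J1 H1] := l1 _ d0; have [J2 H2] := l2 _ d0.
exists (maxn J1 J2) => J z; rewrite geq_max => /andP[le1 le2] zr.
have -> : (P J * Q J).[z] - g z * h z =
  ((P J).[z] - g z) * ((Q J).[z] - h z) +
  (g z * ((Q J).[z] - h z) + h z * ((P J).[z] - g z)) by rewrite hornerM; ring.
have h1 := H1 _ _ le1 zr; have h2 := H2 _ _ le2 zr.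
apply: (@le_trans _ _ (d * 1 + (B * d + B * d))); last first.
  have : d <= e / (3 * B) by rewrite ge_min lexx orbT.
  rewrite ler_pdivlMr ?mulr_gt0 // => hd.
  have : d * 1 <= d * B by rewrite ler_wpM2l ?(ltW d0) // lerDr addr_ge0.
  lra.
apply: le_trans (le_normcD _ _) _; apply: lerD.
  rewrite normcM ler_pM ?normc_ge0 //; apply: le_trans h2 _.
  by rewrite ge_min lexx.
apply: le_trans (le_normcD _ _) _; apply: lerD; rewrite normcM ler_pM ?normc_ge0 //.
  apply: le_trans (b1 _ zr) _; apply: le_trans (ler_norm _) _.
  by rewrite /B -addrA lerDl addr_ge0.
apply: le_trans (b2 _ zr) _; apply: le_trans (ler_norm _) _.
by rewrite /B [`|B1| + _]addrC -addrA lerDl addr_ge0.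
Qed.
End unif_lim.

(** * The Euler product and its derivative as uniform limits *)

Section part_lim.
Local Open Scope complex_scope.
Variable R : realType.
Implicit Types (r e : R) (Q : nat -> {poly R[i]}) (g h : R[i] -> R[i]) (z : R[i]).

Definition euler_inv m z : R[i] := \prod_(1 <= i < m.+1) (1 - z ^+ i)^-1.
Definition lambert m z : R[i] := \sum_(1 <= i < m.+1) i%:R * (z ^+ i / (1 - z ^+ i)).

Lemma ReB z1 z2 : Re (z1 - z2) = Re z1 - Re z2.
Proof. by case: z1 z2 => [? ?] []. Qed.

Lemma ReD z1 z2 : Re (z1 + z2) = Re z1 + Re z2.
Proof. by case: z1 z2 => [? ?] []. Qed.

Lemma ImB z1 z2 : Im (z1 - z2) = Im z1 - Im z2.
Proof. by case: z1 z2 => [? ?] []. Qed.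

Lemma euler_invS m z : euler_inv m.+1 z = euler_inv m z * (1 - z ^+ m.+1)^-1.
Proof. by rewrite /euler_inv big_nat_recr. Qed.

Lemma lambertS m z :
  lambert m.+1 z = lambert m z + m.+1%:R * (z ^+ m.+1 / (1 - z ^+ m.+1)).
Proof. by rewrite /lambert big_nat_recr. Qed.

Lemma unif_lim_ext r P Q g h : P =1 Q -> (forall z, normc z = r -> g z = h z) ->
  unif_lim r P g -> unif_lim r Q h.
Proof.
move=> PQ gh [[B b] l]; split; first by exists B => z zr; rewrite -gh // b.
move=> e e0; have [J0 H] := l _ e0; exists J0 => J z le_J zr.
by rewrite -PQ -gh // H.
Qed.

Lemma normc_1sub_ge r z i : 0 <= r < 1 -> (0 < i)%N -> normc z = r ->
  1 - r <= normc (1 - z ^+ i).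
Proof.
move=> /andP[r0 r1] i0 zr.
have := le_normcD (1 - z ^+ i) (z ^+ i); rewrite subrK normc1 normc_exp zr.
have : r ^+ i <= r by rewrite -[leRHS]expr1; apply: ler_wiXn2l => //; apply: ltW.
lra.
Qed.

Lemma one_subX_neq0 r z i : 0 <= r < 1 -> (0 < i)%N -> normc z = r -> 1 - z ^+ i != 0.
Proof.
move=> r01 i0 zr; apply/eqP => e; have := normc_1sub_ge r01 i0 zr.
by rewrite e normc0 subr_le0 leNgt; case/andP: r01 => _ ->.
Qed.

Lemma normc_inv_1sub_le r z i : 0 <= r < 1 -> (0 < i)%N -> normc z = r ->
  normc (1 - z ^+ i)^-1 <= (1 - r)^-1.
Proof.
move=> r01 i0 zr; have h := normc_1sub_ge r01 i0 zr.
have r1 : 0 < 1 - r by case/andP: r01; rewrite subr_gt0.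
by rewrite normcV lef_pV2 // posrE // (lt_le_trans r1).
Qed.

Lemma horner_geom_poly r z J i : 0 <= r < 1 -> (0 < i)%N -> normc z = r ->
  (geom_poly R[i] J i).[z] = (1 - z ^+ (i * J)) / (1 - z ^+ i).
Proof.
move=> r01 i0 zr; have z1 := one_subX_neq0 r01 i0 zr.
apply: (mulfI z1); rewrite mulrCA divff // mulr1.
have := congr1 (fun p => p.[z]) (geom_polyE R[i] J i).
by rewrite hornerM !hornerE.
Qed.

Lemma normcX_le r z J i : 0 <= r < 1 -> (0 < i)%N -> normc z = r ->
  normc (z ^+ (i * J)) <= r ^+ J.
Proof.
move=> /andP[r0 r1] i0 zr; rewrite normc_exp zr; apply: ler_wiXn2l => //.
- exact: ltW.
- by rewrite -{1}[J]mul1n leq_mul2r i0 orbT.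
Qed.

Lemma unif_lim_geom r i : 0 <= r < 1 -> (0 < i)%N ->
  unif_lim r (fun J => geom_poly _ J i) (fun z => (1 - z ^+ i)^-1).
Proof.
move=> r01 i0; have r1 : 0 < 1 - r by case/andP: r01; rewrite subr_gt0.
split; first by exists (1 - r)^-1 => z; apply: normc_inv_1sub_le.
move=> e e0; have [J0 H] := expr_small r01 (mulr_gt0 e0 r1).
exists J0 => J z le_J zr; rewrite (horner_geom_poly _ r01) //.
rewrite mulrBl mul1r addrAC subrr sub0r normcN normcM.
apply: le_trans (ler_pM (normc_ge0 _) (normc_ge0 _) (normcX_le _ r01 i0 zr)
  (normc_inv_1sub_le r01 i0 zr)) _.
by rewrite ler_pdivrMr // H.
Qed.

(** Obtained by applying X d/dX to [geom_polyE] and evaluating at z. The last two terms vanish as J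
    grows; the third carries a factor J, which is why [natr_expr_small] is needed. *)
Lemma horner_deriv_geom_poly r z J i : 0 <= r < 1 -> (0 < i)%N -> normc z = r ->
  ('X * (geom_poly R[i] J i)^`()).[z] =
  i%:R * z ^+ i / (1 - z ^+ i) ^+ 2 - i%:R * (z ^+ i * z ^+ (i * J) / (1 - z ^+ i) ^+ 2)
  - (i * J)%:R * (z ^+ (i * J) / (1 - z ^+ i)).
Proof.
move=> r01 i0 zr; have z1 := one_subX_neq0 r01 i0 zr.
have := congr1 (fun p : {poly R[i]} => ('X * p^`()).[z]) (geom_polyE R[i] J i).
have dX k : ('X * ('X^k : {poly R[i]})^`()).[z] = k%:R * z ^+ k.
  case: k => [|k]; first by rewrite derivXn /= mulr0n mulr0 horner0 mul0r.
  by rewrite derivXn /= !hornerE hornerMn !hornerE mulrnAr -exprS mulr_natl.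
have d1 k : (1 - 'X^k : {poly R[i]})^`() = - ('X^k)^`().
  by rewrite derivB -polyC1 derivC sub0r.
rewrite derivM !d1 mulrDr hornerD.
have -> : 'X * (- ('X^i)^`() * geom_poly R[i] J i) =
   - ('X * ('X^i)^`() * geom_poly R[i] J i) by ring.
have -> : 'X * ((1 - 'X^i) * (geom_poly R[i] J i)^`()) =
   (1 - 'X^i) * ('X * (geom_poly R[i] J i)^`()) by ring.
have -> : 'X * - ('X^(i * J))^`() = - ('X * ('X^(i * J))^`() : {poly R[i]}) by ring.
rewrite !hornerN [('X * ('X^i)^`() * _).[z]]hornerM !dX [((1 - 'X^i) * _).[z]]hornerM.
rewrite (horner_geom_poly _ r01 i0 zr) => e.
have hz : (1 - 'X^i : {poly R[i]}).[z] = 1 - z ^+ i by rewrite !hornerE.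
apply: (mulfI z1); move: e; rewrite hz; set y := ('X * _).[z]; move=> e.
have {e} -> : (1 - z ^+ i) * y =
    i%:R * z ^+ i * ((1 - z ^+ (i * J)) / (1 - z ^+ i)) - (i * J)%:R * z ^+ (i * J).
  by move/(canRL (addKr _)): e => ->; rewrite opprK.
by set w := z ^+ (i * J); set u := z ^+ i in z1 *; field.
Qed.

Lemma unif_lim_dgeom r i : 0 <= r < 1 -> (0 < i)%N ->
  unif_lim r (fun J => 'X * (geom_poly _ J i)^`()) (fun z => i%:R * z ^+ i / (1 - z ^+ i) ^+ 2).
Proof.
move=> r01 i0; have r1 : 0 < 1 - r by case/andP: r01; rewrite subr_gt0.
have [r0 _] := andP r01.
have D z : normc z = r -> normc (1 - z ^+ i) ^-1 <= (1 - r)^-1 by exact: normc_inv_1sub_le.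
have D2 z : normc z = r -> normc ((1 - z ^+ i) ^+ 2)^-1 <= (1 - r)^-1 ^+ 2.
  move=> zr; rewrite -exprVn normc_exp; apply: lerXn2r; rewrite ?nnegrE ?normc_ge0 ?D //.
  by rewrite invr_ge0 ltW.
have nc k : normc (k%:R : R[i]) = k%:R.
  by rewrite -(rmorph_nat (real_complex R)) normcR ger0_norm.
have Z z k : normc z = r -> normc (z ^+ k) <= 1.
  by move=> zr; rewrite normc_exp zr exprn_ile1 // ltW // -subr_gt0.
split.
  exists (i%:R * 1 * (1 - r)^-1 ^+ 2) => z zr; rewrite !normcM nc.
  rewrite ler_pM ?D2 ?mulr_ge0 ?normc_ge0 //.
  by rewrite ler_wpM2l // Z.
move=> e e0; pose c := i%:R * (1 - r)^-1 ^+ 2 + i%:R * (1 - r)^-1 + 1.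
have c0 : 0 < c.
  by rewrite ltr_wpDl // addr_ge0 // mulr_ge0 ?exprn_ge0 // invr_ge0 ltW.
have ec : 0 < e / c by rewrite divr_gt0.
have [J1 H1] := natr_expr_small r01 ec; exists J1.+1 => J z le_J zr.
rewrite (horner_deriv_geom_poly _ r01) //.
rewrite [X in normc X](_ : _ = - (i%:R * (z ^+ i * z ^+ (i * J) / (1 - z ^+ i) ^+ 2))
  - (i * J)%:R * (z ^+ (i * J) / (1 - z ^+ i))); last by ring.
have {}H1 := H1 J (ltnW le_J).
have J1le : 1 <= J%:R :> R by rewrite ler1n (leq_trans _ le_J).
have rJ := normcX_le J r01 i0 zr.
have rJ0 : 0 <= r ^+ J by exact: exprn_ge0.
apply: le_trans (le_normcD _ _) _; rewrite !normcN !normcM !nc.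
apply: (@le_trans _ _ (i%:R * (1 * r ^+ J * (1 - r)^-1 ^+ 2) + (i * J)%:R * (r ^+ J * (1 - r)^-1))).
  apply: lerD; rewrite ler_wpM2l // ler_pM ?D ?D2 ?normc_ge0 ?mulr_ge0 ?normc_ge0 //.
  by rewrite ler_pM ?normc_ge0 ?Z.
apply: (@le_trans _ _ (c * (J%:R * r ^+ J))); last by rewrite mulrC -ler_pdivlMr.
have hJ : r ^+ J <= J%:R * r ^+ J by rewrite ler_peMl.
have hb : 0 <= (1 - r)^-1 ^+ 2 by rewrite exprn_ge0 // invr_ge0 ltW.
have hi : 0 <= i%:R * (1 - r)^-1 ^+ 2 :> R by rewrite mulr_ge0.
have := ler_wpM2l hi hJ; have : 0 <= J%:R * r ^+ J by rewrite mulr_ge0.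
rewrite natrM /c; set a := J%:R * r ^+ J => ha hia.
have -> : i%:R * J%:R * (r ^+ J * (1 - r)^-1) = i%:R * (1 - r)^-1 * a by rewrite /a; ring.
rewrite !mulrDl; set x := i%:R * (1 - r)^-1 * a; rewrite mul1r; lra.
Qed.

Lemma unif_lim_part r m : 0 <= r < 1 ->
  unif_lim r (fun J => part_poly _ J 1 m) (euler_inv m).
Proof.
move=> r01; elim: m => [|m IH].
  apply: unif_lim_ext (unif_lim_poly r 1) => [J|z _].
    by rewrite /part_poly big_geq.
  by rewrite /euler_inv big_geq // hornerE.
apply: unif_lim_ext (unif_limM IH (unif_lim_geom r01 (ltn0Sn m))) => [J|z _].
  by rewrite /part_poly [RHS]big_nat_recr.
by rewrite /euler_inv [RHS]big_nat_recr.
Qed.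

Lemma unif_lim_dpart r m : 0 <= r < 1 ->
  unif_lim r (fun J => 'X * (part_poly _ J 1 m)^`())
    (fun z => euler_inv m z * lambert m z).
Proof.
move=> r01; elim: m => [|m IH].
  apply: unif_lim_ext (unif_lim_poly r 0) => [J|z _].
    by rewrite /part_poly big_geq // -[1]polyC1 derivC mulr0.
  by rewrite /lambert big_geq // mulr0 horner0.
have i0 := ltn0Sn m.
apply: unif_lim_ext (unif_limD (unif_limM IH (unif_lim_geom r01 i0))
  (unif_limM (unif_lim_part m r01) (unif_lim_dgeom r01 i0))) => [J|z zr].
  by rewrite /part_poly [in RHS]big_nat_recr //= derivM; ring.
rewrite euler_invS lambertS.
have := one_subX_neq0 r01 i0 zr; set u := z ^+ m.+1 => z1.
by set k : R[i] := (m.+1)%:R; field.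
Qed.

Definition circle_avg K (g : R -> R) : R :=
  (K.*2.+1)%:R^-1 * \sum_(l < K.*2.+1) g (circle_pt R K l).

(** The order of choices matters: e fixes J, and then every K beyond the degree of [Q J] makes the
    discrete average exact for [Q J]. Replacing [Q J] by g costs at most e at each sample point. *)
Lemma coef_circle_avg r Q g n (w : R) : 0 < r -> unif_lim r Q g ->
  (exists J1, forall J, (J1 <= J)%N -> (Q J)`_n = w%:C) ->
  forall e, 0 < e -> exists K0, forall K, (K0 <= K)%N ->
  `|w * r ^+ n - circle_avg K (fun a => Re (g (r%:C * cis a) * cis (- (n%:R * a))))| <= e.
Proof.
move=> r0 [_ l] [J1 HJ1] e e0; have [J0 HJ0] := l e e0.
pose J := maxn J0 J1; exists (maxn n (size (Q J))) => K.
rewrite geq_max => /andP[le_nK le_sK].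
have := @dft_coef R (Q J) r K n r0 ltac:(lia) ltac:(lia).
rewrite (HJ1 J (leq_maxr _ _)) -rmorphM => E.
have -> : w * r ^+ n = Re ((w * r ^+ n)%:C) by [].
rewrite E /circle_avg; set M := K.*2.+1.
have -> : (M%:R : R[i])^-1 = (M%:R^-1)%:C by rewrite fmorphV rmorph_nat.
rewrite ReZ Re_sum -mulrBr -sumrB normrM normfV normr_nat.
rewrite mulrC ler_pdivrMr ?ltr0n //.
apply: le_trans (ler_norm_sum _ _ _) _.
have -> : e * M%:R = \sum_(l < M) e by rewrite sumr_const card_ord mulr_natr.
apply: ler_sum => i _.
set z := r%:C * _; set c := cis _.
have -> : Re ((Q J).[z] * c) - Re (g z * c) = Re (((Q J).[z] - g z) * c).
  by rewrite mulrBl ReB.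
apply: le_trans (ler_normc_Re _) _; rewrite normcM normc_cis mulr1.
by apply: HJ0; rewrite ?leq_maxl // normcM normc_cis mulr1 normcR gtr0_norm.
Qed.
End part_lim.

(** * Elementary inequalities *)

Section elementary.
Variable R : realType.
Implicit Types x y : R.

Lemma le_of_derive_ge0 (f df : R -> R) :
  (forall x, is_derive x 1 f (df x)) -> (forall x, 0 <= x -> 0 <= df x) ->
  forall x, 0 <= x -> f 0 <= f x.
Proof.
move=> fdf df0 x x0.
have [c c0 e] : exists2 c, c \in `[0, x] & f x - f 0 = df c * (x - 0).
  apply: MVT_segment => //.
  by apply: derivable_within_continuous => y _; case: (fdf y).
rewrite -subr_ge0 e subr0 mulr_ge0 // df0 //.
by move: c0; rewrite in_itv /= => /andP[].
Qed.

Lemma ge0_of_derive (f df : R -> R) x : f 0 = 0 ->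
  (forall y, is_derive y 1 f (df y)) -> (forall y, 0 <= y -> 0 <= df y) ->
  0 <= x -> 0 <= f x.
Proof. by move=> f0 h1 h2 x0; rewrite -f0; apply: (le_of_derive_ge0 h1). Qed.

Lemma expR_ge_quad x : 0 <= x -> 1 + x + x ^+ 2 / 2 <= expR x.
Proof.
move=> x0; rewrite -subr_ge0.
apply: (@ge0_of_derive (fun y => expR y - (1 + y + y ^+ 2 / 2))
    (fun y => expR y - (1 + y)) _); last by [].
- by rewrite expR0 /=; field.
- by move=> y; apply: is_derive_eq; rewrite /GRing.scale /=; field.
- by move=> y y0; rewrite subr_ge0 expR_ge1Dx.
Qed.

Lemma sinh_ge x : 0 <= x -> 2 * x <= expR x - expR (- x).
Proof.
move=> x0; rewrite -subr_ge0.
apply: (@ge0_of_derive (fun y => expR y - expR (- y) - 2 * y)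
    (fun y => expR y + expR (- y) - 2) _); last by [].
- by rewrite oppr0 expR0 /=; field.
- by move=> y; apply: is_derive_eq; rewrite /GRing.scale /=; ring.
- move=> y y0; have := expRxMexpNx_1 y; have := expR_gt0 y.
  have := sqr_ge0 (expR y - 1); rewrite expRN => h h1 h2.
  rewrite -(pmulr_rge0 _ h1) mulrBr mulrDr h2; lra.
Qed.

(** This is coth(x / 2) >= 2 / x with denominators cleared; see [coth_ge]. *)
Lemma expR_mul_sub2_ge0 x : 0 <= x -> 0 <= expR x * (x - 2) + x + 2.
Proof.
move=> x0.
apply: (@ge0_of_derive (fun y => expR y * (y - 2) + y + 2)
    (fun y => expR y * (y - 1) + 1) _); last by [].
- by rewrite expR0 /=; field.
- by move=> y; apply: is_derive_eq; rewrite /GRing.scale /=; ring.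
- move=> y y0.
  apply: (@ge0_of_derive (fun y => expR y * (y - 1) + 1)
    (fun y => expR y * y) _); last by [].
  + by rewrite expR0; ring.
  + move=> z; apply: is_derive_eq; rewrite /GRing.scale /=; ring.
  + by move=> z z0; rewrite mulr_ge0 // expR_ge0.
Qed.

Lemma sin_le_id x : 0 <= x -> sin x <= x.
Proof.
move=> x0; rewrite -subr_ge0.
apply: (@ge0_of_derive (fun y => y - sin y)
    (fun y => 1 - cos y) _); last by [].
- by rewrite sin0 /=; field.
- by move=> y y0; rewrite subr_ge0 cos_le1.
Qed.

Lemma cos_ge_quad x : 1 - x ^+ 2 / 2 <= cos x.
Proof.
wlog x0 : x / 0 <= x => [h|].
  have [/h//|x0] := leP 0 x.
  by rewrite -cosN -sqrrN; apply: h; rewrite oppr_ge0 ltW.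
rewrite -subr_ge0.
apply: (@ge0_of_derive (fun y => cos y - (1 - y ^+ 2 / 2))
    (fun y => y - sin y) _); last by [].
- by rewrite cos0 /=; field.
- by move=> y; apply: is_derive_eq; rewrite /GRing.scale /=; field.
- by move=> y y0; rewrite subr_ge0 sin_le_id.
Qed.

Lemma sin_ge_cubic x : 0 <= x -> x - x ^+ 3 / 6 <= sin x.
Proof.
move=> x0; rewrite -subr_ge0.
apply: (@ge0_of_derive (fun y => sin y - (y - y ^+ 3 / 6))
    (fun y => cos y - (1 - y ^+ 2 / 2)) _); last by [].
- by rewrite sin0 /=; field.
- by move=> y; apply: is_derive_eq; rewrite /GRing.scale /=; field.
- by move=> y y0; rewrite subr_ge0 cos_ge_quad.
Qed.

Lemma cos_le_quartic x : cos x <= 1 - x ^+ 2 / 2 + x ^+ 4 / 24.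
Proof.
wlog x0 : x / 0 <= x => [h|].
  have [/h//|x0] := leP 0 x.
  have := h (- x); rewrite cosN sqrrN (_ : (- x) ^+ 4 = x ^+ 4); last by ring.
  by apply; rewrite oppr_ge0 ltW.
rewrite -subr_ge0.
apply: (@ge0_of_derive (fun y => 1 - y ^+ 2 / 2 + y ^+ 4 / 24 - cos y)
    (fun y => sin y - (y - y ^+ 3 / 6)) _); last by [].
- by rewrite cos0 /=; field.
- by move=> y; apply: is_derive_eq; rewrite /GRing.scale /=; field.
- by move=> y y0; rewrite subr_ge0 sin_ge_cubic.
Qed.

Lemma normr_sin_sub x : `|sin x - x| <= `|x| ^+ 3 / 6.
Proof.
wlog x0 : x / 0 <= x => [h|].
  have [/h//|x0] := leP 0 x.
  have := h (- x); rewrite sinN -opprD !normrN; apply.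
  by rewrite oppr_ge0 ltW.
have := sin_le_id x0; have := sin_ge_cubic x0; rewrite (ger0_norm x0) ler_norml.
have := exprn_ge0 3 x0; lra.
Qed.

Lemma normr_sin_le x : `|sin x| <= `|x|.
Proof.
wlog x0 : x / 0 <= x => [h|].
  have [/h//|x0] := leP 0 x.
  by have := h (- x); rewrite sinN !normrN; apply; rewrite oppr_ge0 ltW.
rewrite (ger0_norm x0) ler_norml sin_le_id // andbT.
have := sin_ge_cubic x0; have := sin_geN1 x.
have [x1|x1] := leP 1 x; first lra.
have : x ^+ 3 <= x by rewrite -[leRHS]expr1; apply: ler_wiXn2l => //; apply: ltW.
lra.
Qed.

Lemma normr_atan_sub x : `|atan x - x| <= `|x| ^+ 3 / 3.
Proof.
wlog x0 : x / 0 <= x => [h|].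
  have [/h//|x0] := leP 0 x.
  have := h (- x); rewrite atanN -opprD !normrN; apply.
  by rewrite oppr_ge0 ltW.
have d2 y : 0 < 1 + y ^+ 2 by rewrite ltr_wpDr // sqr_ge0.
have h1 : atan x <= x.
  rewrite -subr_ge0.
  apply: (@ge0_of_derive (fun y => y - atan y)
    (fun y => 1 - (1 + y ^+ 2)^-1) _); last by [].
  - by rewrite atan0 /=; field.
  - by move=> y y0; rewrite subr_ge0 invf_le1 ?d2 // lerDl sqr_ge0.
have h2 : x - x ^+ 3 / 3 <= atan x.
  rewrite -subr_ge0.
  apply: (@ge0_of_derive (fun y => atan y - (y - y ^+ 3 / 3))
    (fun y => (1 + y ^+ 2)^-1 - (1 - y ^+ 2)) _); last by [].
  - by rewrite atan0 /=; field.
  - by move=> y; apply: is_derive_eq; rewrite /GRing.scale /=; field; rewrite gt_eqF.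
  - move=> y y0; rewrite subr_ge0 -[leRHS]mul1r ler_pdivlMr ?d2 //.
    by have := sqr_ge0 (y ^+ 2); lra.
rewrite (ger0_norm x0) ler_norml.
have := exprn_ge0 3 x0; lra.
Qed.

(** Uses 1 - cos x = 2 sin(x / 2)^2 and sin y >= y - y^3 / 6 >= y / 3 for 0 <= y <= 2. The range
    covers all angles up to pi. *)
Lemma one_sub_cos_ge x : `|x| <= 4 -> x ^+ 2 / 18 <= 1 - cos x.
Proof.
move=> x4; pose y := `|x| / 2; have y0 : 0 <= y by rewrite divr_ge0.
have y2 : y <= 2 by rewrite /y; lra.
have -> : 1 - cos x = 2 * sin y ^+ 2.
  have := cos_mulr2n y; rewrite (_ : y *+ 2 = `|x|); last by rewrite /y; lra.
  by rewrite cos_norm cos2sin2 => ->; lra.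
have -> : x ^+ 2 / 18 = 2 * (y / 3) ^+ 2.
  by rewrite -(real_normK (num_real x)) /y; field.
have h : y / 3 <= sin y.
  apply: le_trans (sin_ge_cubic y0).
  have : y * y ^+ 2 <= y * 4.
    by rewrite ler_wpM2l // (_ : 4 = 2 ^+ 2) ?lerXn2r ?nnegrE //; ring.
  rewrite -exprS; lra.
by rewrite ler_wpM2l // lerXn2r ?nnegrE ?divr_ge0 // (le_trans _ h) ?divr_ge0.
Qed.

Lemma pi_lt4 : pi < 4 :> R.
Proof. by have := @pihalf_lt2 R; lra. Qed.

End elementary.

(** * The factor 1 / (1 - x e^(i a)) *)

Section factor.
Local Open Scope complex_scope.
Variable R : realType.
Implicit Types x a : R.

(** The square of |1 - x e^(ia)|, written so that its excess over (1 - x)^2 is visibly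
    nonnegative. *)
Definition dist2 x a := (1 - x) ^+ 2 + 2 * x * (1 - cos a).
Definition factor_arg x a := atan (x * sin a / (1 - x * cos a)).
Definition factor_mod x a := (1 - x) / Num.sqrt (dist2 x a).
(** The drop of Re 1 / (1 - x e^(ia)) from its value at a = 0; see [Re_inv_1sub]. *)
Definition Re_defect x a := x * (1 - cos a) * (1 + x) / ((1 - x) * dist2 x a).

Section bounds.
Variables x a : R.
Hypothesis x01 : 0 <= x < 1.

Let x0 : 0 <= x. Proof. by case/andP: x01. Qed.
Let x1 : 0 < 1 - x. Proof. by case/andP: x01; rewrite subr_gt0. Qed.

Lemma onesubcos_ge0 : 0 <= 1 - cos a.
Proof. by rewrite subr_ge0 cos_le1. Qed.

Lemma dist2_ge : (1 - x) ^+ 2 <= dist2 x a.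
Proof. by rewrite lerDl !mulr_ge0 // onesubcos_ge0. Qed.

Lemma dist2_gt0 : 0 < dist2 x a.
Proof. exact: lt_le_trans (exprn_gt0 2 x1) dist2_ge. Qed.

Lemma dist2E : dist2 x a = (1 - x * cos a) ^+ 2 + (x * sin a) ^+ 2.
Proof. by rewrite /dist2 exprMn sin2cos2; ring. Qed.

Lemma one_sub_xcos_ge : 1 - x <= 1 - x * cos a.
Proof. by rewrite lerB // ler_piMr // cos_le1. Qed.

Lemma one_sub_xcos_gt0 : 0 < 1 - x * cos a.
Proof. exact: lt_le_trans x1 one_sub_xcos_ge. Qed.

Lemma inv_1sub_cis : (1 - x%:C * cis a)^-1 =
  ((1 - x * cos a) / dist2 x a) +i* (x * sin a / dist2 x a).
Proof.
have d0 := dist2_gt0.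
have e : (1 - x%:C * cis a) = (1 - x * cos a) +i* (- (x * sin a)).
  by rewrite /cis; simpc.
rewrite e; apply: (@mulIf _ ((1 - x * cos a) +i* (- (x * sin a)))).
  by apply/eqP => -[/eqP]; rewrite gt_eqF // one_sub_xcos_gt0.
rewrite mulVf; last by apply/eqP => -[/eqP]; rewrite gt_eqF // one_sub_xcos_gt0.
simpc; congr (_ +i* _); last by ring.
by rewrite -[1 in LHS](divff (lt0r_neq0 d0)) {1}dist2E; field; apply: lt0r_neq0.
Qed.

Lemma Re_inv_1sub : Re (1 - x%:C * cis a)^-1 = (1 - x)^-1 - Re_defect x a.
Proof.
rewrite inv_1sub_cis /= /Re_defect; have d0 := dist2_gt0.
have dn := lt0r_neq0 d0; have xn := lt0r_neq0 x1; move: dn.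
by rewrite /dist2 => dn; field; rewrite dn xn.
Qed.

Lemma Im_inv_1sub : Im (1 - x%:C * cis a)^-1 = x * sin a / dist2 x a.
Proof. by rewrite inv_1sub_cis. Qed.

Lemma Re_defect_ge0 : 0 <= Re_defect x a.
Proof.
rewrite /Re_defect !mulr_ge0 ?onesubcos_ge0 ?addr_ge0 // invr_ge0.
by rewrite mulr_ge0 // ltW // dist2_gt0.
Qed.

Lemma onesubcos_le : 1 - cos a <= a ^+ 2 / 2.
Proof. by have := cos_ge_quad a; lra. Qed.

Lemma Re_defect_le : Re_defect x a <= a ^+ 2 / 2 * (x * (1 + x) / (1 - x) ^+ 3).
Proof.
have -> : a ^+ 2 / 2 * (x * (1 + x) / (1 - x) ^+ 3) =
    (x * (a ^+ 2 / 2) * (1 + x)) / ((1 - x) * (1 - x) ^+ 2).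
  by field; rewrite lt0r_neq0.
rewrite /Re_defect ler_pM ?mulr_ge0 ?onesubcos_ge0 ?addr_ge0 //.
- by rewrite invr_ge0 mulr_ge0 // ltW // dist2_gt0.
- by rewrite ler_wpM2r ?addr_ge0 // ler_wpM2l // onesubcos_le.
- by rewrite lef_pV2 ?posrE ?mulr_gt0 ?dist2_gt0 ?exprn_gt0 // ler_pM2l // dist2_ge.
Qed.

(** Once the quadratic term is split off, the numerator contains only a^2 / 2 - c and a^2 c with c =
    1 - cos a, and both are of order a^4. *)
Lemma Re_defect_ge :
  a ^+ 2 / 2 * (x * (1 + x) / (1 - x) ^+ 3) - 2 * a ^+ 4 * (x / (1 - x) ^+ 5) <= Re_defect x a.
Proof.
set d := 1 - x; have d0 : 0 < d := x1; set c := 1 - cos a.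
have N0 := dist2_gt0; have Nd := dist2_ge; rewrite -/d in Nd.
have c0 : 0 <= c := onesubcos_ge0; have cu : c <= a ^+ 2 / 2 := onesubcos_le.
have cl : a ^+ 2 / 2 - a ^+ 4 / 24 <= c by have := cos_le_quartic a; rewrite /c; lra.
rewrite lerBlDr -lerBlDl.
have -> : a ^+ 2 / 2 * (x * (1 + x) / d ^+ 3) - Re_defect x a =
  x * (1 + x) * (d ^+ 2 * (a ^+ 2 / 2 - c) + x * a ^+ 2 * c) / (d ^+ 3 * dist2 x a).
  rewrite /Re_defect -/d -/c.
  have -> : d ^+ 2 * (a ^+ 2 / 2 - c) + x * a ^+ 2 * c = a ^+ 2 / 2 * dist2 x a - c * d ^+ 2.
    by rewrite /dist2 -/d -/c; field.
  by field; rewrite (lt0r_neq0 N0) (lt0r_neq0 d0).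
rewrite ler_pdivrMr ?mulr_gt0 ?exprn_gt0 //.
have a2 : 0 <= a ^+ 2 by exact: sqr_ge0.
have h1 : d ^+ 2 * (a ^+ 2 / 2 - c) + x * a ^+ 2 * c <= a ^+ 4.
  have d1 : d ^+ 2 <= 1 by rewrite exprn_ile1 ?(ltW d0) // /d gerBl.
  have : d ^+ 2 * (a ^+ 2 / 2 - c) <= 1 * (a ^+ 4 / 24).
    by rewrite ler_pM ?sqr_ge0 ?subr_ge0 // lerBlDr -lerBlDl.
  have : x * a ^+ 2 * c <= 1 * a ^+ 2 * (a ^+ 2 / 2).
    have xx : x <= 1 by case/andP: x01 => _ /ltW.
    by apply: ler_pM => //; [exact: mulr_ge0|exact: ler_wpM2r].
  have a4 : 0 <= a ^+ 4 by rewrite exprn_even_ge0.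
  have -> : 1 * a ^+ 2 * (a ^+ 2 / 2) = a ^+ 4 / 2 by field.
  lra.
apply: (@le_trans _ _ (x * 2 * a ^+ 4)).
  apply: ler_pM => //.
  - by rewrite mulr_ge0 // addr_ge0.
  - apply: addr_ge0; last by apply: mulr_ge0 => //; apply: mulr_ge0.
    by apply: mulr_ge0; rewrite ?sqr_ge0 ?subr_ge0.
  - by apply: ler_wpM2l => //; case/andP: x01 => _ /ltW; rewrite -(lerD2l 1).
have -> : 2 * a ^+ 4 * (x / d ^+ 5) * (d ^+ 3 * dist2 x a) =
  x * 2 * a ^+ 4 * (dist2 x a / d ^+ 2) by field; rewrite lt0r_neq0.
have a4 : 0 <= x * 2 * a ^+ 4 by apply: mulr_ge0; [exact: mulr_ge0|exact: exprn_even_ge0].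
by apply: ler_peMr => //; rewrite ler_pdivlMr ?exprn_gt0 // mul1r.
Qed.

Lemma Im_inv_1sub_near :
  `|Im (1 - x%:C * cis a)^-1 - a * (x / (1 - x) ^+ 2)| <= 2 * `|a| ^+ 3 * (x / (1 - x) ^+ 4).
Proof.
rewrite Im_inv_1sub; set d := 1 - x; have d0 : 0 < d := x1; set c := 1 - cos a.
have N0 := dist2_gt0; have Nd := dist2_ge; rewrite -/d in Nd.
have c0 : 0 <= c := onesubcos_ge0; have cu : c <= a ^+ 2 / 2 := onesubcos_le.
have -> : x * sin a / dist2 x a - a * (x / d ^+ 2) =
  x * (d ^+ 2 * (sin a - a) - a * (2 * x * c)) / (d ^+ 2 * dist2 x a).
  have -> : d ^+ 2 * (sin a - a) - a * (2 * x * c) = sin a * d ^+ 2 - a * dist2 x a.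
    by rewrite /dist2 -/d -/c; ring.
  by field; rewrite (lt0r_neq0 N0) (lt0r_neq0 d0).
have dN : 0 < d ^+ 2 * dist2 x a by rewrite mulr_gt0 ?exprn_gt0.
rewrite normrM normfV (gtr0_norm dN) ler_pdivrMr // normrM (ger0_norm x0).
have d1 : d ^+ 2 <= 1 by rewrite exprn_ile1 ?(ltW d0) // /d gerBl.
have h1 : `|d ^+ 2 * (sin a - a) - a * (2 * x * c)| <= 2 * `|a| ^+ 3.
  have xc0 : 0 <= 2 * x * c by rewrite !mulr_ge0.
  apply: le_trans (ler_normB _ _) _; rewrite normrM [`|a * _|]normrM.
  rewrite (ger0_norm (sqr_ge0 d)) (ger0_norm xc0).
  have : d ^+ 2 * `|sin a - a| <= 1 * (`|a| ^+ 3 / 6).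
    by rewrite ler_pM ?sqr_ge0 // normr_sin_sub.
  have : `|a| * (2 * x * c) <= `|a| * (2 * 1 * (a ^+ 2 / 2)).
    have xx : x <= 1 by case/andP: x01 => _ /ltW.
    by apply: ler_wpM2l => //; apply: ler_pM; rewrite ?mulr_ge0 // ler_wpM2l.
  have -> : `|a| * (2 * 1 * (a ^+ 2 / 2)) = `|a| ^+ 3.
    by rewrite -(real_normK (num_real a)); field.
  have : 0 <= `|a| ^+ 3 by rewrite exprn_ge0.
  lra.
have -> : 2 * `|a| ^+ 3 * (x / d ^+ 4) * (d ^+ 2 * dist2 x a) =
  x * (2 * `|a| ^+ 3) * (dist2 x a / d ^+ 2) by field; rewrite lt0r_neq0.
apply: le_trans (ler_wpM2l x0 h1) _.
apply: ler_peMr; first by rewrite !mulr_ge0.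
by rewrite ler_pdivlMr ?exprn_gt0 // mul1r.
Qed.

Lemma inv_1sub_polar : (1 - x%:C * cis a)^-1 =
  (Num.sqrt (dist2 x a))^-1%:C * cis (factor_arg x a).
Proof.
rewrite inv_1sub_cis /factor_arg; set p := 1 - x * cos a; set s := x * sin a.
have p0 : 0 < p := one_sub_xcos_gt0; have N0 := dist2_gt0.
have q0 : 0 < Num.sqrt (dist2 x a) by rewrite sqrtr_gt0.
have cE : cos (atan (s / p)) = p / Num.sqrt (dist2 x a).
  rewrite cos_atan; have -> : 1 + (s / p) ^+ 2 = dist2 x a / p ^+ 2.
    by rewrite dist2E -/p -/s; field; apply: lt0r_neq0.
  rewrite sqrtrM ?(ltW N0) // sqrtrV ?sqr_ge0 // sqrtr_sqr (gtr0_norm p0).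
  by field; rewrite !lt0r_neq0.
have sE : sin (atan (s / p)) = s / Num.sqrt (dist2 x a).
  have c0 : cos (atan (s / p)) != 0 by rewrite cE mulf_neq0 ?invr_neq0 ?lt0r_neq0.
  have := atanK (s / p); rewrite /tan => /(canRL (divfK c0)) ->.
  by rewrite cE; field; rewrite !lt0r_neq0.
have NE : dist2 x a = Num.sqrt (dist2 x a) ^+ 2 by rewrite sqr_sqrtr // ltW.
rewrite /cis cE sE; simpc; congr (_ +i* _); rewrite [in LHS]NE; field; exact: lt0r_neq0.
Qed.

Lemma factor_arg_near :
  `|factor_arg x a - a * (x / (1 - x))| <= `|a| ^+ 3 * (x / (1 - x) ^+ 3).
Proof.
rewrite /factor_arg; set d := 1 - x; have d0 : 0 < d := x1.
set p := 1 - x * cos a; have p0 : 0 < p := one_sub_xcos_gt0.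
have dp : d <= p := one_sub_xcos_ge; set y := x * sin a / p.
have dn := lt0r_neq0 d0; have pn := lt0r_neq0 p0.
have d1 : d <= 1 by rewrite /d gerBl.
have xx : x <= 1 by case/andP: x01 => _ /ltW.
have a3 : 0 <= `|a| ^+ 3 by rewrite exprn_ge0.
have y1 : `|y| <= `|a| * (x / d).
  rewrite normrM normfV (gtr0_norm p0) normrM (ger0_norm x0) mulrCA -mulrA.
  apply: ler_pM; rewrite ?mulr_ge0 ?invr_ge0 ?(ltW p0) //.
  by apply: ler_pM; rewrite ?invr_ge0 ?(ltW p0) ?normr_sin_le // lef_pV2 ?posrE.
have h1 : `|atan y - y| <= `|a| ^+ 3 * (x / d ^+ 3) / 3.
  apply: le_trans (normr_atan_sub y) _; rewrite ler_wpM2r //.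
  apply: (@le_trans _ _ ((`|a| * (x / d)) ^+ 3)).
    by rewrite lerXn2r ?nnegrE ?mulr_ge0 ?invr_ge0 ?(ltW d0).
  rewrite exprMn ler_wpM2l // expr_div_n ler_wpM2r ?invr_ge0 ?exprn_ge0 ?(ltW d0) //.
  by rewrite -[leRHS]expr1; apply: ler_wiXn2l.
have h2 : `|y - a * (x / d)| <= `|a| ^+ 3 * (x / d ^+ 3) * (2 / 3).
  have -> : y - a * (x / d) = x * (d * (sin a - a) - a * (x * (1 - cos a))) / (p * d).
    by rewrite /y /p /d; field; rewrite -/d -/p dn pn.
  have pd : 0 < p * d by rewrite mulr_gt0.
  rewrite normrM normfV (gtr0_norm pd) normrM (ger0_norm x0).
  have h3 : `|d * (sin a - a) - a * (x * (1 - cos a))| <= `|a| ^+ 3 * (2 / 3).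
    have xc0 : 0 <= x * (1 - cos a) by rewrite mulr_ge0 ?onesubcos_ge0.
    apply: le_trans (ler_normB _ _) _; rewrite normrM [`|a * _|]normrM.
    rewrite (gtr0_norm d0) (ger0_norm xc0).
    have : d * `|sin a - a| <= 1 * (`|a| ^+ 3 / 6) by rewrite ler_pM ?(ltW d0) ?normr_sin_sub.
    have : `|a| * (x * (1 - cos a)) <= `|a| * (1 * (a ^+ 2 / 2)).
      by rewrite ler_wpM2l // ler_pM ?onesubcos_ge0 ?onesubcos_le.
    have -> : `|a| * (1 * (a ^+ 2 / 2)) = `|a| ^+ 3 / 2.
      by rewrite -(real_normK (num_real a)); field.
    lra.
  have -> : `|a| ^+ 3 * (x / d ^+ 3) * (2 / 3) = x * (`|a| ^+ 3 * (2 / 3)) / (d ^+ 3) by field.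
  apply: ler_pM; rewrite ?mulr_ge0 ?invr_ge0 ?(ltW pd) //; first by rewrite ler_wpM2l.
  rewrite lef_pV2 ?posrE ?exprn_gt0 // exprSr ler_wpM2r ?(ltW d0) //.
  apply: le_trans dp; rewrite expr2 ler_piMr // ltW //.
(* The error of [atan] takes one third of the bound ([h1]), that of its argument two thirds
   ([h2]). *)
have -> : atan y - a * (x / d) = (atan y - y) + (y - a * (x / d)) by ring.
apply: le_trans (ler_normD _ _) _; lra.
Qed.

Lemma factor_mod_ge0 : 0 <= factor_mod x a.
Proof. by rewrite /factor_mod mulr_ge0 ?invr_ge0 ?sqrtr_ge0 // ltW. Qed.

Lemma factor_mod_sqr : factor_mod x a ^+ 2 = (1 - x) ^+ 2 / dist2 x a.
Proof. by rewrite /factor_mod expr_div_n sqr_sqrtr // ltW // dist2_gt0. Qed.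

Lemma factor_mod_le : factor_mod x a <= expR (- (x * (1 - cos a) / 8)).
Proof.
set c := 1 - cos a; have c0 : 0 <= c := onesubcos_ge0.
have c2 : c <= 2 by have := cos_geN1 a; rewrite /c; lra.
have xx : x <= 1 by case/andP: x01 => _ /ltW.
rewrite -(@ler_pXn2r _ 2) ?nnegrE ?factor_mod_ge0 ?expR_ge0 // factor_mod_sqr.
rewrite -expRM_natl ler_pdivrMr ?dist2_gt0 // mulrN expRN.
(* After squaring, b = x * c / 4 is at most 1 / 2, where e^b <= 1 + 2 b, while [dist2 x a] exceeds
   (1 - x)^2 by 8 b. *)
rewrite mulrC ler_pdivlMr ?expR_gt0 //; set b := 2 * _.
have b0 : 0 <= b by rewrite /b !mulr_ge0.
have xc : x * c <= 1 * 2 by rewrite ler_pM.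
have b2 : b <= 1 / 2 by rewrite /b; lra.
have eb : expR b <= 1 + 2 * b.
  have e0 := expR_gt0 b; have h1 := expRxMexpNx_1 b; have h2 := expR_ge1Dx (- b).
  have h3 : expR b * (1 - b) <= 1 by rewrite -[leRHS]h1 ler_pM2l.
  have b1 : 0 < 1 - b by move: b b2 {b0 e0 h1 h2 h3} => b b2; lra.
  have h4 : 0 <= b * (1 - 2 * b).
    by apply: mulr_ge0 => //; move: b b2 {b0 e0 h1 h2 h3 b1} => b b2; lra.
  rewrite -(ler_pM2r b1); apply: le_trans h3 _.
  by move: b h4 {b0 b2 e0 h1 h2 b1} => b h4; lra.
have d2 : (1 - x) ^+ 2 <= 1 by rewrite exprn_ile1 ?(ltW x1) // gerBl.
have -> : dist2 x a = (1 - x) ^+ 2 + 8 * b by rewrite /dist2 /b -/c; field.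
apply: le_trans (ler_wpM2l (sqr_ge0 _) eb) _.
rewrite mulrDr mulr1 lerD2l.
have : (1 - x) ^+ 2 * (2 * b) <= 1 * (2 * b) by rewrite ler_wpM2r // mulr_ge0.
lra.
Qed.

Lemma factor_mod_ge : expR (- (a ^+ 2 / 2 * (x / (1 - x) ^+ 2))) <= factor_mod x a.
Proof.
have d2 : 0 < (1 - x) ^+ 2 by rewrite exprn_gt0.
rewrite -(@ler_pXn2r _ 2) ?nnegrE ?factor_mod_ge0 ?expR_ge0 // factor_mod_sqr.
rewrite -expRM_natl ler_pdivlMr ?dist2_gt0 // mulrN expRN mulrC.
rewrite ler_pdivrMr ?expR_gt0 //.
have -> : dist2 x a = (1 - x) ^+ 2 * (1 + 2 * (x * (1 - cos a) / (1 - x) ^+ 2)).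
  by rewrite /dist2; field; apply: lt0r_neq0.
rewrite ler_pM2l //; apply: le_trans (expR_ge1Dx _); rewrite lerD2l ler_wpM2l //.
rewrite mulrA ler_wpM2r ?invr_ge0 ?(ltW d2) // mulrC ler_wpM2r //.
exact: onesubcos_le.
Qed.

End bounds.
End factor.

(** * The sum of the inverse squares *)

Lemma sum_mulr_expr (F : fieldType) (z : F) M :
  (z - 1) * (\sum_(k < M) k%:R * z ^+ k) = M%:R * z ^+ M - z * \sum_(k < M) z ^+ k.
Proof.
elim: M => [|M IH]; first by rewrite !big_ord0 !mulr0 mul0r subr0.
rewrite !big_ord_recr /= mulrDr IH -addn1 natrD exprD expr1; ring.
Qed.

Section basel.
Local Open Scope complex_scope.
Variable R : realType.
Implicit Types x : R.

Lemma sum_natr M : \sum_(k < M) k%:R = (M%:R * (M%:R - 1)) / 2 :> R.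
Proof.
elim: M => [|M IH]; first by rewrite big_ord0 mul0r mul0r.
by rewrite big_ord_recr /= IH -addn1 natrD; field.
Qed.

Lemma sum_natr_sqr M :
  \sum_(k < M) k%:R ^+ 2 = M%:R * (M%:R - 1) * (2 * M%:R - 1) / 6 :> R.
Proof.
elim: M => [|M IH]; first by rewrite big_ord0 !mul0r.
by rewrite big_ord_recr /= IH -addn1 natrD; field.
Qed.

(* Parseval for the sequence k |-> k on Z/M. *)
Lemma sum_inv_chord K : \sum_(l < K.*2.+1 | l != K :> nat) (2 - 2 * cos (circle_pt R K l))^-1 =
  ((K.*2.+1)%:R ^+ 2 - 1) / 12.
Proof.
set M := K.*2.+1.
have Mn0 : M%:R != 0 :> R by rewrite pnatr_eq0.
pose S (s : R) (l : nat) : R[i] := \sum_(k < M) k%:R * cis (s * (k%:R * circle_pt R K l)).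
have total : \sum_(l < M) S 1 l * S (- 1) l = (M%:R * \sum_(k < M) k%:R ^+ 2)%:C.
  transitivity (\sum_(l < M) \sum_(k < M) \sum_(n < M) (k * n)%:R *
     (cis (k%:R * circle_pt R K l) * cis (- (n%:R * circle_pt R K l)))).
    apply: eq_bigr => l _; rewrite /S mulr_suml; apply: eq_bigr => k _.
    rewrite mulr_sumr; apply: eq_bigr => n _.
    by rewrite mul1r mulN1r natrM; ring.
  rewrite exchange_big /=.
  transitivity (\sum_(k < M) (M%:R * k%:R ^+ 2)%:C : R[i]); last first.
    by rewrite mulr_sumr rmorph_sum.
  apply: eq_bigr => k _; rewrite exchange_big /= (bigD1 k) //= [X in _ + X]big1.
    rewrite -mulr_sumr sum_circle_pt // eqxx mul1n addr0 -natrM.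
    by rewrite -natrX -natrM rmorph_nat; rewrite mulnC mulnn.
  move=> n nk; rewrite -mulr_sumr sum_circle_pt //; have := nk.
  by rewrite -val_eqE eq_sym /= => /negbTE ->; rewrite mul0n mulr0.
have atK : S 1 K * S (- 1) K = ((M%:R * (M%:R - 1) / 2) ^+ 2)%:C.
  have c0 : circle_pt R K K = 0 by rewrite /circle_pt subrr mulr0 mul0r.
  have SK s : S s K = (M%:R * (M%:R - 1) / 2)%:C.
    rewrite /S -sum_natr rmorph_sum; apply: eq_bigr => k _.
    by rewrite c0 !mulr0 cis0 mulr1 rmorph_nat.
  by rewrite !SK -rmorphM.
(* Away from the angle 0 the powers of cis a sum to 0 over a period, so (cis a - 1) * S = M;
   multiplying the two conjugate sums gives M^2 / |cis a - 1|^2. *)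
have offK l : (l < M)%N -> l != K ->
    S 1 l * S (- 1) l = (M%:R ^+ 2 * (2 - 2 * cos (circle_pt R K l))^-1)%:C.
  move=> ltl nlK; set a := circle_pt R K l.
  have a0 : a != 0.
    rewrite /a /circle_pt !mulf_neq0 ?invr_neq0 //.
      by rewrite mulrn_eq0 /= gt_eqF // pi_gt0.
    by rewrite subr_eq0 eqr_nat.
  have c1 : cis a != 1.
    have : 0 < `|a| by rewrite normr_gt0.
    have := circle_pt_bound R ltl; rewrite -/a => api a1.
    have p0 := pi_gt0 R.
    have : cis `|a| != 1 by apply: cis_neq1; rewrite a1 /= mulr2n; lra.
    apply: contraNneq => -[ca sa]; apply/eqP; rewrite /cis cos_norm ca; congr (_ +i* _).
    by have [h|h] := leP 0 a; rewrite ?(ger0_norm h) // (ltr0_norm h) sinN sa oppr0.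
  have Mcis s : s = 1 \/ s = -1 -> cis (s * a) ^+ M = 1 /\ cis (s * a) != 1.
    have cM : cis a ^+ M = 1.
      rewrite cisX /a /circle_pt -/M -[_ *+ M]mulr_natr divfK //.
      have [le|lt] := leqP K l.
        by rewrite -natrB // mulr_natr -cisX cis2pi expr1n.
      rewrite -opprB -natrB 1?ltnW // mulrN mulr_natr.
      apply: (mulIf (cis_neq0 (pi *+ 2 *+ (K - l)))).
      by rewrite -cisD addNr cis0 -cisX cis2pi expr1n mul1r.
    have cN : cis (- a) = (cis a)^-1.
      by apply: (mulIf (cis_neq0 a)); rewrite mulVf ?cis_neq0 // -cisD addNr cis0.
    case=> ->; rewrite ?mul1r ?mulN1r //.
    by rewrite cN exprVn cM invr1 invr_eq1.
  have SM s : s = 1 \/ s = -1 -> (cis (s * a) - 1) * S s l = M%:R.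
    move=> hs; have [cM cn1] := Mcis s hs.
    have -> : S s l = \sum_(k < M) k%:R * cis (s * a) ^+ k.
      apply: eq_bigr => k _; rewrite cisX -[_ *+ k]mulr_natl -/a; congr (_ * cis _); ring.
    rewrite sum_mulr_expr cM.
    have /esym/eqP := subrX1 (cis (s * a)) M; rewrite cM subrr.
    by rewrite mulf_eq0 subr_eq0 (negbTE cn1) /= => /eqP ->; rewrite mulr0 subr0 mulr1.
  have e1 := SM 1 (or_introl erefl); have e2 := SM (-1) (or_intror erefl).
  have dE : (cis (1 * a) - 1) * (cis (-1 * a) - 1) = (2 - 2 * cos a)%:C.
    rewrite mul1r mulN1r /cis cosN sinN.
    have cs := cos2Dsin2 a.
    have h : sin a * sin a = 1 - cos a ^+ 2 by rewrite -cs; ring.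
    rewrite -[1 : R[i]]/(1 +i* 0) /real_complex_def; simpc.
    congr (_ +i* _); last by ring.
    by rewrite h; ring.
  have dn0 : (2 - 2 * cos a)%:C != 0.
    rewrite -dE mulf_neq0 // subr_eq0.
      by have [] := Mcis 1 (or_introl erefl).
    by have [] := Mcis (-1) (or_intror erefl).
  apply: (mulfI dn0); rewrite -{1}dE mulrACA e1 e2.
  have dr0 : 2 - 2 * cos a != 0 by apply: contraNneq dn0 => ->.
  transitivity ((M%:R ^+ 2 : R)%:C); first by rewrite rmorphXn rmorph_nat.
  by rewrite -[RHS]rmorphM mulrCA divff ?mulr1.
have ltK : (K < M)%N by rewrite /M ltnS -addnn leq_addr.
move: total; rewrite (bigD1 (Ordinal ltK)) //= atK.
rewrite (eq_bigr (fun l : 'I_M => (M%:R ^+ 2 * (2 - 2 * cos (circle_pt R K l))^-1)%:C)); last first.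
  by move=> l nl; rewrite offK.
rewrite -rmorph_sum -rmorphD => /complexI; rewrite -mulr_sumr sum_natr_sqr.
rewrite (eq_bigl (fun l : 'I_M => l != K :> nat)); last by [].
set X := \sum_(_ < _ | _) _ => e.
have : M%:R ^+ 2 * X = M%:R ^+ 2 * ((M%:R ^+ 2 - 1) / 12).
  by apply: (addrI ((M%:R * (M%:R - 1) / 2) ^+ 2)); rewrite e; field.
have M2 : M%:R ^+ 2 != 0 :> R by rewrite expf_neq0.
exact: (mulfI M2).
Qed.

(** The sample points l and 2 K - l have opposite angles, so the sum of [sum_inv_chord] is twice the
    sum over one side, where 2 - 2 cos(2 y) = 4 sin(y)^2. *)
Lemma sum_inv_sin2 K :
  \sum_(1 <= d < K.+1) (sin (pi * d%:R / (K.*2.+1)%:R) ^+ 2)^-1 =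
  ((K.*2.+1)%:R ^+ 2 - 1) / 6 :> R.
Proof.
set M := K.*2.+1; pose G (d : nat) : R := (2 - 2 * cos (pi *+ 2 * d%:R / M%:R))^-1.
have GE d : G d = (sin (pi * d%:R / M%:R) ^+ 2)^-1 / 4.
  rewrite /G -invfM; congr (_^-1); set y := pi * _ / _.
  have -> : pi *+ 2 * d%:R / M%:R = y *+ 2 by rewrite /y; ring.
  by rewrite cos_mulr2n cos2sin2; ring.
have := sum_inv_chord K; rewrite -/M.
rewrite -(big_mkord (fun l => l != K) (fun l => (2 - 2 * cos (circle_pt R K l))^-1)).
have ltK : (K <= M)%N by rewrite /M; lia.
rewrite (big_cat_nat (leq0n K) ltK) /=.
rewrite [X in _ + X]big_ltn_cond; last by rewrite /M; lia.
rewrite eqxx /=.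
have -> : \sum_(0 <= i < K | i != K) (2 - 2 * cos (circle_pt R K i))^-1 = \sum_(1 <= d < K.+1) G d.
  rewrite big_add1 /= [RHS]big_nat_rev /= add0n big_nat_cond [RHS]big_nat_cond.
  apply: eq_big => [i|i /andP[/andP[_ lt] _]]; first by lia.
  rewrite /G /circle_pt -/M; congr (_^-1); congr (_ - _ * _).
  rewrite -cosN; congr cos;
  have -> : ((K - i.+1).+1)%:R = K%:R - i%:R :> R by rewrite -natrB 1?ltnW //; congr (_%:R); lia.
  by ring.
have -> : \sum_(K.+1 <= i < M | i != K) (2 - 2 * cos (circle_pt R K i))^-1 = \sum_(1 <= d < K.+1) G d.
  rewrite -[K.+1 in LHS]add1n big_addn (_ : (M - K)%N = K.+1); last by rewrite /M; lia.
  rewrite big_nat_cond [RHS]big_nat_cond; apply: eq_big => [i|i _]; first by lia.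
  rewrite /G /circle_pt -/M natrD addrK //.
rewrite (eq_bigr _ (fun d _ => GE d)) -mulr_suml; set X := \sum_(_ <= _ < _) _; lra.
Qed.

Lemma inv_sin2_le (y : R) : 0 < y <= 2 -> (sin y ^+ 2)^-1 <= (y ^+ 2)^-1 + 2.
Proof.
move=> /andP[y0 y2].
have y22 : y ^+ 2 <= 4.
  by have := ler_pM (ltW y0) (ltW y0) y2 y2; lra.
have yy0 : 0 < y ^+ 2 by rewrite exprn_gt0.
pose u := y ^+ 2 / 6; have u0 : 0 < u by rewrite divr_gt0.
have u1 : u <= 2 / 3 by rewrite /u; lra.
have s1 : y * (1 - u) <= sin y.
  apply: le_trans (sin_ge_cubic (ltW y0)).
  by rewrite [leRHS](_ : _ = y * (1 - u)) // /u; field.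
have v1 : 0 < 1 - u by lra.
have s0 : 0 < y * (1 - u) by rewrite mulr_gt0.
apply: (@le_trans _ _ ((y * (1 - u)) ^+ 2)^-1).
  rewrite lef_pV2 ?posrE ?exprn_gt0 ?(lt_le_trans s0) //.
  by rewrite lerXn2r ?nnegrE ?(ltW s0) // (le_trans (ltW s0)).
have -> : (y ^+ 2)^-1 + 2 = (1 + 12 * u) / y ^+ 2 by rewrite /u; field; apply: lt0r_neq0.
rewrite exprMn invfM mulrC ler_pM2r ?invr_gt0 //.
rewrite -[leLHS]mul1r ler_pdivrMr ?exprn_gt0 //.
(* In terms of u = y^2 / 6 the additive constant 2 becomes 12 u, and u <= 2 / 3 keeps both linear
   factors nonnegative. *)
have -> : (1 + 12 * u) * (1 - u) ^+ 2 = 1 + u * ((2 - 3 * u) * (5 - 4 * u)) by ring.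
rewrite lerDl; apply: mulr_ge0; first exact: ltW.
by apply: mulr_ge0; lra.
Qed.

Lemma sqr_div_mulV (m p j : R) : m != 0 -> p != 0 -> j != 0 ->
  (m / p) ^+ 2 * (j ^+ 2)^-1 = ((p * j / m) ^+ 2)^-1.
Proof. by move=> m0 p0 j0; field; rewrite m0 j0. Qed.

(** Cauchy's argument: with y = pi j / (2 J + 1), the inequality sin y <= y turns the exact value of
    [sum_inv_sin2] into a bound for the inverse squares. *)
Lemma basel_le J : \sum_(1 <= j < J.+1) (j%:R ^+ 2)^-1 <= pi ^+ 2 / 6 :> R.
Proof.
have := sum_inv_sin2 J; set M := (J.*2.+1)%:R => e.
have M0 : 0 < M by rewrite ltr0n.
have p0 := pi_gt0 R.
have h : (M / pi) ^+ 2 * \sum_(1 <= j < J.+1) (j%:R ^+ 2)^-1 <= M ^+ 2 / 6.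
  apply: (@le_trans _ _ ((M ^+ 2 - 1) / 6)); last by lra.
  rewrite -e mulr_sumr !big_nat; apply: ler_sum => j /andP[j1 lej].
  have j0 : 0 < j%:R :> R by rewrite ltr0n.
  set y := pi * _ / _; have y0 : 0 < y by rewrite divr_gt0 // mulr_gt0.
  have yp : y < pi.
    by rewrite ltr_pdivrMr // ltr_pM2l // ltr_nat; lia.
  have s0 : 0 < sin y by rewrite sin_gt0_pi // y0.
  have -> : (M / pi) ^+ 2 * (j%:R ^+ 2)^-1 = (y ^+ 2)^-1.
    by rewrite sqr_div_mulV // lt0r_neq0.
  rewrite lef_pV2 ?posrE ?exprn_gt0 // lerXn2r ?nnegrE ?(ltW y0) ?(ltW s0) //.
  by rewrite sin_le_id // ltW.
have c0 : 0 < (M / pi) ^+ 2 by rewrite exprn_gt0 // divr_gt0.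
rewrite -(ler_pM2l c0); apply: le_trans h _.
rewrite [leRHS](_ : _ = M ^+ 2 / 6) //; move: p0; move: (pi : R) => p p0.
by move: M M0 {e c0} => M M0; field; apply: lt0r_neq0.
Qed.

(** Here [inv_sin2_le] loses at most 2 per term, as pi j / (2 J + 1) <= 2. The total loss 2 J,
    rescaled by (pi / M)^2, fits into 9 / J. *)
Lemma basel_ge J : (0 < J)%N ->
  pi ^+ 2 / 6 - 9 / J%:R <= \sum_(1 <= j < J.+1) (j%:R ^+ 2)^-1 :> R.
Proof.
move=> J0; have := sum_inv_sin2 J; set M := (J.*2.+1)%:R => e.
have M0 : 0 < M by rewrite ltr0n.
have p0 := pi_gt0 R; have p4 := pi_lt4 R.
have Jr : 1 <= J%:R :> R by rewrite ler1n.
have Jr0 : 0 < J%:R :> R by rewrite ltr0n.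
have MJ : M = 2 * J%:R + 1 by rewrite /M -addn1 natrD -mul2n natrM.
have h : (M ^+ 2 - 1) / 6 - 2 * J%:R <= (M / pi) ^+ 2 * \sum_(1 <= j < J.+1) (j%:R ^+ 2)^-1.
  rewrite -e lerBlDr.
  have -> : 2 * J%:R = \sum_(1 <= j < J.+1) 2 :> R.
    by rewrite sumr_const_nat subn1 /= mulr_natr.
  rewrite mulr_sumr -big_split /= !big_nat; apply: ler_sum => j /andP[j1 lej].
  have j0 : 0 < j%:R :> R by rewrite ltr0n.
  set y := pi * _ / _; have y0 : 0 < y by rewrite divr_gt0 // mulr_gt0.
  have y2 : y <= 2.
    rewrite ler_pdivrMr //.
    have : pi * j%:R <= 4 * j%:R :> R by rewrite ler_pM2r // ltW.
    have : j%:R <= J%:R :> R by rewrite ler_nat; lia.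
    lra.
  by rewrite sqr_div_mulV ?lt0r_neq0 // inv_sin2_le // y0.
have c0 : 0 < (M / pi) ^+ 2 by rewrite exprn_gt0 // divr_gt0.
rewrite -(ler_pM2l c0); apply: le_trans h.
have p16 : pi ^+ 2 <= 16 :> R by nra.
have -> : (M / pi) ^+ 2 * (pi ^+ 2 / 6 - 9 / J%:R) = M ^+ 2 / 6 - 9 * M ^+ 2 / (J%:R * pi ^+ 2).
  move: p0 {p4 p16 c0 e}; move: (pi : R) => p p0; move: M M0 {MJ} => M M0.
  by field; rewrite !lt0r_neq0 // (lt_le_trans ltr01).
have : 9 * M ^+ 2 / (16 * J%:R) <= 9 * M ^+ 2 / (J%:R * pi ^+ 2).
  rewrite ler_wpM2l ?mulr_ge0 ?sqr_ge0 // lef_pV2 ?posrE ?mulr_gt0 ?exprn_gt0 //.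
  by rewrite mulrC ler_wpM2r // ltW.
have : 1 / 6 + 2 * J%:R <= 9 * M ^+ 2 / (16 * J%:R).
  have c16 : 0 < 16 * J%:R :> R by rewrite mulr_gt0.
  by rewrite (ler_pdivlMr _ _ c16) MJ; move: Jr; clear; move: (J%:R : R) => j; nra.
lra.
Qed.
End basel.

(** * Lambert sums *)

Section sums.
Variable R : realType.
Implicit Types x y u : R.

(** Equals 1 / (2 sinh(u / 2))^2, and is also the value of the series of the i e^(-iu). *)
Definition inv_sinh2 u : R := expR (- u) / (1 - expR (- u)) ^+ 2.

Lemma expRN_lt1 u : 0 < u -> expR (- u) < 1.
Proof. by move=> u0; rewrite expR_lt1 oppr_lt0. Qed.

Lemma inv_sinh2E u : 0 < u ->
  inv_sinh2 u = ((expR (u / 2) - expR (- (u / 2))) ^+ 2)^-1.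
Proof.
move=> u0; rewrite /inv_sinh2; set z := expR (- (u / 2)).
have z0 : z != 0 by rewrite gt_eqF // expR_gt0.
have eu : expR (- u) = z ^+ 2 by rewrite /z -expRM_natl; congr expR; field.
have z1 : 1 - z ^+ 2 != 0 by rewrite -eu subr_eq0 gt_eqF // expRN_lt1.
have -> : expR (u / 2) = z^-1 by rewrite /z -expRN opprK.
by rewrite eu (_ : z^-1 - z = (1 - z ^+ 2) / z); field; rewrite ?z0.
Qed.

(** Halving the argument twice gives 2 sinh y = 2 sinh(y / 2) * (2 + (2 sinh(y / 4))^2), and
    [sinh_ge] bounds both factors. *)
Lemma sinh_ge_cubic y : 0 <= y -> 2 * y + y ^+ 3 / 4 <= expR y - expR (- y).
Proof.
move=> y0; have h4 := sinh_ge (divr_ge0 y0 (ler0n _ 4)).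
have h2 := sinh_ge (divr_ge0 y0 (ler0n _ 2)).
set a := expR (y / 4) in h4; set b := expR (y / 2) in h2.
have a0 : 0 < a by exact: expR_gt0.
have b0 : 0 < b by exact: expR_gt0.
have ab : b = a ^+ 2 by rewrite /a /b -expRM_natl; congr expR; field.
have ey : expR y = b ^+ 2 by rewrite /b -expRM_natl; congr expR; field.
rewrite expRN -/a in h4; rewrite expRN -/b in h2; rewrite expRN ey.
have -> : b ^+ 2 - (b ^+ 2)^-1 = (b - b^-1) * (2 + (a - a^-1) ^+ 2).
  by rewrite ab; field; rewrite lt0r_neq0.
have -> : 2 * y + y ^+ 3 / 4 = (2 * (y / 2)) * (2 + (2 * (y / 4)) ^+ 2) by field.
have y4 : 0 <= 2 * (y / 4) by lra.
rewrite ler_pM ?addr_ge0 ?sqr_ge0 //; first by lra.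
by rewrite lerD2l lerXn2r ?nnegrE // (le_trans y4).
Qed.

Lemma inv_sinh2_le u : 0 < u -> inv_sinh2 u <= (u ^+ 2)^-1.
Proof.
move=> u0; rewrite inv_sinh2E //.
have := sinh_ge (divr_ge0 (ltW u0) (ler0n _ 2)) => h.
have h' : u <= expR (u / 2) - expR (- (u / 2)) by lra.
have h0 := lt_le_trans u0 h'.
by rewrite lef_pV2 ?posrE ?exprn_gt0 // lerXn2r ?nnegrE // ltW.
Qed.

(** With w = u^2 >= 1 the cubic term improves the denominator by a factor 17 / 16, a gain of 1 / (17
    w); w <= 9 makes it at least 1 / 153. *)
Lemma inv_sinh2_le_mid u : 1 <= u <= 3 -> inv_sinh2 u <= (u ^+ 2)^-1 - 153^-1.
Proof.
move=> /andP[u1 u3]; have u0 : 0 < u by lra.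
rewrite inv_sinh2E //.
have h := sinh_ge_cubic (divr_ge0 (ltW u0) (ler0n _ 2)).
have h' : u * (1 + u ^+ 2 / 32) <= expR (u / 2) - expR (- (u / 2)).
  by apply: le_trans h; rewrite [leRHS](_ : _ = u * (1 + u ^+ 2 / 32)) //; field.
have v0 : 0 < u * (1 + u ^+ 2 / 32) by rewrite mulr_gt0 // ltr_wpDr // divr_ge0 ?sqr_ge0.
apply: (@le_trans _ _ ((u * (1 + u ^+ 2 / 32)) ^+ 2)^-1).
  have := lt_le_trans v0 h' => w0.
  by rewrite lef_pV2 ?posrE ?exprn_gt0 // lerXn2r ?nnegrE // ltW.
have u2 : 1 <= u ^+ 2 by rewrite expr2; nra.
have u9 : u ^+ 2 <= 9 by rewrite expr2; nra.
set w := u ^+ 2 in u2 u9 *.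
have w0 : 0 < w by lra.
have -> : (u * (1 + w / 32)) ^+ 2 = w * (1 + w / 32) ^+ 2 by rewrite exprMn.
have c0 : 0 < 1 + w / 32 by lra.
have c2 : 17 / 16 <= (1 + w / 32) ^+ 2 by rewrite expr2; nra.
apply: (@le_trans _ _ (w * (17 / 16))^-1).
  by rewrite lef_pV2 ?posrE ?mulr_gt0 ?exprn_gt0 // ler_pM2l.
have -> : (w * (17 / 16))^-1 = w^-1 - (17 * w)^-1 by field; rewrite lt0r_neq0.
rewrite lerB // lef_pV2 ?posrE ?mulr_gt0 //; lra.
Qed.

Lemma coth_ge u : 0 < u -> 2 / u <= (1 + expR (- u)) / (1 - expR (- u)).
Proof.
move=> u0; have y1 := expRN_lt1 u0; have h := expR_mul_sub2_ge0 (ltW u0).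
have e0 := expR_gt0 (- u); have e1 := expRxMexpNx_1 u.
rewrite ler_pdivrMr // mulrAC ler_pdivlMr ?subr_gt0 //.
have : 0 <= expR (- u) * (expR u * (u - 2) + u + 2) by rewrite mulr_ge0 // ltW.
have -> : expR (- u) * (expR u * (u - 2) + u + 2) = (expR u * expR (- u)) * (u - 2) + expR (- u) * (u + 2) by ring.
rewrite e1; lra.
Qed.

Lemma coth_le u : 0 < u -> (1 + expR (- u)) / (1 - expR (- u)) <= 2 / u + u.
Proof.
move=> u0; have y1 := expRN_lt1 u0; have h := expR_ge_quad (ltW u0).
have e0 := expR_gt0 (- u); have e1 := expRxMexpNx_1 u.
have -> : 2 / u + u = (2 + u ^+ 2) / u by field; apply: lt0r_neq0.
rewrite ler_pdivlMr // mulrAC ler_pdivrMr ?subr_gt0 //.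
(* The claim amounts to e^u * (u^2 - u + 2) >= u^2 + u + 2. With e^u replaced by its quadratic
   bound, the left side exceeds the right by u^3 * (1 + u) / 2. *)
have : 0 <= expR (- u) * (expR u - (1 + u + u ^+ 2 / 2)) * (u ^+ 2 + 2 - u).
  rewrite !mulr_ge0 ?(ltW e0) // ?subr_ge0 //.
  by have := sqr_ge0 (u - 1); rewrite expr2; nra.
have -> : expR (- u) * (expR u - (1 + u + u ^+ 2 / 2)) * (u ^+ 2 + 2 - u) =
 (expR u * expR (- u)) * (u ^+ 2 + 2 - u) - expR (- u) * ((1 + u + u ^+ 2 / 2) * (u ^+ 2 + 2 - u)) by ring.
rewrite e1 => h1.
have : 0 <= expR (- u) * (u ^+ 2 * u * (1 + u) / 2).
  by rewrite !mulr_ge0 ?sqr_ge0 ?(ltW e0) ?(ltW u0) // addr_ge0 // ltW.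
nra.
Qed.

(** Follows from 1 / sinh^2 = coth^2 - 1 and [coth_ge]. *)
Lemma inv_sinh2_ge u : 0 < u -> (u ^+ 2)^-1 - 4^-1 <= inv_sinh2 u.
Proof.
move=> u0; have y1 := expRN_lt1 u0; have h := coth_ge u0.
have -> : inv_sinh2 u = (((1 + expR (- u)) / (1 - expR (- u))) ^+ 2 - 1) / 4.
  by rewrite /inv_sinh2; field; rewrite subr_eq0 gt_eqF.
have : (2 / u) ^+ 2 <= ((1 + expR (- u)) / (1 - expR (- u))) ^+ 2.
  by rewrite lerXn2r ?nnegrE ?(le_trans _ h) // divr_ge0 // ltW.
have -> : (2 / u) ^+ 2 = 4 * (u ^+ 2)^-1 by field; apply: lt0r_neq0.
lra.
Qed.

Lemma inv_1sub_expRN_le u : 0 < u -> (1 - expR (- u))^-1 <= 1 + u^-1.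
Proof.
move=> u0; have y1 := expRN_lt1 u0.
have d0 : 0 < 1 - expR (- u) by rewrite subr_gt0.
have -> : 1 + u^-1 = (u + 1) / u by field; apply: lt0r_neq0.
rewrite -[leLHS]mul1r ler_pdivrMr // mulrAC ler_pdivlMr //.
have := expR_ge1Dx u; have := expRxMexpNx_1 u; have e0 := expR_gt0 (- u) => e1 h.
have : (1 + u) * expR (- u) <= 1 by rewrite -[leRHS]e1 ler_pM2r.
lra.
Qed.

Lemma sum_mul_expr x m : x != 1 ->
  \sum_(1 <= i < m.+1) i%:R * x ^+ i =
  (x - x ^+ m.+1 * (1 + m%:R * (1 - x))) / (1 - x) ^+ 2.
Proof.
move=> x1; have d : 1 - x != 0 by rewrite subr_eq0 eq_sym.
elim: m => [|m IH]; first by rewrite big_geq // expr1 mul0r addr0 mulr1 subrr mul0r.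
by rewrite big_nat_recr //= IH -[m.+1%:R]natr1 !exprS; field.
Qed.

End sums.

Section lambert_sums.
Variables (R : realType) (t : R).
Hypothesis t01 : 0 < t <= 1 / 2.

Let t0 : 0 < t. Proof. by case/andP: t01. Qed.
Let tn0 : t != 0. Proof. by rewrite gt_eqF. Qed.
Notation q := (expR (- t)).

(** For k = 1 this is [lambert m] at q. Larger k collect the Taylor terms in a of the phase, of log
    rho and of the multiplier; the size is t^-(k+1). *)
Definition lambert_sum (k m : nat) : R :=
  \sum_(1 <= i < m.+1) i%:R ^+ k * (q ^+ i / (1 - q ^+ i) ^+ k).

Lemma expRN_exp i : q ^+ i = expR (- (i%:R * t)).
Proof. by rewrite -expRM_natl mulrN. Qed.

Lemma expRN_bound : 0 <= q < 1.
Proof. by rewrite expR_ge0 expRN_lt1. Qed.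

Lemma expRN_exp_lt1 i : (0 < i)%N -> q ^+ i < 1.
Proof. by move=> i0; rewrite expRN_exp expRN_lt1 // mulr_gt0 // ltr0n. Qed.

Lemma nat_near_inv : exists A : nat, 1 / t <= A%:R <= 1 / t + 1.
Proof.
exists (Num.truncn (1 / t)).+1.
have /andP[h1 h2] := truncn_itv (ltW (divr_gt0 ltr01 t0)).
by rewrite (ltW h2) -addn1 natrD lerD2r.
Qed.

Lemma geometric_half_sum m : \sum_(1 <= i < m.+1) expR (- (i%:R * t / 2)) <= 2 / t.
Proof.
pose s := expR (- (t / 2)).
have t2 : 0 < t / 2 by rewrite divr_gt0.
have s1 : s < 1 by exact: expRN_lt1.
have s0 : 0 < s by exact: expR_gt0.
have -> : \sum_(1 <= i < m.+1) expR (- (i%:R * t / 2)) = \sum_(1 <= i < m.+1) s ^+ i.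
  by apply: eq_bigr => i _; rewrite /s -expRM_natl mulrN mulrA.
have -> : \sum_(1 <= i < m.+1) s ^+ i = s * (1 - s ^+ m) / (1 - s).
  have d : 1 - s != 0 by rewrite subr_eq0 gt_eqF.
  elim: m => [|m IH]; first by rewrite big_geq // subrr mulr0 mul0r.
  by rewrite big_nat_recr //= IH !exprS; field.
have d : 0 < 1 - s by rewrite subr_gt0.
rewrite ler_pdivrMr // mulrAC ler_pdivlMr //.
have h := expR_ge1Dx (t / 2); have e := expRxMexpNx_1 (t / 2); rewrite -/s in e.
have h1 : (1 + t / 2) * s <= 1 by rewrite -[leRHS]e ler_pM2r.
have h2 : s * (1 - s ^+ m) <= s by rewrite ler_piMr ?(ltW s0) // gerBl exprn_ge0 // ltW.
have : s * (1 - s ^+ m) * t <= s * t by rewrite ler_pM2r.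
lra.
Qed.

(** With y = i t, i / (1 - q^i) <= (1 + y) / t. Then (1 + y)^5 <= 10^5 e^((1 + y) / 2) spends half
    of the exponential decay, and e^(1/2) <= 2 gives the remaining constant. *)
Lemma lambert_term_le k i : (k <= 5)%N -> (0 < i)%N ->
  i%:R ^+ k * (q ^+ i / (1 - q ^+ i) ^+ k) <= 2 * 10 ^+ 5 / t ^+ k * expR (- (i%:R * t / 2)).
Proof.
move=> k5 i0; set y := i%:R * t; have ir : 0 < i%:R :> R by rewrite ltr0n.
have y0 : 0 < y by rewrite mulr_gt0.
rewrite !expRN_exp -/y.
have d0 : 0 < 1 - expR (- y) by rewrite subr_gt0 expRN_lt1.
have h1 : i%:R * (1 - expR (- y))^-1 <= (1 + y) / t.
  apply: le_trans (ler_wpM2l (ltW ir) (inv_1sub_expRN_le y0)) _.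
  by rewrite le_eqVlt; apply/orP; left; apply/eqP; rewrite /y; field; rewrite tn0 lt0r_neq0.
have -> : i%:R ^+ k * (expR (- y) / (1 - expR (- y)) ^+ k) =
   expR (- y) * (i%:R * (1 - expR (- y))^-1) ^+ k.
  by rewrite exprMn exprVn; ring.
apply: (@le_trans _ _ (expR (- y) * ((1 + y) / t) ^+ k)).
  rewrite ler_pM2l ?expR_gt0 // lerXn2r // nnegrE.
    by rewrite mulr_ge0 ?invr_ge0 // ltW.
  by rewrite divr_ge0 ?addr_ge0 // ltW.
have -> : expR (- y) * ((1 + y) / t) ^+ k = (expR (- y) * (1 + y) ^+ k) / t ^+ k.
  by rewrite expr_div_n mulrA.
rewrite [leRHS]mulrAC ler_pM2r ?invr_gt0 ?exprn_gt0 //.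
have h2 : (1 + y) ^+ k <= (1 + y) ^+ 5 by apply: ler_weXn2l => //; rewrite lerDl ltW.
have h3 : (1 + y) ^+ 5 <= 10 ^+ 5 * expR ((1 + y) / 2).
  have -> : expR ((1 + y) / 2) = expR ((1 + y) / 10) ^+ 5.
    by rewrite -expRM_natl; congr expR; field.
  have -> : (1 + y) ^+ 5 = 10 ^+ 5 * ((1 + y) / 10) ^+ 5 by field.
  rewrite ler_pM2l // lerXn2r ?nnegrE ?expR_ge0 //.
    by rewrite divr_ge0 // addr_ge0 // ltW.
  by apply: le_trans (expR_ge1Dx _); rewrite lerDr.
have h4 : expR (1 / 2) <= 2 :> R.
  have := expR_ge1Dx (- (1 / 2) : R); have := expRxMexpNx_1 (1 / 2 : R).
  by have := expR_gt0 (1 / 2 : R); nra.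
apply: (@le_trans _ _ (expR (- y) * (10 ^+ 5 * expR ((1 + y) / 2)))).
  by rewrite ler_pM2l ?expR_gt0 // (le_trans h2).
have -> : expR (- y) * (10 ^+ 5 * expR ((1 + y) / 2)) = 10 ^+ 5 * expR (1 / 2) * expR (- (y / 2)).
  have -> : (1 + y) / 2 = y + (1 / 2 - y / 2) by field.
  rewrite expRD [expR (1 / 2 - y / 2)]expRD.
  have e := expRxMexpNx_1 y.
  transitivity (10 ^+ 5 * ((expR y * expR (- y)) * (expR (1 / 2) * expR (- (y / 2))))); first by ring.
  by rewrite e; ring.
by rewrite ler_pM2r ?expR_gt0 //; lra.
Qed.

Lemma lambert_sum_le k m : (k <= 5)%N -> lambert_sum k m <= 4 * 10 ^+ 5 / t ^+ k.+1.
Proof.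
move=> k5; apply: (@le_trans _ _ (2 * 10 ^+ 5 / t ^+ k * (2 / t))).
  apply: (@le_trans _ _ (\sum_(1 <= i < m.+1) 2 * 10 ^+ 5 / t ^+ k * expR (- (i%:R * t / 2)))).
    by rewrite /lambert_sum !big_nat; apply: ler_sum => i /andP[i0 _]; apply: lambert_term_le.
  rewrite -mulr_sumr; apply: ler_wpM2l; last exact: geometric_half_sum.
  by rewrite divr_ge0 // exprn_ge0 // ltW.
rewrite [t ^+ k.+1]exprS [leRHS](_ : _ = 2 * 10 ^+ 5 / t ^+ k * (2 / t)) //.
by field; rewrite ?expf_neq0 ?tn0.
Qed.

Lemma lambert_term_ge0 k i : (0 < i)%N -> 0 <= i%:R ^+ k * (q ^+ i / (1 - q ^+ i) ^+ k).
Proof.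
move=> i0; have := expRN_exp_lt1 i0 => h.
by rewrite !mulr_ge0 ?exprn_ge0 ?invr_ge0 ?expR_ge0 // exprn_ge0 // subr_ge0 ltW.
Qed.

Lemma lambert_sum_ge0 k m : 0 <= lambert_sum k m.
Proof.
rewrite /lambert_sum big_nat; apply: sumr_ge0 => i /andP[i0 _].
exact: lambert_term_ge0.
Qed.

(** Only the block A <= i < 2 A is kept, where 1 <= i t <= 3. It has at least 1 / t terms, each at
    least q^i / t^2 with q^i >= (1 / 4)^4. *)
Lemma lambert_sum2_ge m : 4 / t <= m%:R -> 256^-1 / t ^+ 3 <= lambert_sum 2 m.
Proof.
move=> hm; have [A /andP[A1 A2]] := nat_near_inv.
have Ar : 0 < A%:R :> R by apply: lt_le_trans A1; rewrite divr_gt0.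
have A0 : (0 < A)%N by rewrite -(ltr0n R).
have it : 2 <= 1 / t by rewrite ler_pdivlMr //; case/andP: t01 => _; lra.
have i4 : 4 / t = 4 * (1 / t) by ring.
have leAm : (A + A <= m.+1)%N.
  by rewrite -(ler_nat R) natrD -addn1 natrD; lra.
have leA : (A <= A + A)%N by rewrite leq_addr.
rewrite /lambert_sum (big_cat_nat A0 (leq_trans leA leAm)) /=.
rewrite (big_cat_nat leA leAm) /=.
have p k l : (0 < k)%N -> 0 <= \sum_(k <= i < l) i%:R ^+ 2 * (q ^+ i / (1 - q ^+ i) ^+ 2).
  move=> k0; rewrite big_nat; apply: sumr_ge0 => i /andP[ki _].
  exact: lambert_term_ge0 (leq_trans k0 ki).
apply: (@le_trans _ _ (\sum_(A <= i < A + A) 256^-1 / t ^+ 2)).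
  rewrite sumr_const_nat addKn -[(_ / _) *+ A]mulr_natl [t ^+ 3]exprS.
  have -> : 256^-1 / (t * t ^+ 2) = 1 / t * (256^-1 / t ^+ 2) by field.
  apply: ler_wpM2r A1; apply: divr_ge0; last exact: exprn_ge0 (ltW t0).
  by rewrite invr_ge0; exact: ler0n.
have h1 := p 1%N A isT.
have h2 : 0 <= \sum_(A + A <= i < m.+1) i%:R ^+ 2 * (q ^+ i / (1 - q ^+ i) ^+ 2).
  by apply: p; rewrite addn_gt0 A0.
suff : \sum_(A <= i < A + A) 256^-1 / t ^+ 2 <=
   \sum_(A <= i < A + A) i%:R ^+ 2 * (q ^+ i / (1 - q ^+ i) ^+ 2) by lra.
rewrite !big_nat; apply: ler_sum => i /andP[Ai iA].
have i0 : (0 < i)%N := leq_trans A0 Ai.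
have x1 := expRN_exp_lt1 i0.
have ir : 1 / t <= i%:R by apply: le_trans A1 _; rewrite ler_nat.
have ir2 : i%:R * t <= 3.
  have : i%:R <= A%:R + A%:R :> R by rewrite -natrD ler_nat ltnW.
  move=> h; have e3 : 3 / t = 3 * (1 / t) by ring.
  have : i%:R <= 3 / t by rewrite e3; move: A2 it h; clear; lra.
  by rewrite ler_pdivlMr.
have e3 : 256^-1 <= q ^+ i.
  rewrite expRN_exp; set w := i%:R * t; have -> : - w = 4%:R * (- (w / 4)) by field.
  rewrite expRM_natl; have h := expR_ge1Dx (- (w / 4)).
  have h' : 1 / 4 <= expR (- (w / 4)) by rewrite -/w in ir2; lra.
  have -> : 256^-1 = (1 / 4) ^+ 4 :> R by field.
  by rewrite lerXn2r ?nnegrE ?divr_ge0 // expR_ge0.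
rewrite mulrC; apply: ler_pM.
- by rewrite invr_ge0; exact: exprn_ge0 (ltW t0).
- by rewrite invr_ge0; exact: ler0n.
- have -> : (t ^+ 2)^-1 = (1 / t) ^+ 2 by field.
  by rewrite lerXn2r ?nnegrE // divr_ge0 // ltW.
apply: le_trans e3 _; rewrite ler_pdivlMr ?exprn_gt0 ?subr_gt0 //.
rewrite ler_piMr ?exprn_ge0 ?expR_ge0 // exprn_ile1 ?subr_ge0 ?(ltW x1) // gerBl.
Qed.

End lambert_sums.

Section lambert1.
Variables (R : realType) (t : R).
Hypothesis t01 : 0 < t <= 1 / 2.

Let t0 : 0 < t. Proof. by case/andP: t01. Qed.
Let tn0 : t != 0. Proof. by rewrite gt_eqF. Qed.
Notation q := (expR (- t)).

Lemma pi2_6_le3 : pi ^+ 2 / 6 <= 3 :> R.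
Proof.
have p0 := pi_gt0 R; have p4 := pi_lt4 R; move: p0 p4; move: (pi : R) => p p0 p4.
nra.
Qed.

Lemma sum_mul_qX_le m j : (0 < j)%N ->
  \sum_(1 <= i < m.+1) i%:R * q ^+ (i * j) <= inv_sinh2 (j%:R * t).
Proof.
move=> j0; set y := q ^+ j; have y1 : y < 1 := expRN_exp_lt1 t01 j0.
have y0 : 0 <= y by rewrite exprn_ge0 // expR_ge0.
have -> : \sum_(1 <= i < m.+1) i%:R * q ^+ (i * j) = \sum_(1 <= i < m.+1) i%:R * y ^+ i.
  by apply: eq_bigr => i _; rewrite mulnC exprM.
rewrite sum_mul_expr ?lt_eqF // /inv_sinh2 -expRN_exp -/y.
rewrite ler_wpM2r ?invr_ge0 ?sqr_ge0 // gerBl mulr_ge0 ?exprn_ge0 // addr_ge0 //.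
by rewrite mulr_ge0 // subr_ge0 ltW.
Qed.

Lemma sum_mul_qX_ge m j : (0 < j)%N ->
  inv_sinh2 (j%:R * t) * (1 - m.+1%:R * q ^+ m) <= \sum_(1 <= i < m.+1) i%:R * q ^+ (i * j).
Proof.
move=> j0; set y := q ^+ j; have y1 : y < 1 := expRN_exp_lt1 t01 j0.
have y0 : 0 <= y by rewrite exprn_ge0 // expR_ge0.
have -> : \sum_(1 <= i < m.+1) i%:R * q ^+ (i * j) = \sum_(1 <= i < m.+1) i%:R * y ^+ i.
  by apply: eq_bigr => i _; rewrite mulnC exprM.
rewrite sum_mul_expr ?lt_eqF // /inv_sinh2 -expRN_exp -/y.
rewrite mulrAC ler_wpM2r ?invr_ge0 ?sqr_ge0 //.
have h1 : y ^+ m <= q ^+ m.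
  rewrite lerXn2r ?nnegrE ?expR_ge0 // -[leRHS]expr1; apply: ler_wiXn2l => //.
  by rewrite ltW // expRN_lt1.
have h2 : 1 + m%:R * (1 - y) <= m.+1%:R.
  by rewrite -natr1 addrC lerD2r ler_piMr // gerBl.
have h3 : y ^+ m * (1 + m%:R * (1 - y)) <= q ^+ m * m.+1%:R.
  by rewrite ler_pM ?exprn_ge0 // addr_ge0 // mulr_ge0 // subr_ge0 ltW.
rewrite exprS; have := ler_wpM2l y0 h3; lra.
Qed.

(** The block A <= j < 2 A, where 1 <= j t <= 3, supplies at least 1 / t terms with the uniform gain
    of [inv_sinh2_le_mid]; the other terms use only [inv_sinh2_le]. *)
Lemma lambert_sum1_le m : lambert_sum t 1 m <= pi ^+ 2 / 6 / t ^+ 2 - 153^-1 / t.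
Proof.
set B := _ - _; rewrite leNgt; apply/negP => ltB.
set L := lambert_sum t 1 m in ltB.
have [A /andP[A1 A2]] := nat_near_inv t01.
have Ar : 0 < A%:R :> R by apply: lt_le_trans A1; rewrite divr_gt0.
have A0 : (0 < A)%N by rewrite -(ltr0n R).
have it : 2 <= 1 / t by rewrite ler_pdivlMr //; case/andP: t01 => _; lra.
(* Exchanging the sums over i and j is done for j <= J, at the cost of a factor 1 - q ^+ J; a large
   J then contradicts [ltB]. *)
have key J : (A + A <= J.+1)%N -> L * (1 - q ^+ J) <= B.
  move=> leJ.
  apply: (@le_trans _ _ (\sum_(1 <= j < J.+1) inv_sinh2 (j%:R * t))).
    apply: (@le_trans _ _ (\sum_(1 <= j < J.+1) \sum_(1 <= i < m.+1) i%:R * q ^+ (i * j))); last first.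
      by rewrite !big_nat; apply: ler_sum => j /andP[j0 _]; apply: sum_mul_qX_le.
    rewrite exchange_big /= /L /lambert_sum mulr_suml !big_nat.
    apply: ler_sum => i /andP[i0 _]; rewrite !expr1 -mulr_sumr -mulrA ler_wpM2l //.
    have x1 := expRN_exp_lt1 t01 i0; have d : 0 < 1 - q ^+ i by rewrite subr_gt0.
    have -> : \sum_(1 <= j < J.+1) q ^+ (i * j) = q ^+ i * (1 - (q ^+ i) ^+ J) / (1 - q ^+ i).
      elim: J {leJ} => [|J IH]; first by rewrite big_geq // subrr mulr0 mul0r.
      by rewrite big_nat_recr //= IH exprM !exprS; field; rewrite lt0r_neq0.
    rewrite mulrAC ler_wpM2r ?invr_ge0 ?(ltW d) // ler_wpM2l ?exprn_ge0 ?expR_ge0 //.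
    rewrite lerB // lerXn2r ?nnegrE ?exprn_ge0 ?expR_ge0 //.
    rewrite -[leRHS]expr1; apply: ler_wiXn2l; rewrite ?expR_ge0 //.
    by rewrite ltW // expRN_lt1.
  have basel := @basel_le R J.
  have sq j : (0 < j)%N -> ((j%:R * t) ^+ 2)^-1 = (t ^+ 2)^-1 * (j%:R ^+ 2)^-1.
    by move=> j0; rewrite exprMn invfM mulrC.
  have leA : (A <= A + A)%N by rewrite leq_addr.
  apply: (@le_trans _ _ ((t ^+ 2)^-1 * (\sum_(1 <= j < J.+1) (j%:R ^+ 2)^-1)
      - \sum_(A <= j < A + A) 153^-1)).
    rewrite mulr_sumr (big_cat_nat A0 (leq_trans leA leJ)) /=.
    rewrite (big_cat_nat leA leJ) /= [X in _ <= X - _](big_cat_nat A0 (leq_trans leA leJ)) /=.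
    rewrite [X in _ <= _ + X - _](big_cat_nat leA leJ) /=.
    have p k l : (0 < k)%N -> \sum_(k <= j < l) inv_sinh2 (j%:R * t) <=
        \sum_(k <= j < l) (t ^+ 2)^-1 * (j%:R ^+ 2)^-1.
      move=> k0; rewrite !big_nat; apply: ler_sum => j /andP[kj _].
      have j0 := leq_trans k0 kj.
      by rewrite -sq //; apply: inv_sinh2_le; rewrite mulr_gt0 // ltr0n.
    have h1 := p 1%N A isT.
    have h2 := p (A + A)%N J.+1 ltac:(by rewrite addn_gt0 A0).
    suff : \sum_(A <= j < A + A) inv_sinh2 (j%:R * t) <=
      \sum_(A <= j < A + A) (t ^+ 2)^-1 * (j%:R ^+ 2)^-1 - \sum_(A <= j < A + A) 153^-1.
      move: h1 h2; clear; lra.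
    rewrite -sumrB !big_nat; apply: ler_sum => j /andP[Aj jA].
    have j0 := leq_trans A0 Aj.
    rewrite -sq //; apply: inv_sinh2_le_mid.
    have h3 : 1 / t <= j%:R by apply: le_trans A1 _; rewrite ler_nat.
    rewrite -[X in X && _]ler_pdivrMr // h3 /= -ler_pdivlMr //.
    have : j%:R <= A%:R + A%:R :> R by rewrite -natrD ler_nat ltnW.
    have -> : 3 / t = 3 * (1 / t) by ring.
    move: A2 it; clear; lra.
  rewrite /B sumr_const_nat addKn -[_ *+ A]mulr_natr.
  apply: lerB; first by rewrite mulrC ler_wpM2r // invr_ge0 exprn_ge0 // ltW.
  by rewrite ler_wpM2l ?invr_ge0 // -[_^-1]mul1r.
have L0 : 0 <= L by exact: lambert_sum_ge0.
have e0 : 0 < (L - B) / (L + 1) / 2 by rewrite !divr_gt0 // ?subr_gt0 // ltr_wpDl.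
have [J0 HJ] := expr_small (expRN_bound t01) e0.
have := key (maxn J0 (A + A)) ltac:(rewrite ltnW // ltnS leq_maxr //).
have := HJ (maxn J0 (A + A)) (leq_maxl _ _); set x := q ^+ _ => hx hk.
have L1 : 0 < L + 1 by rewrite ltr_wpDl.
have : L * x <= (L + 1) * ((L - B) / (L + 1) / 2).
  by rewrite ler_pM // ?exprn_ge0 ?expR_ge0 // lerDl.
have -> : (L + 1) * ((L - B) / (L + 1) / 2) = (L - B) / 2 by field; rewrite lt0r_neq0.
move: hk ltB; clear; lra.
Qed.

(** About 1 / t values of j suffice: the Basel tail costs 9 / t, the loss 1 / 4 per term costs less
    than 1 / t, and the truncation at m costs a factor 1 - t, hence about 3 / t. *)
Lemma lambert_sum1_ge m : m.+1%:R * q ^+ m <= t ->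
  pi ^+ 2 / 6 / t ^+ 2 - 20 / t <= lambert_sum t 1 m.
Proof.
move=> hm.
have [A /andP[A1 A2]] := nat_near_inv t01.
have Ar : 0 < A%:R :> R by apply: lt_le_trans A1; rewrite divr_gt0.
have A0 : (0 < A)%N by rewrite -(ltr0n R).
have it : 2 <= 1 / t by rewrite ler_pdivlMr //; case/andP: t01 => _; lra.
pose S := \sum_(1 <= j < A.+1) inv_sinh2 (j%:R * t).
have tl : t <= 1 / 2 by case/andP: t01.
have h1 : S * (1 - t) <= lambert_sum t 1 m.
  apply: (@le_trans _ _ (\sum_(1 <= j < A.+1) \sum_(1 <= i < m.+1) i%:R * q ^+ (i * j))).
    rewrite /S mulr_suml !big_nat; apply: ler_sum => j /andP[j0 _].
    apply: le_trans (sum_mul_qX_ge m j0); apply: ler_wpM2l; last by rewrite lerB.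
    by rewrite /inv_sinh2 divr_ge0 ?expR_ge0 ?sqr_ge0.
  rewrite exchange_big /= /lambert_sum !big_nat.
  apply: ler_sum => i /andP[i0 _]; rewrite !expr1 -mulr_sumr ler_wpM2l //.
  have x1 := expRN_exp_lt1 t01 i0; have d : 0 < 1 - q ^+ i by rewrite subr_gt0.
  have -> : \sum_(1 <= j < A.+1) q ^+ (i * j) = q ^+ i * (1 - (q ^+ i) ^+ A) / (1 - q ^+ i).
    elim: (A) => [|J IH]; first by rewrite big_geq // subrr mulr0 mul0r.
    by rewrite big_nat_recr //= IH exprM !exprS; field; rewrite lt0r_neq0.
  rewrite ler_wpM2r ?invr_ge0 ?(ltW d) //; apply: ler_piMr.
    by rewrite exprn_ge0 // expR_ge0.
  by rewrite gerBl !exprn_ge0 // expR_ge0.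
apply: le_trans h1.
have h2 : pi ^+ 2 / 6 / t ^+ 2 - 10 / t <= S.
  apply: (@le_trans _ _ ((t ^+ 2)^-1 * (\sum_(1 <= j < A.+1) (j%:R ^+ 2)^-1) - A%:R / 4)).
    have b := @basel_ge R A A0.
    have : (t ^+ 2)^-1 * (pi ^+ 2 / 6 - 9 / A%:R) <= (t ^+ 2)^-1 * (\sum_(1 <= j < A.+1) (j%:R ^+ 2)^-1).
      by rewrite ler_wpM2l // invr_ge0 exprn_ge0 // ltW.
    have : (t ^+ 2)^-1 * (9 / A%:R) <= 9 / t.
      have -> : 9 / t = (t ^+ 2)^-1 * (9 * t) by field.
      rewrite ler_wpM2l ?invr_ge0 ?exprn_ge0 ?(ltW t0) // ler_wpM2l //.
      by rewrite -[t]invrK lef_pV2 ?posrE ?invr_gt0 // -[t^-1]mul1r.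
    have -> : 9 / t = 9 * (1 / t) by ring.
    have -> : 10 / t = 10 * (1 / t) by ring.
    rewrite [(t ^+ 2)^-1 * (_ - _)]mulrBr [pi ^+ 2 / 6 / t ^+ 2]mulrC.
    move: A2 it; clear; move: (_ * (pi ^+ 2 / 6)) => P; lra.
  have -> : A%:R / 4 = \sum_(1 <= j < A.+1) 4^-1 :> R.
    by rewrite sumr_const_nat subn1 /= -[RHS]mulr_natl.
  rewrite mulr_sumr -sumrB /S !big_nat; apply: ler_sum => j /andP[j0 _].
  have := inv_sinh2_ge (mulr_gt0 (_ : 0 < j%:R) t0).
  by rewrite exprMn invfM mulrC; apply; rewrite ltr0n.
have P3 := pi2_6_le3; move: h2 P3; move: (pi ^+ 2 / 6) => P h2 P3.
apply: (@le_trans _ _ ((P / t ^+ 2 - 10 / t) * (1 - t))); last first.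
  by rewrite ler_wpM2r // subr_ge0; lra.
have -> : (P / t ^+ 2 - 10 / t) * (1 - t) = P / t ^+ 2 - P / t - 10 / t + 10 by field.
have : P / t <= 3 / t by rewrite ler_wpM2r // invr_ge0 ltW.
have -> : 10 / t = 10 * (1 / t) by ring.
have -> : 20 / t = 20 * (1 / t) by ring.
have -> : 3 / t = 3 * (1 / t) by ring.
lra.
Qed.

(** This fixes the size of the cutoff m: e^y >= y^2 / 2 at y = m t bounds the left side by 4 / (m
    t^2). *)
Lemma succ_mul_expRN_le m : 4 / t ^+ 3 <= m%:R -> m.+1%:R * q ^+ m <= t.
Proof.
move=> hm; have t3 : 0 < t ^+ 3 by rewrite exprn_gt0.
have m0 : 0 < m%:R :> R by apply: lt_le_trans hm; rewrite divr_gt0.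
have m1 : 1 <= m%:R :> R by rewrite ler1n -(ltr0n R).
rewrite expRN_exp; set y := m%:R * t; have y0 : 0 < y by rewrite mulr_gt0.
have h : y ^+ 2 / 2 <= expR y.
  by apply: le_trans (expR_ge_quad (ltW y0)); rewrite lerDr addr_ge0 // ltW.
have y2 : 0 < y ^+ 2 / 2 by rewrite divr_gt0 // exprn_gt0.
have h' : expR (- y) <= (y ^+ 2 / 2)^-1 by rewrite expRN lef_pV2 // posrE expR_gt0.
apply: (@le_trans _ _ ((m%:R + m%:R) * (y ^+ 2 / 2)^-1)).
  by rewrite ler_pM ?expR_ge0 // -natr1 lerD2l.
have -> : (m%:R + m%:R) * (y ^+ 2 / 2)^-1 = (4 / t ^+ 3) / m%:R * t.
  by rewrite /y; field; rewrite tn0 lt0r_neq0.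
rewrite -[leRHS]mul1r ler_wpM2r ?(ltW t0) // ler_pdivrMr // mul1r //.
Qed.

End lambert1.

(** * From kernel estimates to coefficients *)

Section coef_bounds.
Local Open Scope complex_scope.
Variable R : realType.
Implicit Types (r c : R) (Q : nat -> {poly R[i]}) (g : R[i] -> R[i]).

Lemma coef_ge_circle_avg r Q g n (w : R) c : 0 < r -> unif_lim r Q g ->
  (exists J1, forall J, (J1 <= J)%N -> (Q J)`_n = w%:C) ->
  (forall K, c <= circle_avg K (fun a => Re (g (r%:C * cis a) * cis (- (n%:R * a))))) ->
  c <= w * r ^+ n.
Proof.
move=> r0 lim cf h; rewrite -subr_ge0 leNgt; apply/negP => lt0.
have e0 : 0 < (c - w * r ^+ n) / 2 by rewrite divr_gt0 //; lra.
have [K0 HK] := coef_circle_avg r0 lim cf e0.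
have := HK K0 (leqnn _); have := h K0; move: (circle_avg _ _) => x hx.
rewrite ler_norml => /andP[h1 h2]; lra.
Qed.

Lemma circle_avg_ge K (g : R -> R) c :
  (forall a, `|a| <= pi -> c <= g a) -> c <= circle_avg K g.
Proof.
move=> h; rewrite /circle_avg mulrC ler_pdivlMr ?ltr0n // mulrC.
have -> : (K.*2.+1)%:R * c = \sum_(l < K.*2.+1) c.
  by rewrite sumr_const card_ord mulr_natl.
by apply: ler_sum => l _; apply: h; apply: circle_pt_bound.
Qed.

(* At least a proportion d / (2 pi) of the sample points lie in [0, d]. *)
Lemma circle_avg_ge_near K (g : R -> R) b c d : 0 <= b -> 0 <= d <= 1 ->
  (forall a, `|a| <= pi -> - c <= g a) -> (forall a, `|a| <= d -> b - c <= g a) ->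
  b * (d / 8) - c <= circle_avg K g.
Proof.
move=> b0 /andP[d0 d1] h1 h2.
have Mr : 0 < (K.*2.+1)%:R :> R by rewrite ltr0n.
have p0 := pi_gt0 R; have p4 := pi_lt4 R; have p2 := pi_ge2 R.
rewrite /circle_avg [leRHS]mulrC ler_pdivlMr //.
pose chi (l : nat) : R := if `|circle_pt R K l| <= d then b else 0.
have ub : \sum_(l < K.*2.+1) (chi l - c) <= \sum_(l < K.*2.+1) g (circle_pt R K l).
  apply: ler_sum => l _; rewrite /chi; case: ifP => [le|_]; first exact: h2.
  by rewrite sub0r; apply: h1; apply: circle_pt_bound.
apply: le_trans ub; rewrite sumrB mulrBl sumr_const card_ord -[c *+ _]mulr_natr lerD2r.
(* The samples K to K + D have angles from 0 to 2 pi D / (2 K + 1) <= d, since 2 pi < 8. Both ends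
   count, so there are D.+1 > (2 K + 1) d / 8 of them for every K, however small. *)
pose D := Num.truncn ((K.*2.+1)%:R * d / 8 : R).
have /andP[D1 D2] : (D%:R : R) <= (K.*2.+1)%:R * d / 8 < D.+1%:R.
  by apply: truncn_itv; rewrite !mulr_ge0.
have leDK : (K + D.+1 <= K.*2.+1)%N.
  suff : D%:R < K.+1%:R :> R by rewrite ltr_nat ltnS => h; rewrite addnS ltnS -addnn leq_add2l.
  have hM : (K.*2.+1)%:R = 2 * K%:R + 1 :> R by rewrite -addn1 natrD -mul2n natrM.
  have : (K.*2.+1)%:R * d <= (K.*2.+1)%:R * 1 by rewrite ler_wpM2l // ltW.
  have K0 : 0 <= K%:R :> R by [].
  rewrite -[K.+1%:R]natr1; rewrite hM in D1 *; lra.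
rewrite -(big_mkord xpredT chi) (big_cat_nat (leq0n K) _) /=; last by rewrite (leq_trans _ leDK) // leq_addr.
rewrite [X in _ + X](big_cat_nat (leq_addr D.+1 K) leDK) /=.
have pos k l : 0 <= \sum_(k <= i < l) chi i.
  by apply: sumr_ge0 => i _; rewrite /chi; case: ifP.
have e : \sum_(K <= i < K + D.+1) chi i = b * D.+1%:R.
  rewrite (eq_big_nat _ _ (F2 := fun=> b)); first by rewrite sumr_const_nat addKn mulr_natr.
  move=> i /andP[Ki iK]; rewrite /chi ifT //.
  rewrite /circle_pt -natrB //.
  have hn : 0 <= pi *+ 2 * (i - K)%:R :> R.
    by apply: mulr_ge0 => //; apply: mulrn_wge0; exact: ltW.
  rewrite ger0_norm ?divr_ge0 ?(ltW Mr) // ler_pdivrMr //.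
  apply: (@le_trans _ _ (8 * D%:R)); last by rewrite mulrC; lra.
  apply: ler_pM => //; first by apply: mulrn_wge0; exact: ltW.
    by rewrite mulr2n; move: p4; move: (pi : R) => p p4; lra.
  by rewrite ler_nat leq_subLR -ltnS -addnS.
have h3 : b * (d / 8) * (K.*2.+1)%:R <= b * D.+1%:R.
  by rewrite -mulrA ler_wpM2l // (le_trans _ (ltW D2)) // le_eqVlt; apply/orP; left; apply/eqP; ring.
have := pos 0%N K; have := pos (K + D.+1)%N K.*2.+1; rewrite e; move: h3; clear.
move: (b * _) (\sum_(_ <= _ < _) _) => x y; lra.
Qed.
End coef_bounds.

(** * Modulus and phase of the Euler product on the circle *)

Section kernel.
Local Open Scope complex_scope.
Variables (R : realType) (v : R) (n m : nat).
Notation t := (v ^+ 5).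
Notation q := (expR (- t)).
Notation CB := (4 * 10 ^+ 5 : R).
Hypothesis v01 : 0 < v <= 1 / 2.
(* CB is the constant of lambert_sum_le. *)
Hypothesis v_small : (CB + 20) * v <= 1.
Hypothesis ht : n%:R = pi ^+ 2 / 6 / t ^+ 2.
Hypothesis hmn : (n <= m)%N.
Hypothesis hm : 4 / t ^+ 3 <= m%:R.
Hypothesis exp_small : 128 * expR (- (1 / (320 * v))) <= v ^+ 16.

Let v0 : 0 < v. Proof. by case/andP: v01. Qed.
Let v1 : v <= 1 / 2. Proof. by case/andP: v01. Qed.

Lemma vX_gt0 k : 0 < v ^+ k. Proof. exact: exprn_gt0. Qed.

Lemma vX_le k l : (k <= l)%N -> v ^+ l <= v ^+ k.
Proof. by move=> kl; apply: ler_wiXn2l => //; [exact: ltW|have := v1; lra]. Qed.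

Lemma v5_bound : 0 < t <= 1 / 2.
Proof.
rewrite vX_gt0 /=; apply: le_trans v1; rewrite -[leRHS]expr1; exact: vX_le.
Qed.

(** [kernel_mod], [kernel_arg] and [euler_real] are rho, phi and P(q) of the overview, for the
    product cut at m. *)
Definition kernel_mod (a : R) : R := \prod_(1 <= i < m.+1) factor_mod (q ^+ i) (i%:R * a).
Definition kernel_arg (a : R) : R :=
  \sum_(1 <= i < m.+1) factor_arg (q ^+ i) (i%:R * a) - n%:R * a.
Definition euler_real : R := \prod_(1 <= i < m.+1) (1 - q ^+ i)^-1.

Lemma expRN_exp_bound i : (0 < i)%N -> 0 <= q ^+ i < 1.
Proof. by move=> i0; rewrite exprn_ge0 ?expR_ge0 //= (expRN_exp_lt1 v5_bound). Qed.

Lemma expr_mul_cis i a : (q%:C * cis a) ^+ i = (q ^+ i)%:C * cis (i%:R * a).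
Proof. by rewrite exprMn cisX -[a *+ i]mulr_natl rmorphXn. Qed.

Lemma euler_real_gt0 : 0 < euler_real.
Proof.
rewrite /euler_real big_nat; apply: prodr_gt0 => i /andP[i0 _].
by rewrite invr_gt0 subr_gt0; case/andP: (expRN_exp_bound i0).
Qed.

Lemma cis_sum (I : Type) (s : seq I) (P : pred I) (F : I -> R) :
  cis (\sum_(i <- s | P i) F i) = \prod_(i <- s | P i) cis (F i).
Proof. by apply: (big_morph (@cis R)) => [x y|]; rewrite ?cisD ?cis0. Qed.

Lemma euler_inv_polar a : euler_inv m (q%:C * cis a) * cis (- (n%:R * a)) =
  (euler_real * kernel_mod a)%:C * cis (kernel_arg a).
Proof.
rewrite /kernel_arg cisD mulrA; congr (_ * _).
rewrite cis_sum /kernel_mod /euler_real -big_split /= rmorph_prod -big_split /=.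
rewrite /euler_inv; apply: eq_big_nat => i /andP[i0 _].
rewrite expr_mul_cis inv_1sub_polar ?expRN_exp_bound //; congr (_%:C * _).
have d : 1 - q ^+ i != 0 by rewrite subr_eq0 gt_eqF //; case/andP: (expRN_exp_bound i0).
by rewrite /factor_mod mulKf.
Qed.

Lemma kernel_mod_ge0 a : 0 <= kernel_mod a.
Proof.
rewrite /kernel_mod big_nat; apply: prodr_ge0 => i /andP[i0 _].
exact/factor_mod_ge0/expRN_exp_bound.
Qed.

(** The saddle point property of t: both quantities are of order t^-2, their difference only of
    order 1 / t, so the phase has almost no linear term. *)
Lemma lambert1_near : `|lambert_sum t 1 m - n%:R| <= 20 / t.
Proof.
have h1 := lambert_sum1_le v5_bound m; have h2 := lambert_sum1_ge v5_bound (succ_mul_expRN_le v5_bound hm).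
rewrite -ht in h1 h2; rewrite ler_norml.
have c1 : 0 <= 153^-1 / t.
  by apply: divr_ge0; [rewrite invr_ge0; exact: ler0n|exact: ltW (vX_gt0 5)].
have c2 : 0 <= 20 / t by rewrite divr_ge0 // ltW // vX_gt0.
have aux (L N x y : R) : L <= N - x -> N - y <= L -> 0 <= x -> 0 <= y -> - y <= L - N <= y.
  by move=> *; apply/andP; split; lra.
exact: aux h1 h2 c1 c2.
Qed.

(** The cubic errors of [factor_arg_near] add up to |a|^3 * CB / t^4 <= CB * v, and the linear
    coefficient of [lambert1_near] contributes 20 * v ^+ 2. *)
Lemma kernel_arg_le a : `|a| <= v ^+ 7 -> `|kernel_arg a| <= (CB + 20) * v.
Proof.
move=> ha.
have a0 : 0 <= `|a| by [].
pose S := \sum_(1 <= i < m.+1) (factor_arg (q ^+ i) (i%:R * a) - (i%:R * a) * (q ^+ i / (1 - q ^+ i))).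
have -> : kernel_arg a = S + a * (lambert_sum t 1 m - n%:R).
  rewrite /S sumrB /kernel_arg /lambert_sum mulrBr mulr_sumr.
  have -> : \sum_(1 <= i < m.+1) i%:R * a * (q ^+ i / (1 - q ^+ i)) =
     \sum_(1 <= i < m.+1) a * (i%:R ^+ 1 * (q ^+ i / (1 - q ^+ i) ^+ 1)).
    by apply: eq_bigr => i _; rewrite !expr1; ring.
  ring.
apply: le_trans (ler_normD _ _) _; rewrite mulrDl; apply: lerD.
  apply: (@le_trans _ _ (`|a| ^+ 3 * lambert_sum t 3 m)).
    apply: le_trans (ler_norm_sum _ _ _) _; rewrite /lambert_sum mulr_sumr !big_nat.
    apply: ler_sum => i /andP[i0 _]; apply: le_trans (factor_arg_near _ (expRN_exp_bound i0)) _.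
    rewrite normrM exprMn normr_nat le_eqVlt; apply/orP; left; apply/eqP; ring.
  apply: (@le_trans _ _ ((v ^+ 7) ^+ 3 * (CB / t ^+ 4))).
    apply: ler_pM; rewrite ?exprn_ge0 ?(lambert_sum_ge0 v5_bound) //.
      by rewrite lerXn2r ?nnegrE // ltW // vX_gt0.
    exact: (lambert_sum_le v5_bound).
  rewrite le_eqVlt; apply/orP; left; apply/eqP; field; exact: lt0r_neq0.
rewrite normrM; apply: (@le_trans _ _ (v ^+ 7 * (20 / t))).
  by apply: ler_pM => //; exact: lambert1_near.
have -> : v ^+ 7 * (20 / t) = 20 * (v ^+ 2) by field; exact: lt0r_neq0.
by rewrite ler_pM2l // -[leRHS]expr1; apply: vX_le.
Qed.

Lemma cos_kernel_arg a : `|a| <= v ^+ 7 -> 1 / 2 <= cos (kernel_arg a).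
Proof.
move=> ha; apply: le_trans (cos_ge_quad _).
have h := le_trans (kernel_arg_le ha) v_small.
have : kernel_arg a ^+ 2 <= 1 by rewrite -(real_normK (num_real _)) exprn_ile1.
lra.
Qed.

(** The radius is v ^+ 8 and not v ^+ 7 because the decay exponent, of order a^2 / t^3, must stay
    bounded; here it is at most CB * v / 2. *)
Lemma kernel_mod_near a : `|a| <= v ^+ 8 -> 1 / 2 <= kernel_mod a.
Proof.
move=> ha.
have T2 := lambert_sum_le v5_bound m (isT : (2 <= 5)%N).
apply: (@le_trans _ _ (expR (- (a ^+ 2 / 2 * lambert_sum t 2 m)))).
  have a2 : a ^+ 2 <= (v ^+ 8) ^+ 2.
    by rewrite -(real_normK (num_real a)) lerXn2r ?nnegrE // ltW // vX_gt0.
  have : a ^+ 2 / 2 * lambert_sum t 2 m <= (v ^+ 8) ^+ 2 / 2 * (CB / t ^+ 3).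
    apply: ler_pM => //; rewrite ?divr_ge0 ?sqr_ge0 ?(lambert_sum_ge0 v5_bound) //.
    by rewrite ler_pM2r.
  have -> : (v ^+ 8) ^+ 2 / 2 * (CB / t ^+ 3) = CB * v / 2 by field; exact: lt0r_neq0.
  have := expR_ge1Dx (- (a ^+ 2 / 2 * lambert_sum t 2 m)).
  move: v_small v0; rewrite mulrDl; move: (CB * v) (a ^+ 2 / 2 * _) (expR _) => x y z; lra.
rewrite /lambert_sum mulr_sumr -sumrN expR_sum /kernel_mod !big_nat.
apply: ler_prod => i /andP[i0 _]; rewrite expR_ge0 /=.
apply: le_trans (factor_mod_ge _ (expRN_exp_bound i0)); rewrite ler_expR lerN2.
by rewrite exprMn le_eqVlt; apply/orP; left; apply/eqP; ring.
Qed.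

(** The full geometric series give 1 / (1 - q) - Re 1 / (1 - z), which is the defect; the two tails
    beyond m are at most 1 each. *)
Lemma sum_qX_onesubcos a : Re_defect q a - 2 <=
  \sum_(1 <= i < m.+1) q ^+ i * (1 - cos (i%:R * a)).
Proof.
have q01 := expRN_bound v5_bound; have qp : 0 < 1 - q by rewrite subr_gt0; case/andP: q01.
have q0 : 0 <= q by exact: expR_ge0.
set z := q%:C * cis a.
have zq : normc z = q by rewrite normcM normc_cis mulr1 normcR ger0_norm.
have z1 : 1 - z != 0 by have := one_subX_neq0 q01 (ltn0Sn 0) zq; rewrite expr1.
have geo (F : fieldType) (x : F) : 1 - x != 0 ->
    \sum_(1 <= i < m.+1) x ^+ i = (1 - x)^-1 - 1 - x ^+ m.+1 * (1 - x)^-1.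
  move=> x1; elim: (m) => [|k IH]; first by rewrite big_geq // expr1; field.
  by rewrite big_nat_recr //= IH !exprS; field.
have -> : \sum_(1 <= i < m.+1) q ^+ i * (1 - cos (i%:R * a)) =
   Re (\sum_(1 <= i < m.+1) (q ^+ i)%:C - \sum_(1 <= i < m.+1) z ^+ i).
  rewrite -sumrB Re_sum; apply: eq_bigr => i _; rewrite expr_mul_cis ReB ReZ /=; ring.
rewrite -rmorph_sum /= (geo _ _ (lt0r_neq0 qp)) (geo _ _ z1) !ReB.
have re1 : Re (1 : R[i]) = 1 by [].
rewrite re1 Re_inv_1sub //.
have hz : `|Re (z ^+ m.+1 * (1 - z)^-1)| <= q ^+ m.+1 * (1 - q)^-1.
  apply: le_trans (ler_normc_Re _) _; rewrite normcM normc_exp zq ler_wpM2l ?exprn_ge0 //.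
  by have := normc_inv_1sub_le q01 (ltn0Sn 0) zq; rewrite !expr1.
have hq : q ^+ m.+1 * (1 - q)^-1 <= 1.
  have ts := succ_mul_expRN_le v5_bound hm; have [tp tl] := andP v5_bound.
  have : (1 - q)^-1 <= 1 + t^-1 := inv_1sub_expRN_le tp.
  have h1 : q ^+ m.+1 <= q ^+ m * (1 / 1) by rewrite exprSr ler_wpM2l ?exprn_ge0 ?divr1 // ltW // -subr_gt0.
  have h2 : q ^+ m * 2 <= m.+1%:R * q ^+ m.
    rewrite mulrC ler_wpM2r ?exprn_ge0 // ler_nat ltnS lt0n.
    apply/eqP => m0; move: hm; rewrite m0 leNgt divr_gt0 //; exact: exprn_gt0.
  move=> h3; apply: (@le_trans _ _ (t / 2 * (1 + t^-1))).
    apply: ler_pM; rewrite ?exprn_ge0 ?invr_ge0 ?(ltW qp) //.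
    by move: h1 h2 ts; rewrite divr1 mulr1; move: (q ^+ m.+1) (q ^+ m) (t) => x y z'; lra.
  have -> : t / 2 * (1 + t^-1) = t / 2 + 1 / 2 by field; exact: lt0r_neq0.
  move: tl; move: (t) => s; lra.
move: hz; rewrite ler_norml => /andP[hz _].
have aux (D d X Y : R) : - X <= Y -> X <= 1 -> D - 2 <= d - 1 - X - (d - D - 1 - Y).
  by move=> *; lra.
exact: aux hz hq.
Qed.

(** At the cutoff, q * (1 - cos a) is at least w = v^14 / 36, and Z / (s + 2 Z) increases with Z,
    which gives v^4 / 40; the remaining factor (1 + q) / (1 - q) is at least 1 / t = v^-5. *)
Lemma Re_defect_far a : v ^+ 7 <= `|a| -> `|a| <= pi -> 1 / (40 * v) <= Re_defect q a.
Proof.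
move=> ha hpi; have q01 := expRN_bound v5_bound.
have qp : 0 < 1 - q by rewrite subr_gt0; case/andP: q01.
have [tp tl] := andP v5_bound.
have qt : 1 - q <= t by have := expR_ge1Dx (- t); lra.
have q2 : 1 / 2 <= q by lra.
set c := 1 - cos a; have hc : a ^+ 2 / 18 <= c.
  by apply: one_sub_cos_ge; apply: le_trans hpi (ltW (pi_lt4 R)).
have a2 : (v ^+ 7) ^+ 2 <= a ^+ 2.
  by rewrite -(real_normK (num_real a)) lerXn2r ?nnegrE // ltW // vX_gt0.
pose w := (v ^+ 7) ^+ 2 / 36.
have w0 : 0 < w by rewrite divr_gt0 // exprn_gt0 // vX_gt0.
have c0 : 0 < c by apply: lt_le_trans hc; apply: (lt_le_trans _ (ler_wpM2r _ a2)); rewrite ?invr_ge0 // divr_gt0 // exprn_gt0 // vX_gt0.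
have wqc : w <= q * c.
  have h : (v ^+ 7) ^+ 2 / 18 <= c by apply: le_trans hc; rewrite ler_pM2r.
  have : 1 / 2 * ((v ^+ 7) ^+ 2 / 18) <= q * c by apply: ler_pM => //; rewrite divr_ge0 // exprn_ge0 // ltW // vX_gt0.
  by rewrite (_ : 1 / 2 * _ = w) // /w; field.
have qc0 : 0 < q * c := lt_le_trans w0 wqc.
rewrite /Re_defect -/c /dist2 -/c.
have d1 : 0 < (1 - q) ^+ 2 + 2 * q * c by rewrite ltr_wpDl ?sqr_ge0 // -mulrA mulr_gt0.
have d2 : 0 < t ^+ 2 + 2 * w by rewrite addr_gt0 ?exprn_gt0 // mulr_gt0.
have h1 : w / (t ^+ 2 + 2 * w) <= q * c / ((1 - q) ^+ 2 + 2 * q * c).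
  rewrite ler_pdivrMr // mulrAC ler_pdivlMr //.
  have s2 : (1 - q) ^+ 2 <= t ^+ 2 by rewrite lerXn2r ?nnegrE ?(ltW qp) // ltW.
  have : w * (1 - q) ^+ 2 <= q * c * t ^+ 2 by apply: ler_pM => //; rewrite ?(ltW w0) ?sqr_ge0.
  have aux (W Z s T : R) : W * s <= Z * T -> W * (s + 2 * Z) <= Z * (T + 2 * W).
    by move=> *; lra.
  by rewrite -[2 * q * c]mulrA; apply: aux.
have h2 : v ^+ 4 / 40 <= w / (t ^+ 2 + 2 * w).
  rewrite ler_pdivlMr //.
  have -> : t ^+ 2 + 2 * w = v ^+ 10 * (1 + v ^+ 4 / 18) by rewrite /w; field.
  have -> : w = v ^+ 4 / 40 * (v ^+ 10 * (40 / 36)) by rewrite /w; field.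
  rewrite ler_wpM2l ?divr_ge0 ?(ltW (vX_gt0 4)) // ler_wpM2l ?(ltW (vX_gt0 10)) //.
  have : v ^+ 4 <= v ^+ 1 by exact: vX_le.
  by rewrite expr1; have := v1; lra.
have h3 : 1 / t <= (1 + q) / (1 - q).
  rewrite ler_pdivlMr // mulrC mulrA ler_pdivrMr // mulr1.
  have : 0 <= q * t by rewrite mulr_ge0 ?expR_ge0 // ltW.
  lra.
have -> : q * c * (1 + q) / ((1 - q) * ((1 - q) ^+ 2 + 2 * q * c)) =
   ((1 + q) / (1 - q)) * (q * c / ((1 - q) ^+ 2 + 2 * q * c)).
  by field; rewrite (lt0r_neq0 d1) (lt0r_neq0 qp).
have -> : 1 / (40 * v) = 1 / t * (v ^+ 4 / 40) by field; exact: lt0r_neq0.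
apply: ler_pM => //; last exact: le_trans h1.
- by rewrite divr_ge0 // ltW.
- by rewrite divr_ge0 // ltW // vX_gt0.
Qed.

End kernel.

(** * From a bound on a multiplier to a bound on coefficients *)

Section transfer.
Local Open Scope complex_scope.
Variables (R : realType) (v : R) (n m : nat).
Notation t := (v ^+ 5).
Notation q := (expR (- t)).
Notation CB := (4 * 10 ^+ 5 : R).
Hypothesis v01 : 0 < v <= 1 / 2.
Hypothesis v_small : (CB + 20) * v <= 1.
Hypothesis ht : n%:R = pi ^+ 2 / 6 / t ^+ 2.
Hypothesis hmn : (n <= m)%N.
Hypothesis hm : 4 / t ^+ 3 <= m%:R.
Hypothesis exp_small : 128 * expR (- (1 / (320 * v))) <= v ^+ 16.

Let v0 : 0 < v. Proof. by case/andP: v01. Qed.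
Let v1 : v <= 1 / 2. Proof. by case/andP: v01. Qed.

Notation rho := (kernel_mod v m).
Notation phi := (kernel_arg v n m).
Notation er := (euler_real v m).
Notation E0 := (2 * expR (- (1 / (320 * v)))).

Lemma kernel_mod_far a : v ^+ 7 <= `|a| -> `|a| <= pi -> rho a <= E0.
Proof.
move=> h1 h2.
have hS : 1 / (40 * v) - 2 <= \sum_(1 <= i < m.+1) q ^+ i * (1 - cos (i%:R * a)).
  apply: le_trans (sum_qX_onesubcos v01 hm a); rewrite lerD2r.
  exact: Re_defect_far.
apply: (@le_trans _ _ (expR (- ((\sum_(1 <= i < m.+1) q ^+ i * (1 - cos (i%:R * a))) / 8)))).
  rewrite mulr_suml -sumrN expR_sum /kernel_mod !big_nat.
  apply: ler_prod => i /andP[i0 _].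
  by rewrite factor_mod_ge0 ?expRN_exp_bound //= factor_mod_le // expRN_exp_bound.
(* Dividing 1 / (40 * v) - 2 by 8 produces the exponent of [E0] and a stray factor e^(1/4), which
   the 2 of [E0] absorbs. *)
apply: (@le_trans _ _ (expR (1 / 4) * expR (- (1 / (320 * v))))).
  rewrite -expRD ler_expR.
  have -> : 1 / (320 * v) = 1 / (40 * v) / 8 by field; exact: lt0r_neq0.
  move: hS; move: (\sum_(_ <= _ < _) _) (1 / (40 * v)) => x y; lra.
rewrite ler_wpM2r ?expR_ge0 //.
have := expR_ge1Dx (- (1 / 4) : R); have := expRxMexpNx_1 (1 / 4 : R).
by have := expR_gt0 (1 / 4 : R); nra.
Qed.

Lemma E0_ge0 : 0 <= E0. Proof. exact: mulr_ge0 (ler0n _ 2) (expR_ge0 _). Qed.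

Notation p := ((npart_ge 1 n)%:R : R).

Lemma coef_part_poly_npart : exists J1, forall J, (J1 <= J)%N -> (part_poly R[i] J 1 m)`_n = p%:C.
Proof. by exists n.+1 => J lt; rewrite coef_part_poly // rmorph_nat. Qed.

Lemma expRN_v5_bound : 0 <= q < 1. Proof. exact: expRN_bound (v5_bound v01). Qed.

Lemma normc_circle a : normc (q%:C * cis a) = q.
Proof. by rewrite normcM normc_cis mulr1 normcR ger0_norm // expR_ge0. Qed.

(** A bound polynomial in v is enough, since the far arc is exponentially small. On |a| <= v ^+ 8
    both rho and cos phi are at least 1 / 2, and these samples form a proportion of at least v ^+ 8
    / 8. *)
Lemma npart_lower : er * (v ^+ 8 / 64) <= p * q ^+ n.
Proof.
have er0 := euler_real_gt0 m v01.
apply: (@le_trans _ _ (er / 4 * (v ^+ 8 / 8) - er * E0)).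
  rewrite (_ : er / 4 * (v ^+ 8 / 8) - er * E0 = er * (v ^+ 8 / 32 - E0)); last by field.
  rewrite ler_pM2l //.
  have : v ^+ 16 <= v ^+ 8 by exact: vX_le.
  move: exp_small; move: (expR _) (v ^+ 16) (v ^+ 8) => x y z; lra.
apply: (coef_ge_circle_avg _ (unif_lim_part m expRN_v5_bound) coef_part_poly_npart); first exact: expR_gt0.
move=> K; apply: circle_avg_ge_near.
- by rewrite divr_ge0 // ltW.
- rewrite ltW ?vX_gt0 //=; apply: (@le_trans _ _ (v ^+ 0)); [exact: vX_le|by rewrite expr0].
- move=> a api; rewrite (euler_inv_polar n m v01) ReZ /=.
  have r0 := kernel_mod_ge0 m v01 a.
  rewrite -mulrA -mulrN ler_pM2l //.
  have [near|far] := leP `|a| (v ^+ 7).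
    apply: (@le_trans _ _ 0); first by rewrite oppr_le0 E0_ge0.
    apply: mulr_ge0 => //; apply: le_trans (cos_kernel_arg v01 v_small ht hm near).
    by rewrite divr_ge0.
  apply: (@le_trans _ _ (- rho a)); first by rewrite lerN2 kernel_mod_far // ltW.
  by rewrite -mulrN1 ler_wpM2l // cos_geN1.
- move=> a av; rewrite (euler_inv_polar n m v01) ReZ /=.
  have near : `|a| <= v ^+ 7 by apply: le_trans av _; exact: vX_le.
  apply: (@le_trans _ _ (er / 4)); first by rewrite gerBl mulr_ge0 ?E0_ge0 // ltW.
  rewrite -mulrA ler_pM2l //.
  have -> : 4^-1 = 1 / 2 * (1 / 2) :> R by field.
  apply: ler_pM; rewrite ?divr_ge0 //; first exact: kernel_mod_near.
  exact: cos_kernel_arg.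
Qed.

(** The term in v ^+ 8 comes from the far arc: [npart_lower] and [exp_small] bound [er * E0] by v ^+
    8 * p * q ^+ n. The first 2 * kap is the price of the shift made below. *)
Lemma coef_transfer Q h (w kap B : R) : 0 <= kap -> 0 <= B ->
  unif_lim q Q (fun z => euler_inv m z * h z) ->
  (exists J1, forall J, (J1 <= J)%N -> (Q J)`_n = w%:C) ->
  (forall a, `|a| <= v ^+ 7 -> - kap <= Re (cis (phi a) * h (q%:C * cis a))) ->
  (forall a, normc (h (q%:C * cis a)) <= B) ->
  - ((2 * kap + (2 * kap + B) * v ^+ 8) * p) <= w.
Proof.
move=> k0 B0 lim [J1 HJ1] near bnd.
have er0 := euler_real_gt0 m v01.
(* Adding 2 kap p makes the sampled function nonnegative where |a| <= v^7,
   since there cos (phi a) >= 1 / 2. *)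
pose Q' J := Q J + (2 * kap)%:C%:P * part_poly R[i] J 1 m.
have lim' : unif_lim q Q' (fun z => euler_inv m z * h z + ((2 * kap)%:C%:P).[z] * euler_inv m z).
  exact: unif_limD lim (unif_limM (unif_lim_poly _ _) (unif_lim_part m expRN_v5_bound)).
have cf' : exists J1, forall J, (J1 <= J)%N -> (Q' J)`_n = (w + 2 * kap * p)%:C.
  have [J2 HJ2] := coef_part_poly_npart; exists (maxn J1 J2) => J; rewrite geq_max => /andP[le1 le2].
  by rewrite coefD coefCM HJ1 // HJ2 // rmorphD [in RHS]rmorphM.
have key : - (er * ((2 * kap + B) * E0)) <= (w + 2 * kap * p) * q ^+ n.
  apply: (coef_ge_circle_avg _ lim' cf'); first exact: expR_gt0.
  move=> K; apply: circle_avg_ge => a api.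
  rewrite hornerC.
  set z := q%:C * cis a.
  have -> : (euler_inv m z * h z + (2 * kap)%:C * euler_inv m z) * cis (- (n%:R * a)) =
    (h z + (2 * kap)%:C) * (euler_inv m z * cis (- (n%:R * a))) by ring.
  rewrite (euler_inv_polar n m v01) [X in Re X]mulrCA ReZ -mulrA -mulrN ler_pM2l //.
  have r0 := kernel_mod_ge0 m v01 a.
  have -> : Re ((h z + (2 * kap)%:C) * cis (phi a)) =
      Re (cis (phi a) * h z) + 2 * kap * cos (phi a).
    by rewrite mulrDl ReD ReZ /= [h z * _]mulrC.
  have [nr|far] := leP `|a| (v ^+ 7).
    apply: (@le_trans _ _ 0); first by rewrite oppr_le0 mulr_ge0 ?E0_ge0 // addr_ge0 // mulr_ge0.
    apply: mulr_ge0 => //; have := near _ nr; have c := cos_kernel_arg v01 v_small ht hm nr.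
    have : 2 * kap * (1 / 2) <= 2 * kap * cos (phi a) by rewrite ler_wpM2l // mulr_ge0.
    rewrite -/z; move: (Re _) (cos _) => x y; lra.
  have rE := kernel_mod_far (ltW far) api.
  have h1 : - (2 * kap + B) <= Re (cis (phi a) * h z) + 2 * kap * cos (phi a).
    have : `|Re (cis (phi a) * h z)| <= B.
      by apply: le_trans (ler_normc_Re _) _; rewrite normcM normc_cis mul1r; apply: bnd.
    rewrite ler_norml => /andP[h2 _].
    have : 2 * kap * (- 1) <= 2 * kap * cos (phi a).
      by rewrite ler_wpM2l ?cos_geN1 // mulr_ge0.
    move: h2; move: (Re _) (cos _) => x y; lra.
  apply: (@le_trans _ _ (rho a * - (2 * kap + B))); last by rewrite ler_wpM2l.
  by rewrite mulrN lerN2 mulrC ler_wpM2l // addr_ge0 // mulr_ge0.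
have low := npart_lower.
have qn : 0 < q ^+ n by rewrite exprn_gt0 // expR_gt0.
have h3 : er * E0 <= p * q ^+ n * v ^+ 8.
  have : er * (v ^+ 8 / 64) * v ^+ 8 <= p * q ^+ n * v ^+ 8.
    by rewrite ler_pM2r ?vX_gt0.
  apply: le_trans; rewrite -mulrA ler_pM2l //.
  have -> : v ^+ 8 / 64 * v ^+ 8 = v ^+ 16 / 64 by field.
  move: exp_small; move: (expR _) (v ^+ 16) => x y; lra.
have kB : 0 <= 2 * kap + B by rewrite addr_ge0 // mulr_ge0.
have h4 : - ((2 * kap + B) * (p * v ^+ 8)) <= w + 2 * kap * p.
  rewrite -(ler_pM2r qn); apply: le_trans key; rewrite mulNr lerN2.
  have := ler_wpM2l kB h3; rewrite [_ * (er * _)]mulrCA => h5; apply: le_trans h5 _.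
  by rewrite le_eqVlt; apply/orP; left; apply/eqP; ring.
rewrite mulrDl opprD; move: h4; rewrite mulrA mulrAC; move: (_ * v ^+ 8 * p) (2 * kap * p) => x y; lra.
Qed.

End transfer.

(** * The multiplier *)

Section multiplier.
Local Open Scope complex_scope.
Variables (R : realType) (v : R) (m : nat).
Notation t := (v ^+ 5).
Notation q := (expR (- t)).
Notation CB := (4 * 10 ^+ 5 : R).
Hypothesis v01 : 0 < v <= 1 / 2.
Hypothesis hm : 4 / t ^+ 3 <= m%:R.

Let v0 : 0 < v. Proof. by case/andP: v01. Qed.
Let v1 : v <= 1 / 2. Proof. by case/andP: v01. Qed.
Let vn0 : v != 0. Proof. by rewrite gt_eqF. Qed.
Let tp : 0 < t. Proof. exact: exprn_gt0. Qed.
Let tl : t <= 1 / 2. Proof. by case/andP: (v5_bound v01). Qed.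
Let q01 : 0 <= q < 1. Proof. exact: expRN_v5_bound. Qed.
Let qp : 0 < 1 - q. Proof. by rewrite subr_gt0; case/andP: q01. Qed.
Let q0 : 0 <= q. Proof. exact: expR_ge0. Qed.
Let CB0 : 0 < CB. Proof. by rewrite mulr_gt0 // exprn_gt0. Qed.

(* Chosen so that multiplier has no linear term in a at a = 0; see slopeM. *)
Definition slope : R := q / (1 - q) ^+ 2 / lambert_sum t 2 m.

Lemma cutoff_ge : 4 / t <= m%:R.
Proof.
apply: le_trans hm; rewrite ler_pM2l // lef_pV2 ?posrE ?exprn_gt0 //.
rewrite -[leRHS]expr1; apply: ler_wiXn2l => //; first exact: ltW.
by apply: le_trans tl _; lra.
Qed.

Lemma lambert2_gt0 : 0 < lambert_sum t 2 m.
Proof.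
apply: lt_le_trans (lambert_sum2_ge (v5_bound v01) cutoff_ge); apply: divr_gt0.
  by rewrite invr_gt0 ltr0n.
exact: exprn_gt0.
Qed.

Lemma slope_num_le : q / (1 - q) ^+ 2 <= (t ^+ 2)^-1.
Proof. exact: inv_sinh2_le. Qed.

Lemma slope_num_ge : (t ^+ 2)^-1 / 2 <= q / (1 - q) ^+ 2.
Proof.
apply: le_trans (inv_sinh2_ge tp).
have : 1 <= (t ^+ 2)^-1.
  by rewrite invf_ge1 ?exprn_gt0 // exprn_ile1 ?(ltW tp) //; apply: le_trans tl _; lra.
move: (_^-1) => x; lra.
Qed.

(** The slope has the order of t: its numerator is of order t^-2, and [lambert_sum t 2 m] of order
    t^-3 by [lambert_sum2_ge]. The matching lower bound is [slope_ge]. *)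
Lemma slope_le : slope <= 256 * t.
Proof.
have := lambert_sum2_ge (v5_bound v01) cutoff_ge => h.
rewrite /slope ler_pdivrMr ?lambert2_gt0 //; apply: le_trans slope_num_le _.
apply: (@le_trans _ _ (256 * t * (256^-1 / t ^+ 3))); last first.
  by apply: ler_wpM2l h; exact: mulr_ge0 (ler0n _ _) (ltW tp).
by rewrite le_eqVlt; apply/orP; left; apply/eqP; move: tp; move: t => s s0; field; exact: lt0r_neq0.
Qed.

Lemma slope_ge : t / (2 * CB) <= slope.
Proof.
have := lambert_sum_le (v5_bound v01) m (isT : (2 <= 5)%N) => h.
rewrite /slope ler_pdivlMr ?lambert2_gt0 //; apply: le_trans slope_num_ge.
apply: (@le_trans _ _ (t / (2 * CB) * (CB / t ^+ 3))).
  by apply: ler_wpM2l => //; rewrite divr_ge0 // ltW // mulr_gt0.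
rewrite le_eqVlt; apply/orP; left; apply/eqP; move: tp CB0; move: t CB => s c s0 c0.
by field; rewrite !lt0r_neq0.
Qed.

Lemma slope_ge0 : 0 <= slope.
Proof. by apply: le_trans slope_ge; rewrite divr_ge0 // ltW // mulr_gt0. Qed.

Lemma slopeM : slope * lambert_sum t 2 m = q / (1 - q) ^+ 2.
Proof. by rewrite /slope divfK // lt0r_neq0 // lambert2_gt0. Qed.

(** The function h of the overview; [multiplier_const] is its value at z = q. *)
Definition multiplier z : R[i] := (1 - z)^-1 - (1 / 2)%:C - slope%:C * lambert m z.
Definition multiplier_const : R := (1 - q)^-1 - 1 / 2 - slope * lambert_sum t 1 m.

Lemma lambert_circle a : lambert m (q%:C * cis a) =
  \sum_(1 <= i < m.+1) i%:R%:C * ((1 - (q ^+ i)%:C * cis (i%:R * a))^-1 - 1).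
Proof.
rewrite /lambert; apply: eq_big_nat => i /andP[i0 _].
rewrite rmorph_nat; congr (_ * _).
have := one_subX_neq0 q01 i0 (normc_circle v a); rewrite expr_mul_cis; set w := _ * cis _.
by move=> w1; field.
Qed.

Lemma Re_multiplier a : Re (multiplier (q%:C * cis a)) - multiplier_const =
  slope * (\sum_(1 <= i < m.+1) i%:R * Re_defect (q ^+ i) (i%:R * a)) - Re_defect q a.
Proof.
rewrite /multiplier !ReB ReZ lambert_circle Re_sum Re_inv_1sub //.
have -> : \sum_(1 <= i < m.+1) Re (i%:R%:C * ((1 - (q ^+ i)%:C * cis (i%:R * a))^-1 - 1)) =
  lambert_sum t 1 m - \sum_(1 <= i < m.+1) i%:R * Re_defect (q ^+ i) (i%:R * a).
  rewrite /lambert_sum -sumrB; apply: eq_big_nat => i /andP[i0 _].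
  have qi := expRN_exp_bound v01 i0; have d : 1 - q ^+ i != 0 by rewrite subr_eq0 gt_eqF //; case/andP: qi.
  by rewrite ReZ ReB Re_inv_1sub //= !expr1; field.
by rewrite /multiplier_const /=; ring.
Qed.

Lemma Im_multiplier a : Im (multiplier (q%:C * cis a)) =
  Im (1 - q%:C * cis a)^-1 -
  slope * \sum_(1 <= i < m.+1) i%:R * Im (1 - (q ^+ i)%:C * cis (i%:R * a))^-1.
Proof.
rewrite /multiplier !ImB ImZ lambert_circle /= subr0; congr (_ - _ * _).
have Im_sum (I : Type) (s : seq I) (P : pred I) (F : I -> R[i]) :
    Im (\sum_(i <- s | P i) F i) = \sum_(i <- s | P i) Im (F i).
  by apply: (big_morph (@complex.Im R)) => // -[x1 y1] [x2 y2].
by rewrite Im_sum; apply: eq_bigr => i _; rewrite ImZ ImB /= subr0.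
Qed.

(** Each term of the sum carries i coth(i t / 2) >= 2 / t, a bound independent of i, so [slopeM]
    evaluates the quadratic part. It cancels the main part of the subtracted term, where coth(t / 2)
    <= 2 / t + t. Errors of order a^2 / t and slope * a^4 / t^6 remain, both O(v). *)
Lemma Re_multiplier_ge a : `|a| <= v ^+ 7 -> - (10 ^+ 3 * CB * v) <= Re (multiplier (q%:C * cis a)) - multiplier_const.
Proof.
move=> ha; rewrite Re_multiplier.
have a2 : a ^+ 2 <= v ^+ 14.
  rewrite -(real_normK (num_real a)) (_ : v ^+ 14 = (v ^+ 7) ^+ 2); last by rewrite -exprM.
  by rewrite lerXn2r ?nnegrE // exprn_ge0 // ltW.
have a4 : a ^+ 4 <= v ^+ 28.
  rewrite (_ : a ^+ 4 = (a ^+ 2) ^+ 2); last by rewrite -exprM.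
  rewrite (_ : v ^+ 28 = (v ^+ 14) ^+ 2); last by rewrite -exprM.
  by rewrite lerXn2r ?nnegrE ?sqr_ge0 // exprn_ge0 // ltW.
have s0 := slope_ge0.
have h1 : a ^+ 2 / 2 * (2 / t) * lambert_sum t 2 m - 2 * a ^+ 4 * lambert_sum t 5 m <=
    \sum_(1 <= i < m.+1) i%:R * Re_defect (q ^+ i) (i%:R * a).
  rewrite /lambert_sum !mulr_sumr -sumrB !big_nat; apply: ler_sum => i /andP[i0 _].
  have qi := expRN_exp_bound v01 i0; have ir : 0 < i%:R :> R by rewrite ltr0n.
  have d : 0 < 1 - q ^+ i by rewrite subr_gt0; case/andP: qi.
  have hc : 2 / t <= i%:R * ((1 + q ^+ i) / (1 - q ^+ i)).
    have := coth_ge (mulr_gt0 ir tp); rewrite -expRN_exp => hc.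
    apply: le_trans (ler_wpM2l (ltW ir) hc); rewrite le_eqVlt; apply/orP; left.
    by apply/eqP; field; rewrite ?vn0 ?lt0r_neq0.
  apply: le_trans (ler_wpM2l (ltW ir) (Re_defect_ge _ qi)); rewrite mulrBr.
  apply: lerB.
    have -> : i%:R * ((i%:R * a) ^+ 2 / 2 * (q ^+ i * (1 + q ^+ i) / (1 - q ^+ i) ^+ 3)) =
      a ^+ 2 / 2 * (i%:R * ((1 + q ^+ i) / (1 - q ^+ i))) * (i%:R ^+ 2 * (q ^+ i / (1 - q ^+ i) ^+ 2)).
      by field; exact: lt0r_neq0.
    apply: ler_wpM2r; first by rewrite mulr_ge0 ?sqr_ge0 // divr_ge0 ?sqr_ge0 //; case/andP: qi.
    by apply: ler_wpM2l => //; rewrite divr_ge0 ?sqr_ge0.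
  rewrite le_eqVlt; apply/orP; left; apply/eqP; ring.
have h2 : Re_defect q a <= a ^+ 2 / 2 * (q / (1 - q) ^+ 2) * (2 / t + t).
  apply: le_trans (Re_defect_le _ q01) _.
  have -> : a ^+ 2 / 2 * (q * (1 + q) / (1 - q) ^+ 3) =
    a ^+ 2 / 2 * (q / (1 - q) ^+ 2) * ((1 + q) / (1 - q)) by field; exact: lt0r_neq0.
  apply: ler_wpM2l (coth_le tp).
  by apply: mulr_ge0; apply: divr_ge0; rewrite ?sqr_ge0 ?expR_ge0.
have h3 := ler_wpM2l s0 h1.
have h4 : slope * (a ^+ 2 / 2 * (2 / t) * lambert_sum t 2 m - 2 * a ^+ 4 * lambert_sum t 5 m) =
  a ^+ 2 / 2 * (q / (1 - q) ^+ 2) * (2 / t) - 2 * (slope * (a ^+ 4 * lambert_sum t 5 m)).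
  by rewrite -slopeM; ring.
have h5 : a ^+ 2 / 2 * (q / (1 - q) ^+ 2) * t <= v.
  apply: (@le_trans _ _ (v ^+ 14 / 2 * (t ^+ 2)^-1 * t)).
    rewrite ler_pM2r //; apply: ler_pM => //; rewrite ?divr_ge0 ?sqr_ge0 //.
      by rewrite ler_pM2r.
    exact: slope_num_le.
  have -> : v ^+ 14 / 2 * (t ^+ 2)^-1 * t = v ^+ 9 / 2 by field.
  have : v ^+ 9 <= v ^+ 1 by exact: vX_le.
  by rewrite expr1; have := v0; lra.
have h6 : slope * (a ^+ 4 * lambert_sum t 5 m) <= 256 * CB * v.
  apply: (@le_trans _ _ (256 * t * (v ^+ 28 * (CB / t ^+ 6)))).
    apply: ler_pM slope_le _ => //.
      by rewrite mulr_ge0 ?exprn_even_ge0 // lambert_sum_ge0 // v5_bound.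
    apply: ler_pM a4 (lambert_sum_le (v5_bound v01) m (isT : (5 <= 5)%N)).
      by rewrite exprn_even_ge0.
    by rewrite lambert_sum_ge0 // v5_bound.
  have -> : 256 * t * (v ^+ 28 * (CB / t ^+ 6)) = 256 * CB * v ^+ 3 by field.
  apply: ler_wpM2l; first exact: mulr_ge0 (ler0n _ _) (ltW CB0).
  by rewrite -[leRHS]expr1; exact: vX_le.
have h7 : v <= CB * v by rewrite ler_peMl ?(ltW v0) //; have := @exprn_ege1 R 5 10 (ler1n _ 10); lra.
have aux (S D x y z e c : R) : x - 2 * y <= S -> D <= x + z -> z <= e -> y <= 256 * c ->
  e <= c -> 0 <= c -> - (10 ^+ 3 * c) <= S - D by lra.
rewrite -mulrA; apply: (aux _ _ _ _ _ _ _ _ _ h5 _ h7); last by rewrite mulr_ge0 ?ltW.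
- by rewrite h4 in h3; exact: h3.
- by apply: le_trans h2 _; rewrite mulrDr.
- by rewrite [leRHS]mulrA.
Qed.

(** Dropping [Re_defect q a] forgoes the cancellation and leaves slope * a^2 / t^4, of order 1 / v,
    which is still small against 1 / t. *)
Lemma Re_multiplier_le a : `|a| <= v ^+ 7 -> Re (multiplier (q%:C * cis a)) - multiplier_const <= 256 * CB / v.
Proof.
move=> ha; rewrite Re_multiplier; have s0 := slope_ge0.
have a2 : a ^+ 2 <= v ^+ 14.
  rewrite -(real_normK (num_real a)) (_ : v ^+ 14 = (v ^+ 7) ^+ 2); last by rewrite -exprM.
  by rewrite lerXn2r ?nnegrE // exprn_ge0 // ltW.
have h1 : \sum_(1 <= i < m.+1) i%:R * Re_defect (q ^+ i) (i%:R * a) <= a ^+ 2 * lambert_sum t 3 m.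
  rewrite /lambert_sum mulr_sumr !big_nat; apply: ler_sum => i /andP[i0 _].
  have qi := expRN_exp_bound v01 i0; have ir : 0 < i%:R :> R by rewrite ltr0n.
  have d : 0 < 1 - q ^+ i by rewrite subr_gt0; case/andP: qi.
  apply: le_trans (ler_wpM2l (ltW ir) (Re_defect_le _ qi)) _.
  have -> : i%:R * ((i%:R * a) ^+ 2 / 2 * (q ^+ i * (1 + q ^+ i) / (1 - q ^+ i) ^+ 3)) =
    a ^+ 2 * (i%:R ^+ 3 * (q ^+ i / (1 - q ^+ i) ^+ 3)) * ((1 + q ^+ i) / 2).
    by field; exact: lt0r_neq0.
  apply: ler_piMr; last by case/andP: qi => _ /ltW; lra.
  by rewrite mulr_ge0 ?sqr_ge0 // (lambert_term_ge0 (v5_bound v01)).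
have h2 := Re_defect_ge0 a q01.
have h3 : slope * (a ^+ 2 * lambert_sum t 3 m) <= 256 * CB / v.
  apply: (@le_trans _ _ (256 * t * (v ^+ 14 * (CB / t ^+ 4)))).
    apply: ler_pM slope_le _ => //.
      by rewrite mulr_ge0 ?sqr_ge0 // lambert_sum_ge0 // v5_bound.
    apply: ler_pM a2 (lambert_sum_le (v5_bound v01) m (isT : (3 <= 5)%N)).
      by rewrite sqr_ge0.
    by rewrite lambert_sum_ge0 // v5_bound.
  by rewrite le_eqVlt; apply/orP; left; apply/eqP; field.
have := ler_wpM2l s0 h1; move: h2 h3; move: (slope * _) (slope * _) (Re_defect _ _) (_ / v) => x y z w; lra.
Qed.

(** The linear terms cancel by [slopeM]; the cubic ones are of order |a|^3 / t^4 and slope * |a|^3 /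
    t^5, hence O(v). *)
Lemma Im_multiplier_le a : `|a| <= v ^+ 7 -> `|Im (multiplier (q%:C * cis a))| <= 10 ^+ 3 * CB * v.
Proof.
move=> ha; rewrite Im_multiplier; have s0 := slope_ge0.
have a0 : 0 <= `|a| by [].
have a3 : `|a| ^+ 3 <= v ^+ 21.
  rewrite (_ : v ^+ 21 = (v ^+ 7) ^+ 3); last by rewrite -exprM.
  by rewrite lerXn2r ?nnegrE // exprn_ge0 // ltW.
pose S := \sum_(1 <= i < m.+1) (i%:R * Im (1 - (q ^+ i)%:C * cis (i%:R * a))^-1
   - a * (i%:R ^+ 2 * (q ^+ i / (1 - q ^+ i) ^+ 2))).
have -> : Im (1 - q%:C * cis a)^-1 -
    slope * (\sum_(1 <= i < m.+1) i%:R * Im (1 - (q ^+ i)%:C * cis (i%:R * a))^-1) =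
  (Im (1 - q%:C * cis a)^-1 - a * (q / (1 - q) ^+ 2)) - slope * S.
  by rewrite /S sumrB -mulr_sumr -/(lambert_sum t 2 m) -slopeM; ring.
have hS : `|S| <= 2 * `|a| ^+ 3 * lambert_sum t 4 m.
  rewrite /S /lambert_sum mulr_sumr; apply: le_trans (ler_norm_sum _ _ _) _.
  rewrite !big_nat; apply: ler_sum => i /andP[i0 _].
  have qi := expRN_exp_bound v01 i0; have ir : 0 <= i%:R :> R by [].
  have -> : i%:R * Im (1 - (q ^+ i)%:C * cis (i%:R * a))^-1 - a * (i%:R ^+ 2 * (q ^+ i / (1 - q ^+ i) ^+ 2)) =
    i%:R * (Im (1 - (q ^+ i)%:C * cis (i%:R * a))^-1 - (i%:R * a) * (q ^+ i / (1 - q ^+ i) ^+ 2)) by ring.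
  rewrite normrM normr_nat; apply: le_trans (ler_wpM2l ir (Im_inv_1sub_near _ qi)) _.
  by rewrite normrM normr_nat le_eqVlt; apply/orP; left; apply/eqP; ring.
have h1 : slope * `|S| <= 2 * 256 * CB * v.
  apply: (@le_trans _ _ (256 * t * (2 * v ^+ 21 * (CB / t ^+ 5)))).
    apply: ler_pM slope_le _ => //; apply: le_trans hS _.
    apply: ler_pM _ (lambert_sum_le (v5_bound v01) m (isT : (4 <= 5)%N)).
    - by rewrite mulr_ge0 // exprn_ge0.
    - by rewrite lambert_sum_ge0 // v5_bound.
    - by rewrite ler_pM2l.
  by rewrite le_eqVlt; apply/orP; left; apply/eqP; field.
have h2 : `|Im (1 - q%:C * cis a)^-1 - a * (q / (1 - q) ^+ 2)| <= 8 * v.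
  apply: le_trans (Im_inv_1sub_near _ q01) _.
  have -> : q / (1 - q) ^+ 4 = q / (1 - q) ^+ 2 * ((1 - q)^-1) ^+ 2 by field; exact: lt0r_neq0.
  have hi : (1 - q)^-1 <= 2 / t.
    apply: le_trans (inv_1sub_expRN_le tp) _.
    have : 1 <= t^-1 by rewrite invf_ge1 //; apply: le_trans tl _; lra.
    move: (t^-1) => x; lra.
  apply: (@le_trans _ _ (2 * v ^+ 21 * ((t ^+ 2)^-1 * (2 / t) ^+ 2))).
    apply: ler_pM; rewrite ?mulr_ge0 ?exprn_ge0 ?invr_ge0 ?exprn_ge0 ?(ltW qp) //.
      by rewrite ler_pM2l.
    apply: ler_pM; rewrite ?mulr_ge0 ?exprn_ge0 ?invr_ge0 ?exprn_ge0 ?(ltW qp) //.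
      exact: slope_num_le.
    by rewrite lerXn2r ?nnegrE ?invr_ge0 ?(ltW qp) // divr_ge0 // ltW.
  by rewrite le_eqVlt; apply/orP; left; apply/eqP; field.
have h7 : v <= CB * v by rewrite ler_peMl ?(ltW v0) //; have := @exprn_ege1 R 5 10 (ler1n _ 10); lra.
apply: le_trans (ler_normB _ _) _; rewrite normrM (ger0_norm s0).
have aux (x y e c : R) : x <= 8 * e -> y <= 2 * 256 * c -> e <= c -> 0 <= c -> x + y <= 10 ^+ 3 * c by lra.
rewrite -mulrA; apply: aux h2 _ h7 _; last by rewrite mulr_ge0 // ltW.
by rewrite [leRHS]mulrA.
Qed.

Lemma normc_lambert_le a : normc (lambert m (q%:C * cis a)) <= lambert_sum t 1 m.
Proof.
rewrite /lambert /lambert_sum; apply: le_trans (ler_normc_sum _ _ _) _.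
rewrite !big_nat; apply: ler_sum => i /andP[i0 _]; rewrite !expr1.
have zq := normc_circle v a; have qi := expRN_exp_bound v01 i0.
have -> : i%:R = (i%:R%:C : R[i]) by rewrite rmorph_nat.
rewrite normcM normcR ger0_norm // ler_wpM2l // normcM normc_exp zq normcV.
apply: ler_wpM2l; first by case/andP: qi.
have h := le_normcD (1 - (q%:C * cis a) ^+ i) ((q%:C * cis a) ^+ i).
rewrite subrK normc1 normc_exp zq in h.
have d : 0 < 1 - q ^+ i by rewrite subr_gt0; case/andP: qi.
have h' : 1 - q ^+ i <= normc (1 - (q%:C * cis a) ^+ i) by lra.
by rewrite lef_pV2 // posrE // (lt_le_trans d).
Qed.

Lemma slope_lambert1_le : slope * lambert_sum t 1 m <= 256 * CB / t.
Proof.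
apply: (@le_trans _ _ (256 * t * (CB / t ^+ 2))).
  apply: ler_pM slope_le (lambert_sum_le (v5_bound v01) m (isT : (1 <= 5)%N)).
    exact: slope_ge0.
  by rewrite lambert_sum_ge0 // v5_bound.
by rewrite le_eqVlt; apply/orP; left; apply/eqP; move: tp; move: t => s sp; field; exact: lt0r_neq0.
Qed.

(** Valid on the whole circle and meant as [B] in [coef_transfer], where the factor v ^+ 8 makes a
    growth like 1 / t affordable. *)
Lemma normc_multiplier_le a : normc (multiplier (q%:C * cis a) - multiplier_const%:C) <= 10 ^+ 3 * CB / t.
Proof.
have zq := normc_circle v a.
have h1 : normc (1 - q%:C * cis a)^-1 <= 2 / t.
  have := normc_inv_1sub_le q01 (ltn0Sn 0) zq; rewrite expr1 => h.
  apply: le_trans h _; apply: le_trans (inv_1sub_expRN_le tp) _.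
  have : 1 <= t^-1 by rewrite invf_ge1 //; apply: le_trans tl _; lra.
  move: (t^-1) => x; lra.
have h2 : (1 - q)^-1 <= 2 / t.
  apply: le_trans (inv_1sub_expRN_le tp) _.
  have : 1 <= t^-1 by rewrite invf_ge1 //; apply: le_trans tl _; lra.
  move: (t^-1) => x; lra.
have h3 := slope_lambert1_le; have s0 := slope_ge0.
have h4 := ler_wpM2l s0 (normc_lambert_le a).
have -> : multiplier (q%:C * cis a) - multiplier_const%:C =
  ((1 - q%:C * cis a)^-1 + (- (1 - q)^-1)%:C) + ((- slope)%:C * lambert m (q%:C * cis a) + (slope * lambert_sum t 1 m)%:C).
  by rewrite /multiplier /multiplier_const !rmorphB rmorphN /= rmorphN; ring.
apply: le_trans (le_normcD _ _) _.
have h5 := le_normcD (1 - q%:C * cis a)^-1 (- (1 - q)^-1)%:C.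
have h6 := le_normcD ((- slope)%:C * lambert m (q%:C * cis a)) (slope * lambert_sum t 1 m)%:C.
rewrite normcM !normcR normrN (ger0_norm s0) in h6.
rewrite normcR normrN ger0_norm ?invr_ge0 ?(ltW qp) // in h5.
have L0 := mulr_ge0 s0 (lambert_sum_ge0 (v5_bound v01) 1 m).
rewrite (ger0_norm L0) in h6.
have cb1 : 1 <= CB by have := @exprn_ege1 R 5 10 (ler1n _ 10); lra.
have ti : 0 <= t^-1 by rewrite invr_ge0 ltW.
have h7 : t^-1 <= CB * t^-1 by rewrite ler_peMl.
have aux (A A1 A2 B B1 B2 e c : R) : A <= A1 + A2 -> B <= B1 + B2 -> A1 <= 2 * e -> A2 <= 2 * e ->
  B1 <= B2 -> B2 <= 256 * c -> e <= c -> 0 <= e -> A + B <= 10 ^+ 3 * c by lra.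
by rewrite -[10 ^+ 3 * _ * _]mulrA; apply: aux h5 h6 h1 h2 h4 _ h7 ti; rewrite mulrA.
Qed.

End multiplier.

(** * Bounds for spt *)

Section spt_bounds.
Local Open Scope complex_scope.
Variables (R : realType) (v : R) (n m : nat).
Notation t := (v ^+ 5).
Notation q := (expR (- t)).
Notation CB := (4 * 10 ^+ 5 : R).
Hypothesis v01 : 0 < v <= 1 / 2.
Hypothesis v_small : (CB + 20) * v <= 1.
Hypothesis ht : n%:R = pi ^+ 2 / 6 / t ^+ 2.
Hypothesis hmn : (n < m)%N.
Hypothesis hm : 4 / t ^+ 3 <= m%:R.
Hypothesis exp_small : 128 * expR (- (1 / (320 * v))) <= v ^+ 16.

Let v0 : 0 < v. Proof. by case/andP: v01. Qed.
Let v1 : v <= 1 / 2. Proof. by case/andP: v01. Qed.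
Let vn0 : v != 0. Proof. by rewrite gt_eqF. Qed.
Let tp : 0 < t. Proof. exact: exprn_gt0. Qed.
Let tl : t <= 1 / 2. Proof. by case/andP: (v5_bound v01). Qed.
Let q01 : 0 <= q < 1. Proof. exact: expRN_v5_bound. Qed.
Let qp : 0 < 1 - q. Proof. by rewrite subr_gt0; case/andP: q01. Qed.
Let q0 : 0 <= q. Proof. exact: expR_ge0. Qed.
Let cb1 : 1 <= CB. Proof. by have := @exprn_ege1 R 5 10 (ler1n _ 10); lra. Qed.

Notation phi := (kernel_arg v n m).
Notation p := ((npart_ge 1 n)%:R : R).
Notation s := (slope v m).
Notation M0 := (lambert_sum t 1 m).

(** The source of strictness: (1 - q)^-1 - 1 / 2 = coth(t / 2) / 2 already reaches 1 / t, and the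
    slope times n - M adds at least t / (2 CB) times 1 / (153 t). *)
Lemma multiplier_const_lower : 1 / t + 1 / (306 * CB) <= multiplier_const v m + s * n%:R.
Proof.
have e : multiplier_const v m + s * n%:R = (1 - q)^-1 - 1 / 2 + s * (n%:R - M0) by rewrite /multiplier_const; ring.
rewrite e; apply: lerD.
  have := coth_ge tp; have -> : (1 + q) / (1 - q) = 2 * ((1 - q)^-1 - 1 / 2).
    by field; exact: lt0r_neq0.
  rewrite -[2 / t]/(2 * t^-1) -[1 / t]/(1 * t^-1); move: (t^-1) ((1 - q)^-1) => x y; lra.
have h := lambert_sum1_le (v5_bound v01) m; rewrite -ht in h.
apply: (@le_trans _ _ (t / (2 * CB) * (153^-1 / t))); last first.
  apply: ler_pM (slope_ge v01 hm) _.
  - by rewrite divr_ge0 ?(ltW tp) // mulr_ge0 // (le_trans ler01 cb1).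
  - by apply: divr_ge0 (ltW tp); rewrite invr_ge0; exact: ler0n.
  - by move: h; move: M0 (n%:R) (_ / t) => x y z; lra.
rewrite le_eqVlt; apply/orP; left; apply/eqP; move: tp cb1; move: t CB => x y x0 y1.
by field; rewrite !lt0r_neq0 // (lt_le_trans ltr01).
Qed.

Lemma multiplier_const_upper : multiplier_const v m + s * n%:R <= 1 / t + 10 ^+ 4.
Proof.
have e : multiplier_const v m + s * n%:R = (1 - q)^-1 - 1 / 2 + s * (n%:R - M0) by rewrite /multiplier_const; ring.
rewrite e.
have h1 := inv_1sub_expRN_le tp.
have h := lambert1_near v01 ht hm; rewrite ler_norml in h; have /andP[h2 _] := h.
have h3 : s * (n%:R - M0) <= 256 * t * (20 / t).
  apply: le_trans (ler_wpM2l (slope_ge0 v01 hm) (_ : n%:R - M0 <= 20 / t)) _.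
    by move: h2; move: M0 (n%:R) (20 / t) => x y z; lra.
  by apply: ler_wpM2r (slope_le v01 hm); rewrite divr_ge0 // ltW.
have e2 : 256 * t * (20 / t) = 256 * 20 by move: tp; move: t => x x0; field; exact: lt0r_neq0.
rewrite e2 in h3; rewrite -[1 / t]/(1 * t^-1).
move: h1 h3; move: (t^-1) ((1 - q)^-1) (s * _) => x y z; lra.
Qed.

Lemma coef_multipliers : exists J1, forall J, (J1 <= J)%N -> [/\
  (part_poly R[i] J 1 m)`_n = p%:C,
  (part_poly R[i] J 1 m * (geom_poly R[i] J 1 - 1))`_n = (nmult 1 n)%:R%:C,
  (part_poly R[i] J 1 m * (1 - 'X) * (geom_poly R[i] J 2 - 1))`_n = (nmult 2 n)%:R%:C &
  ('X * (part_poly R[i] J 1 m)^`())`_n = (n%:R * p)%:C].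
Proof.
exists n.+1 => J lt; have le : (n <= m)%N := ltnW hmn.
have m0 : (0 < m)%N by apply: leq_ltn_trans hmn.
rewrite coef_nmult1 // coef_nmult2 // coef_part_poly // !rmorph_nat; split=> //.
rewrite coefXM; case: (n) lt le => [|k] lt le; first by rewrite mul0r.
by rewrite coef_deriv coef_part_poly // rmorphM !rmorph_nat mulr_natl.
Qed.

Lemma sub_cis_near a : `|a| <= v ^+ 7 -> normc (1 - q%:C * cis a) <= 3 * t.
Proof.
move=> ha.
have at1 : `|a| <= t by apply: le_trans ha _; exact: vX_le.
have -> : 1 - q%:C * cis a = (1 - q * cos a)%:C + (- (q * sin a))%:C * 'i%C.
  by rewrite /cis; simpc.
apply: le_trans (le_normcD _ _) _; rewrite normcM !normcR normrN.
have -> : normc ('i%C : R[i]) = 1 by rewrite /= expr0n add0r expr1n sqrtr1.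
rewrite mulr1 normrM (ger0_norm q0).
have h1 : q * `|sin a| <= 1 * `|a|.
  by apply: ler_pM => //; [case/andP: q01 => _ /ltW|exact: normr_sin_le].
have h2 : 1 - q <= t by have := expR_ge1Dx (- t); move: q t => x y; lra.
have h3 : q * (1 - cos a) <= 1 * (a ^+ 2 / 2).
  apply: ler_pM => //; rewrite ?onesubcos_ge0 ?onesubcos_le //.
  by case/andP: q01 => _ /ltW.
have h4 : a ^+ 2 <= t * 1.
  rewrite -(real_normK (num_real a)) expr2; apply: ler_pM => //.
  by apply: le_trans at1 _; apply: le_trans tl _; lra.
have h5 := one_sub_xcos_ge a q01.
have h6 : 0 <= 1 - q * cos a := le_trans (ltW qp) h5.
rewrite (ger0_norm h6).
have -> : 1 - q * cos a = (1 - q) + q * (1 - cos a) by ring.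
have aux (D X Y A2 A T : R) : X <= 1 * A -> D <= T -> Y <= 1 * (A2 / 2) ->
  A2 <= T * 1 -> A <= T -> 0 < T -> D + Y + X <= 3 * T by lra.
exact: aux h1 h2 h3 h4 at1 tp.
Qed.

(** The singularity at z = 1 is removable: the difference equals -(2 z + 1)(1 - z) / (2 (1 + z)),
    and 1 + z stays away from 0 because 1 - z is at most 3 t in modulus. *)
Lemma twos_multiplier_near a z : `|a| <= v ^+ 7 -> z = q%:C * cis a ->
  normc ((1 - z) * ((1 - z ^+ 2)^-1 - 1) - (1 / 2)%:C) <= 9 * v.
Proof.
move=> ha ez; have h1 := sub_cis_near ha; rewrite -ez in h1.
have zq : normc z = q by rewrite ez; exact: normc_circle.
have tv : t <= v ^+ 4 * v by rewrite -exprSr.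
have t32 : t <= 1 / 32.
  have : t <= (1 / 2) ^+ 5 by rewrite lerXn2r ?nnegrE ?(ltW v0).
  have -> : (1 / 2) ^+ 5 = 1 / 32 :> R by field.
  by [].
have tv1 : t <= v by rewrite -[leRHS]expr1; exact: vX_le.
have n2 : 1 / 2 <= normc (1 + z).
  have := le_normcD (1 + z) (1 - z); rewrite addrA addrAC addrK.
  have -> : normc (1 + 1 : R[i]) = 2.
    by rewrite -[1 + 1]/(2%:R) -(rmorph_nat (real_complex R)) normcR ger0_norm.
  move: h1 t32; move: t (normc _) (normc _) => x y w; lra.
have nz : 1 + z != 0 by apply/eqP => e; move: n2; rewrite e normc0; lra.
have nz1 : 1 - z != 0 by have := one_subX_neq0 q01 (ltn0Sn 0) zq; rewrite expr1.
have -> : (1 - z) * ((1 - z ^+ 2)^-1 - 1) - (1 / 2)%:C = - ((2 * z + 1) * (1 - z)) * (2^-1)%:C * (1 + z)^-1.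
  have -> : (1 / 2)%:C = 2^-1 :> R[i] by rewrite div1r fmorphV rmorph_nat.
  have -> : (2^-1)%:C = 2^-1 :> R[i] by rewrite fmorphV rmorph_nat.
  have -> : 1 - z ^+ 2 = (1 - z) * (1 + z) by ring.
  by field; rewrite nz nz1.
rewrite !normcM normcN normcM normcR normcV.
have n3 : normc (2 * z + 1) <= 3.
  apply: le_trans (le_normcD _ _) _; rewrite normcM normc1 zq.
  have -> : normc (2 : R[i]) = 2 by rewrite -(rmorph_nat (real_complex R)) normcR ger0_norm.
  by case/andP: q01 => _ /ltW; move: q => x; lra.
have n4 : (normc (1 + z))^-1 <= 2.
  rewrite -[leRHS]invrK lef_pV2 ?posrE ?invr_gt0 //; last by apply: lt_le_trans n2; lra.
  by move: n2; rewrite div1r.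
rewrite ger0_norm ?invr_ge0 //.
apply: (@le_trans _ _ (3 * (3 * t) * 2^-1 * 2)).
  apply: ler_pM => //; rewrite ?invr_ge0 ?normc_ge0 ?mulr_ge0 ?normc_ge0 ?invr_ge0 //.
  by rewrite ler_pM2r // ler_pM ?normc_ge0.
move: tv1; move: t => x; lra.
Qed.

Lemma twos_multiplier_le a z : z = q%:C * cis a ->
  normc ((1 - z) * ((1 - z ^+ 2)^-1 - 1) - (1 / 2)%:C) <= 10 / t.
Proof.
move=> ez; have zq : normc z = q by rewrite ez; exact: normc_circle.
have h1 : normc (1 - z ^+ 2)^-1 <= 2 / t.
  have := normc_inv_1sub_le q01 (ltn0Sn 1) zq => h.
  apply: le_trans h _; apply: le_trans (inv_1sub_expRN_le tp) _.
  have : 1 <= t^-1 by rewrite invf_ge1 //; apply: le_trans tl _; lra.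
  move: (t^-1) => x; lra.
have h2 : normc (1 - z) <= 2.
  apply: le_trans (le_normcD _ _) _; rewrite normc1 normcN zq.
  by case/andP: q01 => _ /ltW; move: q => x; lra.
apply: le_trans (le_normcD _ _) _; rewrite normcM normcN normcR ger0_norm ?divr_ge0 //.
have h3 := le_normcD (1 - z ^+ 2)^-1 (-1); rewrite normcN normc1 in h3.
have t2 : 2 <= t^-1 by rewrite -[2]invrK lef_pV2 ?posrE ?invr_gt0 //; move: tl; rewrite div1r.
have h4 : normc (1 - z) * normc ((1 - z ^+ 2)^-1 - 1) <= 2 * (2 / t + 1).
  by apply: ler_pM; rewrite ?normc_ge0 //; apply: le_trans h3 _; rewrite lerD2r.
move: h4 t2; rewrite -[2 / t]/(2 * t^-1) -[10 / t]/(10 * t^-1); move: (t^-1) (_ * normc _) => x y; lra.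
Qed.

Lemma Re_cisM f (w : R[i]) : Re (cis f * w) = cos f * Re w - sin f * Im w.
Proof. by case: w. Qed.

Lemma nmult_lower : p * (1 / t + 1 / (306 * CB) - 2 * 10 ^+ 4 * CB * v) <=
  (nmult 1 n)%:R + (nmult 2 n)%:R.
Proof.
(* The 1 is made of two halves: the one subtracted inside [multiplier], and the value at z = 1 of
   the multiplier for w_2. *)
pose c := (1 + multiplier_const v m)%:C : R[i].
have cE : c = (1 / 2)%:C + (multiplier_const v m)%:C + (1 / 2)%:C.
  by rewrite /c -!rmorphD; congr (_%:C); field.
pose Q J := part_poly R[i] J 1 m * (geom_poly R[i] J 1 + (- c)%:P) +
  ((- s)%:C%:P * ('X * (part_poly R[i] J 1 m)^`()) +
   part_poly R[i] J 1 m * (1 - 'X) * (geom_poly R[i] J 2 + (- 1)%:P)).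
pose h z := (multiplier v m z - (multiplier_const v m)%:C) + ((1 - z) * ((1 - z ^+ 2)^-1 - 1) - (1 / 2)%:C) : R[i].
have lim : unif_lim q Q (fun z => euler_inv m z * h z).
  have L1 := unif_limM (unif_lim_part m q01) (unif_limD (unif_lim_geom q01 (ltn0Sn 0)) (unif_lim_poly q (- c)%:P)).
  have L2 := unif_limM (unif_lim_poly q (- s)%:C%:P) (unif_lim_dpart m q01).
  have L3 := unif_limM (unif_limM (unif_lim_part m q01) (unif_lim_poly q (1 - 'X)))
     (unif_limD (unif_lim_geom q01 (ltn0Sn 1)) (unif_lim_poly q (- 1)%:P)).
  apply: unif_lim_ext (unif_limD L1 (unif_limD L2 L3)) => [//|z zq].
  by rewrite !hornerC !hornerE /h /multiplier cE rmorphN /=; ring.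
have cf : exists J1, forall J, (J1 <= J)%N -> (Q J)`_n =
    ((nmult 1 n)%:R + (nmult 2 n)%:R - (multiplier_const v m + s * n%:R) * p)%:C.
  have [J1 HJ] := coef_multipliers; exists J1 => J le; have [e1 e2 e3 e4] := HJ J le.
  have -> : Q J = part_poly R[i] J 1 m * (geom_poly R[i] J 1 - 1) +
     (1 - c)%:P * part_poly R[i] J 1 m +
     (- s)%:C%:P * ('X * (part_poly R[i] J 1 m)^`()) +
     part_poly R[i] J 1 m * (1 - 'X) * (geom_poly R[i] J 2 - 1).
    by rewrite /Q !polyCB !polyCN !polyC1; ring.
  rewrite !coefD !coefCM e1 e2 e3 e4 /c.
  have -> : 1 - (1 + multiplier_const v m)%:C = (- multiplier_const v m)%:C :> R[i].
    by rewrite rmorphD rmorph1 opprD addrA subrr add0r rmorphN.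
  by rewrite -!rmorphM -!rmorphD; congr (_%:C); ring.
(* The real and imaginary errors of [multiplier] contribute 10 ^+ 3 * CB * v each, the multiplier
   for w_2 contributes 9 * v. *)
pose kap := (2 * 10 ^+ 3 * CB + 9) * v; pose B := 10 ^+ 3 * CB / t + 10 / t.
have k0 : 0 <= kap by apply: mulr_ge0 (ltW v0); move: cb1; move: CB => x; lra.
have B0 : 0 <= B.
  have t0' := ltW tp; apply: addr_ge0; apply: divr_ge0; [|exact: t0'|exact: ler0n|exact: t0'].
  by apply: mulr_ge0; [exact: exprn_ge0|exact: le_trans ler01 cb1].
have near a : `|a| <= v ^+ 7 -> - kap <= Re (cis (phi a) * h (q%:C * cis a)).
  move=> ha; rewrite /h mulrDr ReD.
  have h1 := Re_multiplier_ge v01 hm ha; have h2 := Im_multiplier_le v01 hm ha.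
  have h3 := twos_multiplier_near ha erefl; have hc := cos_kernel_arg v01 v_small ht hm ha.
  set w2 := (_ * _ - (1 / 2)%:C) in h3 *.
  have h4 : `|Re (cis (phi a) * w2)| <= 9 * v.
    by apply: le_trans (ler_normc_Re _) _; rewrite normcM normc_cis mul1r.
  rewrite Re_cisM ReB ImB /= subr0.
  have h5 : - (10 ^+ 3 * CB * v) <= cos (phi a) * (Re (multiplier v m (q%:C * cis a)) - multiplier_const v m).
    set x := _ - _ in h1 *; have cl := cos_le1 (phi a).
    have e0 : 0 <= 10 ^+ 3 * CB * v.
      apply: mulr_ge0 (ltW v0); apply: mulr_ge0; [exact: exprn_ge0|exact: le_trans ler01 cb1].
    have [x0|x0] := leP 0 x.
      by apply: (@le_trans _ _ 0); rewrite ?oppr_le0 // mulr_ge0 // (le_trans _ hc) // divr_ge0.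
    apply: le_trans h1 _; have : 0 <= (1 - cos (phi a)) * (- x).
      by rewrite mulr_ge0 ?subr_ge0 // oppr_ge0 ltW.
    lra.
  have h6 : `|sin (phi a) * Im (multiplier v m (q%:C * cis a))| <= 10 ^+ 3 * CB * v.
    rewrite normrM -[leRHS]mul1r; apply: ler_pM => //; exact: sin_max.
  have aux (x y z e b : R) : - (9 * e) <= z -> - (10 ^+ 3 * b * e) <= x -> y <= 10 ^+ 3 * b * e ->
    - ((2 * 10 ^+ 3 * b + 9) * e) <= x - y + z by lra.
  move: h4 h6; rewrite !ler_norml => /andP[g1 _] /andP[_ g3].
  exact: aux g1 h5 g3.
have bnd a : normc (h (q%:C * cis a)) <= B.
  apply: le_trans (le_normcD _ _) _; apply: lerD; last exact: twos_multiplier_le.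
  exact: normc_multiplier_le.
have := coef_transfer v01 v_small ht (ltnW hmn) hm exp_small k0 B0 lim cf near bnd.
have p0 : 0 <= p by [].
have hc := ler_wpM2l p0 multiplier_const_lower.
have he : 2 * kap + (2 * kap + B) * v ^+ 8 <= 2 * 10 ^+ 4 * CB * v.
  have eB : B * v ^+ 8 = (10 ^+ 3 * CB + 10) * v ^+ 3.
    by rewrite /B; move: CB => b; field.
  have h3 : B * v ^+ 8 <= (10 ^+ 3 * CB + 10) * v.
    rewrite eB; apply: ler_wpM2l; first by move: cb1; move: CB => x; lra.
    by rewrite -[leRHS]expr1; exact: vX_le.
  have h8 : 2 * kap * v ^+ 8 <= 2 * kap.
    apply: ler_piMr; first exact: (mulr_ge0 (ler0n _ 2) k0).
    by apply: (@le_trans _ _ (v ^+ 0)); [exact: vX_le|rewrite expr0].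
  have hv : v <= CB * v by rewrite ler_peMl ?(ltW v0).
  have aux (K b e x y : R) : x <= (10 ^+ 3 * b + 10) * e -> y <= 2 * K -> e <= b * e -> 0 < e ->
      K = (2 * 10 ^+ 3 * b + 9) * e -> 2 * K + (y + x) <= 2 * 10 ^+ 4 * b * e.
    by move=> g1 g2 g3 g4 g5; rewrite g5 in g2 *; lra.
  by rewrite [(2 * kap + B) * _]mulrDl; apply: aux h3 h8 hv v0 erefl.
have he' := ler_wpM2l p0 he.
have aux (P X Y Z W N : R) : P * Z <= P * X -> P * Y <= P * W -> - (Y * P) <= N - X * P ->
  P * (Z - W) <= N by rewrite mulrBr ![_ * P]mulrC; lra.
exact: aux hc he'.
Qed.

(** The transfer is applied to the opposite multiplier, so [Re_multiplier_le] is what enters; the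
    error O(1 / v) is far larger than in [nmult_lower] but still o(1 / t). *)
Lemma nmult_upper : (nmult 1 n)%:R <= p * (1 / t + 2 * 10 ^+ 4 * CB / v).
Proof.
pose c := (multiplier_const v m + 1 / 2)%:C : R[i].
pose Q J := part_poly R[i] J 1 m * (c%:P - geom_poly R[i] J 1) +
  s%:C%:P * ('X * (part_poly R[i] J 1 m)^`()).
pose h z := (multiplier_const v m)%:C - multiplier v m z : R[i].
have cE : c = (multiplier_const v m)%:C + (1 / 2)%:C by rewrite /c rmorphD.
have lim : unif_lim q Q (fun z => euler_inv m z * h z).
  have L1 := unif_limM (unif_lim_part m q01) (unif_limD (unif_lim_poly q c%:P)
     (unif_limM (unif_lim_poly q (- 1)%:P) (unif_lim_geom q01 (ltn0Sn 0)))).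
  have L2 := unif_limM (unif_lim_poly q s%:C%:P) (unif_lim_dpart m q01).
  apply: unif_lim_ext (unif_limD L1 L2) => [J|z zq].
    by rewrite /Q polyCN polyC1 mulN1r.
  by rewrite !hornerC !hornerE /h /multiplier cE /=; ring.
have cf : exists J1, forall J, (J1 <= J)%N -> (Q J)`_n =
    ((multiplier_const v m + s * n%:R) * p - (nmult 1 n)%:R - p / 2)%:C.
  have [J1 HJ] := coef_multipliers; exists J1 => J le; have [e1 e2 e3 e4] := HJ J le.
  have -> : Q J = (c - 1)%:P * part_poly R[i] J 1 m - part_poly R[i] J 1 m * (geom_poly R[i] J 1 - 1) +
     s%:C%:P * ('X * (part_poly R[i] J 1 m)^`()).
    by rewrite /Q !polyCB polyC1; ring.
  rewrite coefD coefB !coefCM e1 e2 e4 /c.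
  have -> : (multiplier_const v m + 1 / 2)%:C - 1 = (multiplier_const v m - 1 / 2)%:C :> R[i].
    transitivity ((multiplier_const v m + 1 / 2)%:C - (1 : R)%:C : R[i]); first by [].
    by rewrite -rmorphB; congr (_%:C); field.
  by rewrite -!rmorphM -rmorphB -rmorphD; congr (_%:C); field.
pose kap := 2 * 10 ^+ 3 * CB / v; pose B := 10 ^+ 3 * CB / t.
have CB0 : 0 <= CB by exact: le_trans ler01 cb1.
have k0 : 0 <= kap by apply: mulr_ge0; [apply: mulr_ge0 => //; apply: mulr_ge0 => //; exact: exprn_ge0|rewrite invr_ge0 ltW].
have B0 : 0 <= B by apply: mulr_ge0; [apply: mulr_ge0 => //; exact: exprn_ge0|rewrite invr_ge0 ltW].
have vi : v <= v^-1.
  by rewrite -[leRHS]mul1r ler_pdivlMr //; have := v1; have := v0; nra.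
have near a : `|a| <= v ^+ 7 -> - kap <= Re (cis (phi a) * h (q%:C * cis a)).
  move=> ha; rewrite /h Re_cisM ReB ImB /= sub0r.
  have h1 := Re_multiplier_le v01 hm ha; have h2 := Im_multiplier_le v01 hm ha.
  have hc := cos_kernel_arg v01 v_small ht hm ha; have cl := cos_le1 (phi a).
  have hc0 : 0 <= cos (phi a) by apply: le_trans hc; rewrite divr_ge0.
  have h6 : `|sin (phi a) * Im (multiplier v m (q%:C * cis a))| <= 10 ^+ 3 * CB * v.
    rewrite normrM -[leRHS]mul1r; apply: ler_pM => //; exact: sin_max.
  have h7 : 10 ^+ 3 * CB * v <= 10 ^+ 3 * CB * v^-1.
    by apply: ler_wpM2l vi; apply: mulr_ge0 => //; exact: exprn_ge0.
  have h5 : - (256 * CB / v) <= cos (phi a) * (multiplier_const v m - Re (multiplier v m (q%:C * cis a))).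
    rewrite -opprB mulrN lerN2; set x := _ - _ in h1 *.
    have e0 : 0 <= 256 * CB / v.
      by apply: mulr_ge0; [exact: mulr_ge0 (ler0n _ _) CB0|rewrite invr_ge0 ltW].
    have [x0|x0] := leP 0 x; first by apply: le_trans h1; rewrite ler_piMl.
    by apply: le_trans e0; rewrite mulr_ge0_le0 // ltW.
  have aux (x y b e : R) : - (256 * b * e) <= x -> - (10 ^+ 3 * b * e) <= y -> 0 <= b * e ->
     - (2 * 10 ^+ 3 * b * e) <= x - - y by lra.
  move: h6; rewrite ler_norml => /andP[g2 _].
  rewrite mulrN; apply: aux h5 _ _; first by apply: le_trans g2; rewrite lerN2.
  by rewrite mulr_ge0 // invr_ge0 ltW.
have bnd a : normc (h (q%:C * cis a)) <= B.
  by rewrite /h -opprB normcN; exact: normc_multiplier_le.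
have := coef_transfer v01 v_small ht (ltnW hmn) hm exp_small k0 B0 lim cf near bnd.
have p0 : 0 <= p by [].
have hc := ler_wpM2l p0 multiplier_const_upper.
have he : 2 * kap + (2 * kap + B) * v ^+ 8 + 10 ^+ 4 <= 2 * 10 ^+ 4 * CB / v.
  have eB : B * v ^+ 8 = 10 ^+ 3 * CB * v ^+ 3 by rewrite /B; move: CB => b; field.
  have h3 : B * v ^+ 8 <= 10 ^+ 3 * CB / v.
    rewrite eB; apply: ler_wpM2l; first by apply: mulr_ge0 => //; exact: exprn_ge0.
    by apply: le_trans vi; rewrite -[leRHS]expr1; exact: vX_le.
  have h8 : 2 * kap * v ^+ 8 <= 2 * kap.
    apply: ler_piMr; first exact: (mulr_ge0 (ler0n _ 2) k0).
    by apply: (@le_trans _ _ (v ^+ 0)); [exact: vX_le|rewrite expr0].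
  have hv : 1 <= CB / v.
    rewrite ler_pdivlMr // mul1r; apply: le_trans cb1; have := v1; lra.
  have aux (K b e x y : R) : x <= 10 ^+ 3 * b * e -> y <= 2 * K -> 1 <= b * e ->
      K = 2 * 10 ^+ 3 * b * e -> 2 * K + (y + x) + 10 ^+ 4 <= 2 * 10 ^+ 4 * b * e.
    by move=> g1 g2 g3 g5; rewrite g5 in g2 *; lra.
  by rewrite [(2 * kap + B) * _]mulrDl; apply: aux h3 h8 hv erefl.
have he' := ler_wpM2l p0 he.
have aux (P X Y Z W N d : R) : P * X <= P * (Z + d) -> P * (Y + d) <= P * W ->
  - (Y * P) <= X * P - N - P / 2 -> 0 <= P -> N <= P * (Z + W).
  by rewrite !mulrDr ![_ * P]mulrC; lra.
by move=> h9; exact: aux hc he' h9 p0.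
Qed.

End spt_bounds.

(** * Choice of the constants *)

Section asymptotics.
Variable R : realType.
Notation CB := (4 * 10 ^+ 5 : R).

(** From e^y >= (y / 17)^17. The exponent is one more than in [exp_small], and the spare factor v
    absorbs the constant. *)
Lemma expRN_inv_le (v : R) : 0 < v -> expR (- (1 / (320 * v))) <= (17 * 320) ^+ 17 * v ^+ 17.
Proof.
move=> v0; rewrite -exprMn expRN.
have c0 : 0 < 17 * 320 * v by rewrite !mulr_gt0 ?ltr0n.
have -> : (17 * 320 * v) ^+ 17 = (((17 * 320 * v)^-1) ^+ 17)^-1 by rewrite exprVn invrK.
rewrite lef_pV2 ?posrE ?expR_gt0 ?exprn_gt0 ?invr_gt0 //.
have -> : 1 / (320 * v) = 17%:R * (17 * 320 * v)^-1 by field; exact: lt0r_neq0.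
rewrite expRM_natl lerXn2r ?nnegrE ?expR_ge0 ?invr_ge0 ?(ltW c0) //.
by apply: le_trans (expR_ge1Dx _); rewrite lerDr.
Qed.

Lemma spt_bounds : exists c0 C0 : R, [/\ 0 < c0, 0 < C0 & forall (v : R) n,
  0 < v <= c0 -> n%:R = pi ^+ 2 / 6 / (v ^+ 5) ^+ 2 ->
  1 / v ^+ 5 * (npartitions n)%:R < (spt n)%:R /\
  (spt n)%:R <= (1 / v ^+ 5 + C0 / v) * (npartitions n)%:R].
Proof.
have cb1 : 1 <= CB by have := @exprn_ege1 R 5 10 (ler1n _ 10); lra.
have cb0 : 0 < CB := lt_le_trans ltr01 cb1.
(* Reciprocals of the thresholds for v: a1 gives [v_small], a2 makes the error 2 * 10 ^+ 4 * CB * v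
   at most half of 1 / (306 * CB), and a3 gives [exp_small]; the 2 in S gives v <= 1 / 2. *)
pose a1 := CB + 20; pose a2 := 2 * 10 ^+ 4 * CB * (306 * CB) * 2; pose a3 := 128 * (17 * 320) ^+ 17 : R.
have a10 : 0 < a1 by rewrite /a1; move: cb0; move: CB => x; lra.
have a20 : 0 < a2.
  by rewrite /a2 !mulr_gt0 ?exprn_gt0 ?ltr0n.
have a30 : 0 < a3 by rewrite /a3 mulr_gt0 ?exprn_gt0 ?mulr_gt0 ?ltr0n.
pose S := 2 + a1 + a2 + a3.
have aux (x y z : R) : 0 < x -> 0 < y -> 0 < z -> let w := 2 + x + y + z in
    [/\ 0 < w, 2 <= w, x <= w, y <= w & z <= w] by split; lra.
have [S0 S2 Sa1 Sa2 Sa3] := aux _ _ _ a10 a20 a30; rewrite -/S in S0 S2 Sa1 Sa2 Sa3.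
(* The 2 * p of [spt_upper] is absorbed into a third 10 ^+ 4 * CB / v beside the two of
   [nmult_upper]. *)
exists S^-1, (3 * 10 ^+ 4 * CB); split; first by rewrite invr_gt0.
  by apply: mulr_gt0 => //; apply: mulr_gt0 => //; exact: exprn_gt0.
move=> v n /andP[v0 vS] hn.
have vS1 : v * S <= 1 by rewrite -ler_pdivlMr // div1r.
have vle a : a <= S -> v * a <= 1 by move=> ha; apply: le_trans vS1; rewrite ler_pM2l.
have v2 : v * 2 <= 1 by exact: vle.
have v01 : 0 < v <= 1 / 2 by rewrite v0 /=; lra.
have v_small : (CB + 20) * v <= 1.
  by rewrite mulrC; exact: vle.
have va2 : v * a2 <= 1 by exact: vle.
have va3 : v * a3 <= 1 by exact: vle.
have exp_small : 128 * expR (- (1 / (320 * v))) <= v ^+ 16.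
  apply: (@le_trans _ _ (128 * ((17 * 320) ^+ 17 * v ^+ 17))).
    by apply: ler_wpM2l => //; exact: expRN_inv_le.
  rewrite [v ^+ 17]exprS mulrA -/a3 mulrA [a3 * v]mulrC; apply: ler_piMl => //.
  by rewrite exprn_ge0 // ltW.
set t := v ^+ 5; have t0 : 0 < t by exact: exprn_gt0.
pose m := maxn n.+1 (Num.truncn (4 / t ^+ 3)).+1.
have hmn : (n < m)%N by rewrite leq_maxl.
have hm : 4 / t ^+ 3 <= m%:R.
  have x0 : 0 <= 4 / t ^+ 3 by rewrite divr_ge0 // exprn_ge0 // ltW.
  have /andP[_ h] := truncn_itv x0; apply: le_trans (ltW h) _.
  by rewrite ler_nat leq_maxr.
have low := nmult_lower v01 v_small hn hmn hm exp_small.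
have up := nmult_upper v01 v_small hn hmn hm exp_small.
rewrite npartitionsE; set p := (npart_ge 1 n)%:R in low up *.
have p0 : 0 < p by rewrite ltr0n -npartitionsE npartitions_gt0.
have sl : (nmult 1 n)%:R + (nmult 2 n)%:R <= (spt n)%:R :> R.
  by rewrite -natrD ler_nat spt_lower.
have su : (spt n)%:R <= (nmult 1 n)%:R + 2 * p.
  by rewrite /p -npartitionsE -natrM -natrD ler_nat mul2n spt_upper.
split.
  apply: lt_le_trans sl; apply: lt_le_trans low; rewrite mulrC ltr_pM2l //.
  rewrite -/t -addrA ltrDl subr_gt0 ltr_pdivlMr; last exact: mulr_gt0 (ltr0Sn _ 305) cb0.
  move: va2; have -> : v * a2 = 2 * 10 ^+ 4 * CB * v * (306 * CB) * 2 by rewrite /a2; ring.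
  move: (_ * (306 * CB)) => x; lra.
apply: le_trans su _; have := up; rewrite -/t => h.
have hv : 2 <= 10 ^+ 4 * CB / v.
  rewrite ler_pdivlMr //; apply: (@le_trans _ _ 1); first by rewrite mulrC.
  apply: le_trans cb1 _; rewrite ler_peMl ?(ltW cb0) //.
  by apply: exprn_ege1; rewrite ler1n.
have h2 : p * 2 <= p * (10 ^+ 4 * CB / v) by rewrite ler_pM2l.
have -> : (1 / t + 3 * 10 ^+ 4 * CB / v) * p =
   p * (1 / t + 2 * 10 ^+ 4 * CB / v) + p * (10 ^+ 4 * CB / v) by ring.
by rewrite [2 * p]mulrC; apply: lerD.
Qed.

End asymptotics.

(* N [tuple a; b] is a threshold for every eps bounded below by the positive
   rational a / b, hence in particular for eps = a / b itself. *)
Theorem theorem1p4 (R : realType) :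
  exists2 N : 2.-tuple nat -> nat, recursive N &
  forall eps : R, 0 < eps ->
  forall a b : nat, (0 < a)%N -> (0 < b)%N -> a%:R / b%:R <= eps ->
  (0 < N [tuple a; b])%N /\
  forall n : nat, (N [tuple a; b] <= n)%N ->
    Num.sqrt 6 / pi * Num.sqrt n%:R * (npartitions n)%:R < (spt n)%:R :> R
    /\ (spt n)%:R < (Num.sqrt 6 / pi + eps) * Num.sqrt n%:R
                    * (npartitions n)%:R :> R.
Proof.
have [c0 [C0 [c00 C00 H]]] := spt_bounds R.
(* Besides v <= c0, the bound 1 ensures v ^+ 4 <= v, and (4 * C0)^-1 ensures 2 * C0 * b * v ^+ 4 <=
   1 / 2 once v <= c1 / b. *)
pose c1 := Num.min c0 (Num.min 1 (4 * C0)^-1).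
have c10 : 0 < c1 by rewrite !lt_min c00 ltr01 invr_gt0 mulr_gt0.
pose K := (Num.truncn (3 / c1 ^+ 10)).+1.
have hK : 3 / c1 ^+ 10 < K%:R.
  have x0 : 0 <= 3 / c1 ^+ 10 by rewrite divr_ge0 // exprn_ge0 // ltW.
  by have /andP[] := truncn_itv x0.
(* As v ^+ 10 = zeta(2) / n and zeta(2) <= 3, the condition n >= K * b ^ 10 forces v <= c1 / b. K is
   one fixed natural number, so [recursive_const] covers it. *)
exists (fun x => K * tnth x (inord 1) ^ 10)%N.
  apply: recursive_mul; first exact: recursive_const.
  exact/recursive_exp/rec_proj.
move=> eps eps0 a b a0 b0 hab; rewrite !(tnth_nth 0%N) /= inordK //=.
split; first by rewrite muln_gt0 expn_gt0 b0.
move=> n leN; have n0 : (0 < n)%N by apply: leq_trans leN; rewrite muln_gt0 expn_gt0 b0.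
have nr : 0 < n%:R :> R by rewrite ltr0n.
have br : 0 < b%:R :> R by rewrite ltr0n.
have pi0 := pi_gt0 R; have p3 := pi2_6_le3 R; have pi2 := pi_ge2 R.
pose P : R := pi ^+ 2 / 6; have P0 : 0 < P by rewrite divr_gt0 // exprn_gt0.
(* Chosen so that v ^+ 5 = pi / sqrt (6 n), which makes 1 / v ^+ 5 exactly the required main term
   ([tE]). *)
pose v := (P / n%:R) `^ (10%:R^-1).
have Pn0 : 0 < P / n%:R by rewrite divr_gt0.
have v0 : 0 < v by rewrite powR_gt0.
have v10 : v ^+ 10 = P / n%:R.
  by rewrite -powR_mulrn ?(ltW v0) // -powRrM mulVf ?pnatr_eq0 // powRr1 // ltW.
have vc : v <= c1 / b%:R.
  rewrite -(@ler_pXn2r _ 10) ?nnegrE ?(ltW v0) ?divr_ge0 ?(ltW c10) // v10 expr_div_n.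
  apply: (@le_trans _ _ (3 / n%:R)); first by rewrite ler_pM2r ?invr_gt0.
  rewrite ler_pdivrMr // mulrAC ler_pdivlMr ?exprn_gt0 //.
  have hKn : K%:R * b%:R ^+ 10 <= n%:R :> R by rewrite -natrX -natrM ler_nat.
  apply: (@le_trans _ _ (c1 ^+ 10 * (K%:R * b%:R ^+ 10))); last first.
    by rewrite ler_pM2l ?exprn_gt0.
  rewrite mulrA ler_pM2r ?exprn_gt0 // mulrC -ler_pdivrMr ?exprn_gt0 //.
  exact: ltW.
have b1 : 1 <= b%:R :> R by rewrite ler1n.
have vc1 : v <= c1.
  apply: le_trans vc _; rewrite ler_pdivrMr // ler_peMr //; exact: ltW.
have [h1 h2] : 1 / v ^+ 5 * (npartitions n)%:R < (spt n)%:R /\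
  (spt n)%:R <= (1 / v ^+ 5 + C0 / v) * (npartitions n)%:R.
  apply: H.
    by rewrite v0 /=; apply: le_trans vc1 _; rewrite ge_min lexx.
  by rewrite -exprM v10 -/P invf_div mulrCA divff ?mulr1 // lt0r_neq0.
have tE : 1 / v ^+ 5 = Num.sqrt 6 / pi * Num.sqrt n%:R.
  apply: (@pexpIrn _ 2) => //; rewrite ?nnegrE ?divr_ge0 ?mulr_ge0 ?sqrtr_ge0 ?invr_ge0 ?exprn_ge0 ?(ltW v0) ?(ltW pi0) //.
  rewrite !exprMn !sqr_sqrtr ?ler0n // exprVn -exprM v10 expr1n mul1r exprVn /P.
  move: pi0; move: (pi : R) => x x0; field.
  by rewrite !lt0r_neq0.
rewrite -tE; split=> //; apply: le_lt_trans h2 _; rewrite [(_ + eps) * _]mulrDl -tE.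
have p0 : 0 < (npartitions n)%:R :> R by rewrite ltr0n npartitions_gt0.
rewrite ltr_pM2r // ltrD2l.
have sn : Num.sqrt n%:R = pi / Num.sqrt 6 * (1 / v ^+ 5) :> R.
  rewrite tE; have s6 : 0 < Num.sqrt 6 :> R by rewrite sqrtr_gt0.
  move: pi0 s6; move: (pi : R) (Num.sqrt 6) (Num.sqrt n%:R) => x y z x0 y0.
  by field; rewrite !lt0r_neq0.
have s63 : Num.sqrt 6 <= 3 :> R.
  rewrite -(@ler_pXn2r _ 2) ?nnegrE ?sqrtr_ge0 // sqr_sqrtr //; lra.
have s60 : 0 < Num.sqrt 6 :> R by rewrite sqrtr_gt0.
have epsb : 1 / b%:R <= eps.
  by apply: (le_trans _ hab); rewrite ler_pM2r ?invr_gt0 // ler1n.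
have half : 1 / 2 <= pi / Num.sqrt 6 :> R.
  rewrite ler_pdivlMr //; move: pi2 s63; move: (pi : R) (Num.sqrt 6) => x y; lra.
have v4 : v ^+ 4 <= c1 / b%:R.
  apply: (le_trans _ vc); rewrite -[leRHS]expr1; apply: ler_wiXn2l => //; first exact: ltW.
  by apply: le_trans vc1 _; rewrite !ge_min lexx orbT.
have cC : c1 * (4 * C0) <= 1.
  rewrite -ler_pdivlMr ?mulr_gt0 // div1r; by rewrite !ge_min lexx !orbT.
(* The right side is a lower bound for eps * sqrt n, from eps >= 1 / b and sqrt n = pi / sqrt 6 * (1
   / v ^+ 5) with pi / sqrt 6 >= 1 / 2. *)
have key : C0 / v < 1 / b%:R * (1 / 2 * (1 / v ^+ 5)).
  have -> : 1 / b%:R * (1 / 2 * (1 / v ^+ 5)) = (1 / (2 * b%:R * v ^+ 4)) / v.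
    by field; rewrite !lt0r_neq0.
  rewrite ltr_pM2r ?invr_gt0 // ltr_pdivlMr ?mulr_gt0 ?exprn_gt0 //.
  have : C0 * (2 * b%:R * v ^+ 4) <= C0 * (2 * b%:R * (c1 / b%:R)).
    by rewrite ler_pM2l // ler_pM2l // mulr_gt0.
  have -> : C0 * (2 * b%:R * (c1 / b%:R)) = c1 * (4 * C0) / 2.
    by field; rewrite lt0r_neq0.
  move: cC; move: (c1 * _) (C0 * _) => x y; lra.
apply: lt_le_trans key _; rewrite sn.
have v5 : 0 <= 1 / v ^+ 5 by rewrite divr_ge0 // exprn_ge0 // ltW.
by apply: ler_pM => //; [exact: mulr_ge0|rewrite ler_wpM2r].
Qed.
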